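(* Let $P_{XY_1Y_2Z_1Z_2}$ be a pmf on a finite product alphabet such that $Z_2$ is a constant and $Z_1$ is less noisy than $Y_2$, i.e., for all auxiliary random variables $U$ satisfying the Markov chain $U\to X\to(Y_1,Y_2,Z_1)$, $$I(U;Z_1)\ge I(U;Y_2).$$ Then for every $R_0\ge 0$, $$\mathcal{E}_{\mathrm{GW}}^{\mathrm{SI}}(R_0,R_1=0,R_2=0)=\mathcal{E}_{\mathrm{GW}}^{\mathrm{SI,in}}(R_0,R_1=0,R_2=0),$$ where $\mathcal{E}_{\mathrm{GW}}^{\mathrm{SI}}$ is the (operational) exponents region of the hypothesis testing problem over the Gray-Wyner network with side information and $\mathcal{E}_{\mathrm{GW}}^{\mathrm{SI,in}}$ is the single-letter region, both defined in the context.
   Context: Logarithms are to base 2. All entropies and mutual informations are computed under hypothesis $\mathcal{H}=0$, i.e. with $(X,Y_1,Y_2,Z_1,Z_2)\sim P_{XY_1Y_2Z_1Z_2}$. Hypothesis testing over the Gray-Wyner network with side information. A transmitter observes $X^n$; Receiver $i\in\{1,2\}$ observes $(Y_i^n,Z_i^n)$. Under $\mathcal{H}=0$, $(X^n,Y_1^n,Y_2^n,Z_1^n,Z_2^n)$ is i.i.d. according to $P_{XY_1Y_2Z_1Z_2}$. Under $\mathcal{H}=1$, it is i.i.d. according to $P_{XZ_1Z_2}P_{Y_1|Z_1}P_{Y_2|Z_2}$, where $P_{XZ_1Z_2}$, $P_{Y_1|Z_1}$, $P_{Y_2|Z_2}$ are the marginal and conditional marginals of $P_{XY_1Y_2Z_1Z_2}$.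 The transmitter computes $(M_0,M_1,M_2)=\phi^{(n)}(X^n)$ with a possibly stochastic encoding function $\phi^{(n)}:\mathcal{X}^n\to\{0,\dots,2^{nR_0}\}\times\{0,\dots,2^{nR_1}\}\times\{0,\dots,2^{nR_2}\}$ (where $\{0,\dots,2^{nR}\}$ means the integers between $0$ and $2^{nR}$; the encoder's randomness is independent of everything else). Receiver $i$ observes $M_0$ and $M_i$ noiselessly and outputs the decision $\hat{\mathcal{H}}_i=g_i^{(n)}(Y_i^n,Z_i^n,M_0,M_i)\in\{0,1\}$. The error probabilities are $\alpha_{i,n}=\Pr[\hat{\mathcal{H}}_i=1|\mathcal{H}=0]$ (type I) and $\beta_{i,n}=\Pr[\hat{\mathcal{H}}_i=0|\mathcal{H}=1]$ (type II). For $\epsilon\in(0,1)$, the tuple $(\theta_1,\theta_2,R_0,R_1,R_2)$ is $\epsilon$-achievable if there is a sequence $\{(\phi^{(n)},g_1^{(n)},g_2^{(n)})\}_{n\ge1}$ such that for $i\in\{1,2\}$: $\alpha_{i,n}\le\epsilon$ for all positive integers $n$, and $-\limsup_{n\to\infty}\frac1n\log\beta_{i,n}\ge\theta_i$. The exponents region $\mathcal{E}_{\mathrm{GW}}^{\mathrm{SI}}(R_0,R_1,R_2)$ is the closure of the set of all nonnegative pairs $(\theta_1,\theta_2)$ such that $(\theta_1,\theta_2,R_0,R_1,R_2)$ is $\epsilon$-achievable for every $\epsilon\in(0,1)$. The region $\mathcal{E}_{\mathrm{GW}}^{\mathrm{SI,in}}(R_0,R_1,R_2)$ is the set of all pairs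 $(\theta_1,\theta_2)$ with $\theta_1,\theta_2\ge0$ for which there exist $(U_0,U_1,U_2)$ over finite alphabets with $(U_0,U_1,U_2)\to X\to(Y_1,Y_2,Z_1,Z_2)$ such that $R_0+R_1\ge I(U_0,U_1;X|Z_1)$, $R_0+R_2\ge I(U_0,U_2;X|Z_2)$, $R_0+R_1+R_2\ge\max_{i\in\{1,2\}}I(U_0;X|Z_i)+I(U_1;X|U_0,Z_1)+I(U_2;X|U_0,Z_2)$, $\theta_1\le I(U_1;Y_1|Z_1)$ and $\theta_2\le I(U_2;Y_2|Z_2)$. *)

(* Defs.v *)
From HB Require Import structures.
From mathcomp Require Import all_boot all_order all_algebra.
From mathcomp Require Import all_classical all_reals all_analysis.

Set Implicit Arguments.
Unset Strict Implicit.
Unset Printing Implicit Defensive.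

Import Order.TTheory GRing.Theory Num.Theory.
Import numFieldNormedType.Exports.

Local Open Scope classical_set_scope.
Local Open Scope ring_scope.

Section InformationMeasures.
Context {R : realType}.

Definition is_pmf (T : finType) (p : T -> R) : Prop :=
  (forall t, 0 <= p t) /\ \sum_t p t = 1.

Definition log2 (x : R) : R := ln x / ln 2.

(* [lne 0 = -oo], so that a vanishing error probability has exponent [+oo]. *)
Definition elog2 (x : R) : \bar R := (lne x%:E * ((ln 2)^-1)%:E)%E.

(* Random variables are functions on a finite sample space [W] with pmf [p]. *)
Definition law (W A : finType) (p : W -> R) (f : W -> A) (a : A) : R :=
  \sum_(w | f w == a) p w.

Definition pairRV (W A B : finType) (f : W -> A) (g : W -> B) : W -> A * B :=
  fun w => (f w, g w).

(* As [0 * _ = 0], the terms of probability zero vanish. *)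
Definition mutual_info (W A B : finType) (p : W -> R)
    (f : W -> A) (g : W -> B) : R :=
  \sum_a \sum_b
    law p (pairRV f g) (a, b) *
    log2 (law p (pairRV f g) (a, b) / (law p f a * law p g b)).

(* [I(f ; g | h)] *)
Definition cond_mutual_info (W A B C : finType) (p : W -> R)
    (f : W -> A) (g : W -> B) (h : W -> C) : R :=
  \sum_a \sum_b \sum_c
    law p (pairRV (pairRV f g) h) (a, b, c) *
    log2 (law p (pairRV (pairRV f g) h) (a, b, c) * law p h c /
          (law p (pairRV f h) (a, c) * law p (pairRV g h) (b, c))).

(* [f -> g -> h], i.e. [P(a,b,c) = P(a,b) P(c|b)] with the denominator
   [P(b)] cleared. *)
Definition markov_chain (W A B C : finType) (p : W -> R)
    (f : W -> A) (g : W -> B) (h : W -> C) : Prop :=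
  forall a b c,
    law p (pairRV (pairRV f g) h) (a, b, c) * law p g b =
    law p (pairRV f g) (a, b) * law p (pairRV g h) (b, c).

End InformationMeasures.

Section GrayWyner.
Context {R : realType} {X Y1 Y2 Z1 Z2 : finType}.

Definition letter : finType := (X * Y1 * Y2 * Z1 * Z2)%type.

Definition rvX (s : letter) : X := s.1.1.1.1.
Definition rvY1 (s : letter) : Y1 := s.1.1.1.2.
Definition rvY2 (s : letter) : Y2 := s.1.1.2.
Definition rvZ1 (s : letter) : Z1 := s.1.2.
Definition rvZ2 (s : letter) : Z2 := s.2.

Definition cond_law (A C : finType) (P : letter -> R)
    (f : letter -> A) (h : letter -> C) (a : A) (c : C) : R :=
  law P (pairRV f h) (a, c) / law P h c.

(* The letter law under H = 1, [P_{XZ1Z2} P_{Y1|Z1} P_{Y2|Z2}]; where a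
   conditioning event has probability zero, so does the first factor. *)
Definition alt_law (P : letter -> R) (s : letter) : R :=
  law P (pairRV (pairRV rvX rvZ1) rvZ2) (rvX s, rvZ1 s, rvZ2 s) *
  cond_law P rvY1 rvZ1 (rvY1 s) (rvZ1 s) *
  cond_law P rvY2 rvZ2 (rvY2 s) (rvZ2 s).

Definition iid (n : nat) (Q : letter -> R) (s : {ffun 'I_n -> letter}) : R :=
  \prod_(j < n) Q (s j).

Definition coords (A : finType) (f : letter -> A) (n : nat)
    (s : {ffun 'I_n -> letter}) : {ffun 'I_n -> A} := [ffun j => f (s j)].

(* The integers [{0, ..., 2^(nr)}]; there are [floor (2^(nr)) + 1] of them,
   hence two (not one) at rate [r = 0]. *)
Definition message (n : nat) (r : R) : finType :=
  'I_(Num.truncn (2 `^ (n%:R * r))).+1.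

(* [enc x m] is the probability that the stochastic encoder maps [x] to [m].
   Decisions are booleans, [false] standing for 0 and [true] for 1. *)
Record code (n : nat) (R0 R1 R2 : R) : Type := Code {
  enc : {ffun 'I_n -> X} ->
        (message n R0 * message n R1 * message n R2)%type -> R ;
  enc_pmf : forall x, is_pmf (enc x) ;
  dec1 : {ffun 'I_n -> Y1} -> {ffun 'I_n -> Z1} ->
         message n R0 -> message n R1 -> bool ;
  dec2 : {ffun 'I_n -> Y2} -> {ffun 'I_n -> Z2} ->
         message n R0 -> message n R2 -> bool }.

(* Probability that Receiver 1 (resp. 2) decides [b] when the source letters
   are i.i.d. with law [Q]. *)
Definition prob_dec1 (n : nat) (R0 R1 R2 : R) (c : code n R0 R1 R2)
    (Q : letter -> R) (b : bool) : R :=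
  \sum_(s : {ffun 'I_n -> letter})
    \sum_(m | dec1 c (coords rvY1 s) (coords rvZ1 s) m.1.1 m.1.2 == b)
      iid Q s * enc c (coords rvX s) m.

Definition prob_dec2 (n : nat) (R0 R1 R2 : R) (c : code n R0 R1 R2)
    (Q : letter -> R) (b : bool) : R :=
  \sum_(s : {ffun 'I_n -> letter})
    \sum_(m | dec2 c (coords rvY2 s) (coords rvZ2 s) m.1.1 m.2 == b)
      iid Q s * enc c (coords rvX s) m.

Definition error_exponent (beta : nat -> R) : \bar R :=
  (- limn_esup (fun n => (n%:R^-1)%:E * elog2 (beta n)))%E.

(* The code at [n = 0] is irrelevant. *)
Definition achievable (P : letter -> R) (eps theta1 theta2 R0 R1 R2 : R)
    : Prop :=
  exists c : forall n, code n R0 R1 R2,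
    [/\ forall n, (0 < n)%N -> prob_dec1 (c n) P true <= eps,
        forall n, (0 < n)%N -> prob_dec2 (c n) P true <= eps,
        (theta1%:E <=
           error_exponent (fun n => prob_dec1 (c n) (alt_law P) false))%E &
        (theta2%:E <=
           error_exponent (fun n => prob_dec2 (c n) (alt_law P) false))%E].

Definition exponents_region (P : letter -> R) (R0 R1 R2 : R) : set (R * R) :=
  closure [set t : R * R | [/\ 0 <= t.1, 0 <= t.2 &
    forall eps : R, 0 < eps < 1 ->
      achievable P eps t.1 t.2 R0 R1 R2]].

Definition aux_extension (U : finType) (P : letter -> R)
    (p : (U * letter)%type -> R) : Prop :=
  is_pmf p /\ forall s, law p snd s = P s.

Definition inner_region (P : letter -> R) (R0 R1 R2 : R) : set (R * R) :=
  [set t : R * R | [/\ 0 <= t.1, 0 <= t.2 &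
    exists (A0 A1 A2 : finType) (p : (A0 * A1 * A2 * letter)%type -> R),
      let U0 (w : A0 * A1 * A2 * letter) := w.1.1.1 in
      let U1 (w : A0 * A1 * A2 * letter) := w.1.1.2 in
      let U2 (w : A0 * A1 * A2 * letter) := w.1.2 in
      let x (w : A0 * A1 * A2 * letter) := rvX w.2 in
      let y1 (w : A0 * A1 * A2 * letter) := rvY1 w.2 in
      let y2 (w : A0 * A1 * A2 * letter) := rvY2 w.2 in
      let z1 (w : A0 * A1 * A2 * letter) := rvZ1 w.2 in
      let z2 (w : A0 * A1 * A2 * letter) := rvZ2 w.2 in
      [/\ aux_extension P p,
          markov_chain p (pairRV (pairRV U0 U1) U2) x
            (pairRV (pairRV (pairRV y1 y2) z1) z2),
          [/\ cond_mutual_info p (pairRV U0 U1) x z1 <= R0 + R1,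
              cond_mutual_info p (pairRV U0 U2) x z2 <= R0 + R2 &
              Num.max (cond_mutual_info p U0 x z1)
                      (cond_mutual_info p U0 x z2)
                + cond_mutual_info p U1 x (pairRV U0 z1)
                + cond_mutual_info p U2 x (pairRV U0 z2)
                <= R0 + R1 + R2],
          t.1 <= cond_mutual_info p U1 y1 z1 &
          t.2 <= cond_mutual_info p U2 y2 z2]]].

Definition less_noisy_Z1_Y2 (P : letter -> R) : Prop :=
  forall (A : finType) (p : (A * letter)%type -> R),
    let U (w : A * letter) := w.1 in
    let x (w : A * letter) := rvX w.2 in
    let y1 (w : A * letter) := rvY1 w.2 in
    let y2 (w : A * letter) := rvY2 w.2 in
    let z1 (w : A * letter) := rvZ1 w.2 in
    aux_extension P p ->
    markov_chain p U x (pairRV (pairRV y1 y2) z1) ->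
    mutual_info p U z1 >= mutual_info p U y2.

Definition constant_Z2 (P : letter -> R) : Prop :=
  exists z2 : Z2, law P rvZ2 z2 = 1.

End GrayWyner.

Arguments letter : clear implicits.

(* Main.v *)
(* Converse. A change of measure bounds each exponent by [n^-1] times the
   n-letter mutual information of the messages, up to a factor [1 - eps].
   With [V_t = (M, Y2^{t-1}, Z1_{t+1}^n)] and [W_t = (M, L^{t-1}, Z1_{t+1}^n)],
   [L] being the whole letter, Csiszar's sum identity turns the rate constraint into
   [theta2 + (I(V; Z1) - I(V; Y2)) + I(W; X | Z1) <= R0].
   Caratheodory's theorem bounds the alphabets, so that the slack vanishes along
   an ultrafilter. Erasing [V] with a suitable probability brings [I(V; Y2)] down
   to [theta2] and, [Z1] being less noisy than [Y2], [I(V; Z1)] down by at least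
   as much; [U0 = U2 =] the erased [V] and [U1 = W] satisfy the constraints.

   Direct part. With [V = (U0, U2)] and [W = U1], a random superposition code is
   used with a likelihood encoder: the index of [V^n] is sent as it is, that of
   [W^n] only through its bin, and Receiver 1 lists the words of the bin that are
   compatible with [Z1^n]. The receivers run likelihood-ratio tests, and all error
   terms are controlled by Chebyshev's inequality. Erasing [V] and [W] together
   gives the strict inequality between rates that the code needs. *)

Require Import Defs.
From HB Require Import structures.
From mathcomp Require Import all_boot all_order all_algebra.
From mathcomp Require Import all_classical all_reals all_analysis.
From mathcomp Require Import ring lra.

Set Implicit Arguments.
Unset Strict Implicit.
Unset Printing Implicit Defensive.

Import Order.TTheory GRing.Theory Num.Theory.
Import numFieldNormedType.Exports.

Local Open Scope ring_scope.

(** * Entropies *)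

(** The converse meets an obstacle at Receiver 2: Csiszar's identity charges the rate with
    [n^-1 I(M; Y2^n)], which may be smaller than [I(V; Y2)], so the single-letter constraint does
    not pay for the whole of [I(V; Z1)]. The erasure removes this gap, since it multiplies the
    nonnegative [I(V; Z1) - I(V; Y2)] by a factor at most 1. [W] carries whole past letters so that
    it determines [V]; then [I(U0; X) + I(U1; X | U0, Z1)] collapses to [I(U0; Z1) + I(U1; X | Z1)],
    the quantity that the identity controls.

    In the direct part, covering [X^n] takes [I(V, W; X)] bits: [I(V; X)] for the index of [V^n],
    [I(W; X | V, Z1)] for the bin of [W^n], and [I(W; Z1 | V)] for the words within a bin. Receiver
    1 does not decode: it accepts when some listed word passes, and as the mean list is bounded,
    type II errors lose a constant factor only. Encoding failures are signalled by the second value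
    that a message of rate zero still has; both receivers then reject, which affects type I errors
    alone. *)

Section Log.
Context {R : realType}.
Implicit Types x y : R.

(** As [ln] is 0 on nonpositive reals, this is [-x log x] extended by 0, which is continuous on the
    whole line. *)
Definition xlog x : R := - (x * log2 x).

Lemma ln2_gt0 : 0 < ln 2 :> R.
Proof. by rewrite ln_gt0// ltr1n. Qed.

Lemma log2_le0 x : x <= 0 -> log2 x = 0.
Proof. by move=> x0; rewrite /log2 ln0 ?mul0r. Qed.

Lemma log2M x y : 0 < x -> 0 < y -> log2 (x * y) = log2 x + log2 y.
Proof. by move=> x0 y0; rewrite /log2 lnM ?posrE// mulrDl. Qed.

Lemma log2V x : 0 < x -> log2 x^-1 = - log2 x.
Proof. by move=> x0; rewrite /log2 lnV ?posrE// mulNr. Qed.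

Lemma log2_div x y : 0 < x -> 0 < y -> log2 (x / y) = log2 x - log2 y.
Proof. by move=> x0 y0; rewrite log2M ?invr_gt0// log2V. Qed.

Lemma log21 : log2 1 = 0 :> R.
Proof. by rewrite /log2 ln1 mul0r. Qed.

Lemma log2_powR x : log2 (2 `^ x) = x.
Proof. by rewrite /log2 ln_powR mulfK// gt_eqF// ln2_gt0. Qed.

Lemma ler_log2 x y : 0 < x -> x <= y -> log2 x <= log2 y.
Proof.
move=> x0 xy; rewrite /log2; apply: ler_wpM2r; first by rewrite invr_ge0 ltW ?ln2_gt0.
by rewrite ler_ln ?posrE//; exact: lt_le_trans xy.
Qed.

Lemma xlog0 : xlog 0 = 0.
Proof. by rewrite /xlog mul0r oppr0. Qed.

Lemma xlog1 : xlog 1 = 0.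
Proof. by rewrite /xlog log21 mulr0 oppr0. Qed.

(** The entropy function obeys a Leibniz rule; it yields the chain rule for mixtures and the
    homogeneity of [column_diff]. *)
Lemma xlogM x y : 0 <= x -> 0 <= y -> xlog (x * y) = x * xlog y + y * xlog x.
Proof.
rewrite le_eqVlt => /predU1P[<- _|x0]; first by rewrite mul0r xlog0 !(mul0r, mulr0) addr0.
rewrite le_eqVlt => /predU1P[<-|y0]; first by rewrite mulr0 xlog0 !(mul0r, mulr0) addr0.
by rewrite /xlog log2M//; ring.
Qed.

(** Merging two atoms loses entropy, because each logarithm only grows. *)
Lemma xlogD x y : 0 <= x -> 0 <= y -> xlog (x + y) <= xlog x + xlog y.
Proof.
rewrite le_eqVlt => /predU1P[<- _|x0]; first by rewrite xlog0 !add0r.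
rewrite le_eqVlt => /predU1P[<-|y0]; first by rewrite xlog0 !addr0.
rewrite /xlog mulrDl -opprD lerN2; apply: lerD; rewrite ler_pM2l//;
  by rewrite ler_log2// ?lerDl ?lerDr ltW.
Qed.

Lemma xlog_sum (I : Type) (r : seq I) (P : pred I) (F : I -> R) :
  (forall i, P i -> 0 <= F i) ->
  xlog (\sum_(i <- r | P i) F i) <= \sum_(i <- r | P i) xlog (F i).
Proof.
move=> F0.
suff [] : 0 <= \sum_(i <- r | P i) F i /\
  xlog (\sum_(i <- r | P i) F i) <= \sum_(i <- r | P i) xlog (F i) by [].
elim/big_rec2 : _ => [|i y1 y2 Pi [y20 y21]]; first by rewrite xlog0 !lexx.
split; first by rewrite addr_ge0 ?F0.
by apply: le_trans (xlogD _ _) _; rewrite ?F0// lerD2l.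
Qed.

(* The Gibbs inequality, term by term. *)
Lemma ler_mul_log2 x y : 0 <= x -> 0 <= y -> (0 < x -> 0 < y) ->
  (x - y) / ln 2 <= x * log2 (x / y).
Proof.
rewrite le_eqVlt => /predU1P[<- y0 _|x0 _ /(_ x0) y0].
  by rewrite mul0r sub0r mulNr oppr_le0 divr_ge0// ltW// ln2_gt0.
rewrite /log2 mulrA; apply: ler_wpM2r; first by rewrite invr_ge0 ltW ?ln2_gt0.
rewrite -[ln _]opprK -lnV ?posrE ?divr_gt0// invf_div.
have := @le_ln1Dx R (y / x - 1).
rewrite [1 + _]addrC subrK ltrBrDr addNr divr_gt0// => /(_ isT) h.
rewrite mulrN lerNr opprB.
apply: (@le_trans _ _ (x * (y / x - 1))); first by rewrite ler_wpM2l// ltW.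
by rewrite mulrBr mulr1 mulrCA divff ?gt_eqF// mulr1.
Qed.

End Log.

Lemma sum_pair {V : nmodType} (A B : finType) (F : A * B -> V) :
  \sum_u F u = \sum_a \sum_b F (a, b).
Proof. by rewrite pair_bigA; apply: eq_bigr => -[]. Qed.

Section Entropy.
Context {R : realType} (W : finType).

Definition entropy (A : finType) (p : W -> R) (f : W -> A) : R := \sum_a xlog (law p f a).

(* [mi_diff p U f g = I(U; f) - I(U; g)], that is [I(U; f | g)] when [g] is a
   function of [f]. *)
Definition mi_diff (A B C : finType) (p : W -> R) (U : W -> A) (f : W -> B) (g : W -> C) : R :=
  (entropy p f - entropy p g) - (entropy p (pairRV U f) - entropy p (pairRV U g)).

(** Dependence up to null sets: only atoms of nonzero mass are compared, so that a variable that is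
    constant with probability one is determined by any other. *)
Definition determines (A B : finType) (p : W -> R) (f : W -> A) (g : W -> B) :=
  forall w w', p w != 0 -> p w' != 0 -> f w = f w' -> g w = g w'.

End Entropy.

Section Law.
Context {R : realType} {W : finType}.
Implicit Types (p : W -> R).

Lemma sum_indicator p (A : pred W) : \sum_(w | A w) p w = \sum_w p w * (A w)%:R.
Proof. by rewrite big_mkcond; apply: eq_bigr => w _; case: (A w); rewrite ?mulr1 ?mulr0. Qed.

Lemma law_ge0 (A : finType) p (f : W -> A) a :
  (forall w, 0 <= p w) -> 0 <= law p f a.
Proof. by move=> p0; rewrite /law sumr_ge0. Qed.

Lemma sum_law (A : finType) p (f : W -> A) (phi : A -> R) :
  \sum_w p w * phi (f w) = \sum_a law p f a * phi a.
Proof.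
rewrite (partition_big f xpredT)//=; apply: eq_bigr => a _.
by rewrite /law mulr_suml; apply: eq_bigr => w /eqP ->.
Qed.

Lemma sum_law1 (A : finType) p (f : W -> A) : \sum_a law p f a = \sum_w p w.
Proof.
under eq_bigr do rewrite -[law _ _ _]mulr1.
by rewrite -sum_law; apply: eq_bigr => w _; rewrite mulr1.
Qed.

Lemma law_comp (A B : finType) p (f : W -> A) (g : A -> B) :
  law (law p f) g = law p (g \o f).
Proof.
apply/funext => b; rewrite /law (partition_big f (fun a => g a == b))//=.
apply: eq_bigr => a gab; apply: eq_bigl => w.
by case: eqP => [->|]; rewrite ?gab// andbF.
Qed.

Lemma law_compE (A B : finType) p (f : W -> A) (g : A -> B) b :
  law p (fun w => g (f w)) b = \sum_(a | g a == b) law p f a.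
Proof. by rewrite -[RHS]/(law (law p f) g b) law_comp. Qed.

Lemma law_suml (A B : finType) p (f : W -> A) (g : W -> B) b :
  law p g b = \sum_a law p (pairRV f g) (a, b).
Proof.
rewrite -[g]/(fun w => (pairRV f g w).2) law_compE.
rewrite (reindex_onto (fun a => (a, b)) (fun x => x.1)) /=; last first.
  by move=> [a' b'] /= /eqP ->.
by apply: eq_bigl => a; rewrite !eqxx.
Qed.

Lemma law_sumr (A B : finType) p (f : W -> A) (g : W -> B) a :
  law p f a = \sum_b law p (pairRV f g) (a, b).
Proof.
rewrite -[f]/(fun w => (pairRV f g w).1) law_compE.
rewrite (reindex_onto (fun b => (a, b)) (fun x => x.2)) /=; last first.
  by move=> [a' b'] /= /eqP ->.
by apply: eq_bigl => b; rewrite !eqxx.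
Qed.

Lemma law_eq0P (A : finType) p (f : W -> A) a : (forall w, 0 <= p w) ->
  law p f a != 0 -> exists2 w, p w != 0 & f w = a.
Proof.
move=> p0 h; apply/not_exists2P => H; move/eqP: h; apply.
by apply: big1 => w /eqP fwa; apply/eqP; case: (H w) => // /negP; rewrite negbK.
Qed.

Lemma law_gt0_comp (A B : finType) p (f : W -> A) (g : A -> B) a :
  (forall w, 0 <= p w) -> 0 < law p f a -> 0 < law p (g \o f) (g a).
Proof.
move=> p0 h; apply: lt_le_trans h _; rewrite -law_comp /law.
rewrite [leRHS](bigD1 a)//= -[leLHS]addr0 lerD// sumr_ge0// => b _.
exact: sumr_ge0.
Qed.

Lemma entropyE (A : finType) p (f : W -> A) :
  entropy p f = - \sum_w p w * log2 (law p f (f w)).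
Proof.
rewrite (sum_law p f (fun a => log2 (law p f a))) -sumrN; exact: eq_bigr.
Qed.

(** Both sides are compared with the sum of [xlog] over the joint masses. Subadditivity bounds the
    left side by it; for each value of [g] at most one value of [f] has positive joint mass, so it
    is at most the right side. *)
Lemma entropy_det (A B : finType) p (f : W -> A) (g : W -> B) :
  (forall w, 0 <= p w) ->
  (forall w w', p w != 0 -> p w' != 0 -> g w = g w' -> f w = f w') ->
  entropy p f <= entropy p g.
Proof.
move=> p0 H.
apply: (@le_trans _ _ (\sum_a \sum_b xlog (law p (pairRV f g) (a, b)))).
  apply: ler_sum => a _; rewrite (law_sumr p f g a).
  by apply: xlog_sum => b _; exact: law_ge0.
rewrite exchange_big/=; apply: ler_sum => b _.
have [gb0|/law_eq0P] := eqVneq (law p g b) 0.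
  rewrite gb0 xlog0 big1// => a _.
  have := gb0; rewrite (law_suml p f g b) => /eqP.
  rewrite psumr_eq0; last by move=> *; exact: law_ge0.
  by move=> /allP/(_ a); rewrite mem_index_enum => /(_ isT)/eqP ->; rewrite xlog0.
move=> /(_ p0)[w pw gw].
have e0 a : a != f w -> law p (pairRV f g) (a, b) = 0.
  move=> afw; apply: contraNeq afw => /law_eq0P => /(_ p0)[w' pw' [fw' gw']].
  by rewrite -fw'; apply/eqP/H => //; rewrite gw gw'.
rewrite (law_suml p f g b) (bigD1 (f w))//= big1; last first.
  by move=> a afw; rewrite e0// xlog0.
by rewrite [X in _ <= xlog X](bigD1 (f w))//= big1 ?addr0// => a /e0.
Qed.

Lemma entropy_eq (A B : finType) p (f : W -> A) (g : W -> B) :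
  (forall w, 0 <= p w) ->
  (forall w w', p w != 0 -> p w' != 0 -> (g w = g w' <-> f w = f w')) ->
  entropy p f = entropy p g.
Proof.
move=> p0 H; apply/eqP; rewrite eq_le; apply/andP; split;
  by apply: entropy_det => // w w' pw pw' /H; apply.
Qed.

Lemma entropy_law (A B : finType) p (f : W -> A) (g : A -> B) :
  entropy (law p f) g = entropy p (g \o f).
Proof. by rewrite /entropy law_comp. Qed.

Lemma mutual_infoE (A B : finType) p (f : W -> A) (g : W -> B) :
  (forall w, 0 <= p w) ->
  mutual_info p f g = entropy p f + entropy p g - entropy p (pairRV f g).
Proof.
move=> p0; rewrite !entropyE /mutual_info pair_big/=.
pose phi (x : A * B) := log2 (law p (pairRV f g) x) - log2 (law p f x.1) - log2 (law p g x.2).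
transitivity (\sum_x law p (pairRV f g) x * phi x).
  apply: eq_bigr => -[a b] _ /=.
  have := @law_ge0 _ p (pairRV f g) (a, b) p0; rewrite le_eqVlt => /predU1P[<-|h].
    by rewrite !mul0r.
  have ha := law_gt0_comp fst p0 h; have hb := law_gt0_comp snd p0 h.
  rewrite /= in ha hb.
  rewrite log2_div ?mulr_gt0// log2M// /phi/=.
  by rewrite opprD addrA.
rewrite -sum_law -!sumrN -!big_split/=; apply: eq_bigr => w _.
by rewrite /phi /=; ring.
Qed.

Lemma cond_mutual_infoE (A B C : finType) p (f : W -> A) (g : W -> B) (h : W -> C) :
  (forall w, 0 <= p w) ->
  cond_mutual_info p f g h = entropy p (pairRV f h) + entropy p (pairRV g h)
    - entropy p (pairRV (pairRV f g) h) - entropy p h.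
Proof.
move=> p0; rewrite !entropyE /cond_mutual_info.
pose phi (x : A * B * C) := log2 (law p (pairRV (pairRV f g) h) x) + log2 (law p h x.2)
   - log2 (law p (pairRV f h) (x.1.1, x.2)) - log2 (law p (pairRV g h) (x.1.2, x.2)).
transitivity (\sum_x law p (pairRV (pairRV f g) h) x * phi x).
  rewrite pair_big pair_big/=; apply: eq_bigr => -[[a b] c] _ /=.
  have := @law_ge0 _ p (pairRV (pairRV f g) h) (a, b, c) p0.
  rewrite le_eqVlt => /predU1P[<-|k]; first by rewrite !mul0r.
  have hc := law_gt0_comp snd p0 k.
  have hac := law_gt0_comp (fun x => (x.1.1, x.2)) p0 k.
  have hbc := law_gt0_comp (fun x => (x.1.2, x.2)) p0 k.
  rewrite /= in hc hac hbc.
  rewrite log2_div ?mulr_gt0// !log2M// /phi/= opprD addrA.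
  by [].
rewrite -sum_law -!sumrN -!big_split/=; apply: eq_bigr => w _.
by rewrite /phi /=; ring.
Qed.

(** Gibbs' inequality against the law [q] that makes [f] and [g] independent given [h]. Both laws
    have the total mass of [p], so the linear lower bounds sum to zero. *)
Lemma cond_mutual_info_ge0 (A B C : finType) p (f : W -> A) (g : W -> B) (h : W -> C) :
  (forall w, 0 <= p w) -> 0 <= cond_mutual_info p f g h.
Proof.
move=> p0; rewrite /cond_mutual_info.
set T := pairRV (pairRV f g) h.
pose q a b c := law p (pairRV f h) (a, c) * law p (pairRV g h) (b, c) / law p h c.
have step a b c : (law p T (a, b, c) - q a b c) / ln 2 <=
  law p T (a, b, c) * log2 (law p T (a, b, c) * law p h c /
    (law p (pairRV f h) (a, c) * law p (pairRV g h) (b, c))).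
  apply: le_trans (ler_mul_log2 _ _ _) _.
  - exact: law_ge0.
  - by rewrite /q divr_ge0 ?mulr_ge0 ?law_ge0.
  - move=> k; have hc := law_gt0_comp snd p0 k.
    have hac := law_gt0_comp (fun x => (x.1.1, x.2)) p0 k.
    have hbc := law_gt0_comp (fun x => (x.1.2, x.2)) p0 k.
    by rewrite /q divr_gt0 ?mulr_gt0.
  - by rewrite /q invf_div (mulrA (law p T _) (law p h c)).
apply: le_trans (ler_sum _ (fun a _ => ler_sum _ (fun b _ => ler_sum _ (fun c _ => step a b c)))).
suff -> : \sum_a \sum_b \sum_c (law p T (a, b, c) - q a b c) / ln 2 = 0 by [].
transitivity ((\sum_a \sum_b \sum_c law p T (a, b, c) - \sum_a \sum_b \sum_c q a b c) / ln 2).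
  rewrite -sumrB mulr_suml; apply: eq_bigr => a _.
  rewrite -sumrB mulr_suml; apply: eq_bigr => b _.
  by rewrite -sumrB mulr_suml.
suff -> : \sum_a \sum_b \sum_c law p T (a, b, c) = \sum_a \sum_b \sum_c q a b c.
  by rewrite subrr mul0r.
rewrite pair_big pair_big/=.
under eq_bigr do rewrite -!surjective_pairing.
rewrite sum_law1 -(sum_law1 p h).
under [RHS]eq_bigr do rewrite exchange_big/=.
rewrite exchange_big/=; apply: eq_bigr => c _.
under eq_bigr do rewrite /q -mulr_suml -mulr_sumr -law_suml.
rewrite -mulr_suml -mulr_suml -law_suml.
by have [->|hc] := eqVneq (law p h c) 0; rewrite ?mul0r// mulfK.
Qed.

Lemma entropy_submod (A B C : finType) p (f : W -> A) (g : W -> B) (h : W -> C) :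
  (forall w, 0 <= p w) ->
  entropy p (pairRV (pairRV f g) h) + entropy p h
    <= entropy p (pairRV f h) + entropy p (pairRV g h).
Proof.
move=> p0; have := cond_mutual_info_ge0 f g h p0.
by rewrite cond_mutual_infoE// -addrA -opprD subr_ge0.
Qed.

Lemma mi_diffN (A B C : finType) p (U : W -> A) (f : W -> B) (g : W -> C) :
  mi_diff p U f g = - mi_diff p U g f.
Proof. by rewrite /mi_diff; ring. Qed.

Lemma mi_diffD (A B C D : finType) p (U : W -> A) (f : W -> B) (g : W -> C) (h : W -> D) :
  mi_diff p U f h = mi_diff p U f g + mi_diff p U g h.
Proof. by rewrite /mi_diff; ring. Qed.

Lemma determines_pair (A B C D : finType) p (f : W -> A) (g : W -> B)
    (f' : W -> C) (g' : W -> D) :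
  determines p f f' -> determines p g g' ->
  determines p (pairRV f g) (pairRV f' g').
Proof.
move=> ff' gg' w w' pw pw' [] /(ff' _ _ pw pw') fw /(gg' _ _ pw pw') gw.
by rewrite /pairRV fw gw.
Qed.

Lemma entropy_determines (A B : finType) p (f : W -> A) (g : W -> B) :
  (forall w, 0 <= p w) -> determines p f g -> determines p g f ->
  entropy p f = entropy p g.
Proof.
by move=> p0 fg gf; apply: entropy_eq => // w w' pw pw'; split; [exact: gf|exact: fg].
Qed.

End Law.

(** For two tuples with the same components up to order, nesting and repetition. *)
Ltac same_info := by apply: entropy_determines => // ? ? _ _; rewrite /pairRV/= => ?; congruence.

Section MutualInformation.
Context {R : realType} {W : finType}.
Implicit Types (p : W -> R).

Lemma eq_mi_diff (A A' B B' C C' : finType) p (U : W -> A) (U' : W -> A')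
   (f : W -> B) (f' : W -> B') (g : W -> C) (g' : W -> C') :
  (forall w, 0 <= p w) ->
  determines p U U' -> determines p U' U ->
  determines p f f' -> determines p f' f ->
  determines p g g' -> determines p g' g ->
  mi_diff p U f g = mi_diff p U' f' g'.
Proof.
move=> p0 uu' u'u ff' f'f gg' g'g; rewrite /mi_diff.
by congr (_ - _ - (_ - _)); apply: entropy_determines => //; exact: determines_pair.
Qed.

(** As [f] determines [g], both sides are conditional informations given [g]; they differ by
    [I(U'; f | U, g)], which [entropy_submod] makes nonnegative. *)
Lemma mi_diff_monoU (A A' B C : finType) p (U : W -> A) (U' : W -> A')
    (f : W -> B) (g : W -> C) :
  (forall w, 0 <= p w) -> determines p f g -> determines p U' U ->
  mi_diff p U f g <= mi_diff p U' f g.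
Proof.
move=> p0 fg UU; rewrite /mi_diff lerD2l lerN2.
have := entropy_submod f U' (pairRV U g) p0.
have -> : entropy p (pairRV (pairRV f U') (pairRV U g)) = entropy p (pairRV U' f).
  apply: entropy_eq => // w w' pw pw'; rewrite /pairRV; split=> [[u fw]|[fw u _ _]].
    by rewrite fw u (UU w w')// (fg w w').
  by rewrite fw u.
have -> : entropy p (pairRV f (pairRV U g)) = entropy p (pairRV U f).
  apply: entropy_eq => // w w' pw pw'; rewrite /pairRV; split=> [[uw fw]|[fw uw _]].
    by rewrite uw fw (fg w w').
  by rewrite uw fw.
have -> : entropy p (pairRV U' (pairRV U g)) = entropy p (pairRV U' g).
  apply: entropy_eq => // w w' pw pw'; rewrite /pairRV; split=> [[u gw]|[u _ gw]].
    by rewrite u gw (UU w w').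
  by rewrite u gw.
by move=> h; lra.
Qed.

Lemma mi_diff_cst (A B C : finType) p (c : A) (f : W -> B) (g : W -> C) :
  (forall w, 0 <= p w) -> mi_diff p (fun=> c) f g = 0.
Proof.
move=> p0; rewrite /mi_diff.
have -> : entropy p (pairRV (fun=> c) f) = entropy p f by same_info.
have -> : entropy p (pairRV (fun=> c) g) = entropy p g by same_info.
by rewrite subrr.
Qed.

Lemma mi_diff_ge0 (A B C : finType) p (U : W -> A) (f : W -> B) (g : W -> C) :
  (forall w, 0 <= p w) -> determines p f g -> 0 <= mi_diff p U f g.
Proof.
by move=> p0 fg; have := @mi_diff_monoU _ _ _ _ p (fun=> tt) U f g p0 fg; rewrite mi_diff_cst//; apply.
Qed.

Lemma entropy_cst p : \sum_w p w = 1 -> entropy p (fun=> tt) = 0.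
Proof.
by move=> p1; rewrite /entropy big1// => -[] _; rewrite /law (eq_bigl xpredT)// p1 xlog1.
Qed.

Lemma mutual_info_mi_diff (A B : finType) p (f : W -> A) (g : W -> B) :
  is_pmf p -> mutual_info p f g = mi_diff p f g (fun=> tt).
Proof.
move=> [p0 p1]; rewrite mutual_infoE// /mi_diff.
have -> : entropy p (pairRV f (fun=> tt)) = entropy p f by same_info.
by rewrite entropy_cst//; ring.
Qed.

Lemma cond_mutual_info_mi_diff (A B C : finType) p (f : W -> A) (g : W -> B)
    (h : W -> C) : (forall w, 0 <= p w) ->
  cond_mutual_info p f g h = mi_diff p f (pairRV g h) h.
Proof.
move=> p0; rewrite cond_mutual_infoE// /mi_diff.
have -> : entropy p (pairRV f (pairRV g h)) = entropy p (pairRV (pairRV f g) h) by same_info.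
by ring.
Qed.

End MutualInformation.

Section Mixture.
Context {R : realType} {T W : finType}.

Lemma law_mixture (A : finType) (pi : T -> R) (p : W -> R) (G : T -> W -> A) t a :
  law (fun w : T * W => pi w.1 * p w.2) (fun w => (w.1, G w.1 w.2)) (t, a)
  = pi t * law p (G t) a.
Proof.
rewrite /law mulr_sumr [RHS]big_mkcond/= [LHS]big_mkcond.
rewrite -(pair_bigA _ (fun i j => if (i, G i j) == (t, a) then pi i * p j else 0))/=.
rewrite (bigD1 t)//= [X in _ + X]big1 ?addr0; last first.
  by move=> i it; rewrite big1// => w _; rewrite xpair_eqE (negbTE it).
by apply: eq_bigr => w _; rewrite xpair_eqE eqxx.
Qed.

Lemma entropy_mixture (A : finType) (pi : T -> R) (p : W -> R) (G : T -> W -> A) :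
  (forall t, 0 <= pi t) -> (forall w, 0 <= p w) ->
  entropy (fun w : T * W => pi w.1 * p w.2) (fun w => (w.1, G w.1 w.2))
  = \sum_t pi t * entropy p (G t) + (\sum_w p w) * \sum_t xlog (pi t).
Proof.
move=> pi0 p0; rewrite mulr_sumr -big_split/= /entropy.
rewrite (eq_bigr (fun x => xlog (pi x.1 * law p (G x.1) x.2))); last first.
  by move=> [t a] _; rewrite law_mixture.
rewrite -(pair_bigA _ (fun t a => xlog (pi t * law p (G t) a)))/=.
apply: eq_bigr => t _.
rewrite -(sum_law1 p (G t)) mulr_suml mulr_sumr -big_split/=.
by apply: eq_bigr => a _; rewrite xlogM// law_ge0.
Qed.

Lemma law_snd (pi : T -> R) (p : W -> R) (A : finType) (f : W -> A) :
  \sum_t pi t = 1 -> law (fun w : T * W => pi w.1 * p w.2) (f \o snd) = law p f.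
Proof.
move=> pi1; apply/funext => a; rewrite /law.
rewrite [LHS]big_mkcond.
rewrite -(pair_bigA _ (fun i j => if f j == a then pi i * p j else 0))/= exchange_big/=.
rewrite [RHS]big_mkcond; apply: eq_bigr => w _; case: ifP => // _.
  by rewrite -mulr_suml pi1 mul1r.
by rewrite big1.
Qed.

(** The hypotheses on entropies hold for the letters of an i.i.d. sequence under a random index. As
    the index is part of the auxiliary, its own entropy enters both joint entropies and cancels. *)
Lemma mi_diff_mixture (A B C : finType) (pi : T -> R) (p : W -> R)
    (U : T -> W -> A) (f : T -> W -> B) (g : T -> W -> C) :
  is_pmf pi -> (forall w, 0 <= p w) ->
  let q := (fun w : T * W => pi w.1 * p w.2) in
  (forall t, entropy p (f t) = entropy q (fun w => f w.1 w.2)) ->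
  (forall t, entropy p (g t) = entropy q (fun w => g w.1 w.2)) ->
  mi_diff q (fun w => (w.1, U w.1 w.2)) (fun w => f w.1 w.2) (fun w => g w.1 w.2)
  = \sum_t pi t * mi_diff p (U t) (f t) (g t).
Proof.
move=> [pi0 pi1] p0 q ef eg; rewrite /mi_diff.
have q0 w : 0 <= q w by rewrite /q mulr_ge0.
have E (D : finType) (k : T -> W -> D) :
    entropy q (pairRV (fun w => (w.1, U w.1 w.2)) (fun w => k w.1 w.2))
  = \sum_t pi t * entropy p (pairRV (U t) (k t)) + (\sum_w p w) * \sum_t xlog (pi t).
  rewrite -(entropy_mixture (fun t => pairRV (U t) (k t)))//.
  same_info.
rewrite !E.
under [RHS]eq_bigr do rewrite ef eg mulrBr.
rewrite [RHS]sumrB -mulr_suml pi1 mul1r.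
under [X in _ = _ - X]eq_bigr do rewrite mulrBr.
by rewrite sumrB; ring.
Qed.

End Mixture.

(** * Product laws *)

Section Product.
Context {R : realType} {I T : finType}.
Implicit Types (Q : T -> R) (s : {ffun I -> T}).

Definition prodm Q s : R := \prod_i Q (s i).

Definition fcomp (A : finType) (f : T -> A) s : {ffun I -> A} := [ffun i => f (s i)].

Definition upd s (i : I) (t : T) : {ffun I -> T} :=
  [ffun j => if j == i then t else s j].

Lemma prodm_ge0 Q s : (forall t, 0 <= Q t) -> 0 <= prodm Q s.
Proof. by move=> Q0; apply: prodr_ge0 => i _. Qed.

Lemma sum_prodm Q : \sum_t Q t = 1 -> \sum_s prodm Q s = 1.
Proof.
move=> Q1; rewrite /prodm -(bigA_distr_bigA (fun (_ : I) t => Q t))/=.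
by rewrite big1.
Qed.

Lemma prodm_pmf Q : is_pmf Q -> is_pmf (prodm Q).
Proof. by move=> [Q0 Q1]; split=> [s|]; [exact: prodm_ge0|exact: sum_prodm]. Qed.

Lemma law_prodm (A : finType) Q (f : T -> A) (u : {ffun I -> A}) :
  law (prodm Q) (fcomp f) u = \prod_i law Q f (u i).
Proof.
rewrite /law.
have /= -> := bigA_distr_big_dep (fun i t => f t == u i) (fun (_ : I) t => Q t).
apply: eq_bigl => s; apply/eqP/familyP => [<- i|H].
  by rewrite unfold_in/= ffunE.
by apply/ffunP => i; rewrite ffunE; apply/eqP; have := H i; rewrite unfold_in.
Qed.

Lemma prodm_upd Q s i t : prodm Q (upd s i t) * Q (s i) = prodm Q s * Q t.
Proof.
rewrite /prodm (bigD1 i)//= [in RHS](bigD1 i)//= ffunE eqxx.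
rewrite (eq_bigr (fun j => Q (s j))); first by ring.
by move=> j ji; rewrite ffunE (negbTE ji).
Qed.

(** Exchanging coordinate [i] with a fresh letter is an involution that preserves the product
    law. *)
Lemma resample Q i (F : {ffun I -> T} -> R) : \sum_t Q t = 1 ->
  \sum_s prodm Q s * F s = \sum_s prodm Q s * \sum_t Q t * F (upd s i t).
Proof.
move=> Q1.
under [RHS]eq_bigr do rewrite mulr_sumr.
rewrite pair_big/=.
pose h (x : {ffun I -> T} * T) := (upd x.1 i x.2, x.1 i).
have hK : involutive h.
  move=> [s t]; rewrite /h/= ffunE eqxx; congr (_, _).
  by apply/ffunP => j; rewrite !ffunE; case: eqP => // ->.
rewrite [RHS](reindex_inj (inv_inj hK))/=.
rewrite (eq_bigr (fun x => prodm Q x.1 * Q x.2 * F x.1)); last first.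
  move=> [s t] _ /=; rewrite mulrA prodm_upd; congr (_ * F _).
  by apply/ffunP => j; rewrite !ffunE; case: eqP => // ->.
rewrite -(pair_bigA _ (fun s t => prodm Q s * Q t * F s))/=.
apply: eq_bigr => s _.
by rewrite -mulr_suml -mulr_sumr Q1 mulr1.
Qed.

Lemma sum_prodm1 Q i (phi : T -> R) : \sum_t Q t = 1 ->
  \sum_s prodm Q s * phi (s i) = \sum_t Q t * phi t.
Proof.
move=> Q1; rewrite (resample i _ Q1).
under eq_bigr do under eq_bigr do rewrite ffunE eqxx.
by rewrite -mulr_suml sum_prodm// mul1r.
Qed.

Lemma sum_prodm2 Q i j (phi : T -> T -> R) : \sum_t Q t = 1 -> i != j ->
  \sum_s prodm Q s * phi (s i) (s j) = \sum_t \sum_u Q t * Q u * phi t u.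
Proof.
move=> Q1 ij; rewrite (resample i _ Q1).
under eq_bigr do under eq_bigr do rewrite !ffunE eqxx eq_sym (negbTE ij).
rewrite (sum_prodm1 j (fun u => \sum_t Q t * phi t u))//.
rewrite exchange_big/=; apply: eq_bigr => u _.
by rewrite mulr_sumr; apply: eq_bigr => t _; ring.
Qed.

Lemma sum_prodm_sum Q (g : T -> R) : \sum_t Q t = 1 ->
  \sum_s prodm Q s * (\sum_i g (s i)) = #|I|%:R * \sum_t Q t * g t.
Proof.
move=> Q1; under eq_bigr do rewrite mulr_sumr.
rewrite exchange_big/= (eq_bigr (fun=> \sum_t Q t * g t)).
  by rewrite sumr_const mulr_natl.
by move=> i _; rewrite sum_prodm1.
Qed.

(** The cross terms vanish by independence and zero mean. *)
Lemma sum_prodm_sqr0 Q (g : T -> R) : \sum_t Q t = 1 -> \sum_t Q t * g t = 0 ->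
  \sum_s prodm Q s * (\sum_i g (s i)) ^+ 2 = #|I|%:R * \sum_t Q t * g t ^+ 2.
Proof.
move=> Q1 g0.
have -> : \sum_s prodm Q s * (\sum_i g (s i)) ^+ 2 =
   \sum_i \sum_j \sum_s prodm Q s * (g (s i) * g (s j)).
  under [RHS]eq_bigr do rewrite exchange_big/=.
  rewrite [RHS]exchange_big/=; apply: eq_bigr => s _.
  rewrite expr2 mulr_suml mulr_sumr; apply: eq_bigr => i _.
  by rewrite mulr_sumr mulr_sumr.
rewrite (eq_bigr (fun=> \sum_t Q t * g t ^+ 2)).
  by rewrite sumr_const mulr_natl.
move=> i _; rewrite (bigD1 i)//= [X in _ + X]big1 ?addr0.
  by rewrite -(sum_prodm1 i (fun t => g t ^+ 2))//.
move=> j ji; rewrite (sum_prodm2 (fun t u => g t * g u))// 1?eq_sym//.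
rewrite big1// => t _.
under eq_bigr do rewrite mulrACA.
by rewrite -mulr_sumr g0 mulr0.
Qed.

Lemma variance_prodm Q (g : T -> R) (m := \sum_t Q t * g t) : is_pmf Q ->
  \sum_s prodm Q s * (\sum_i g (s i) - #|I|%:R * m) ^+ 2
    = #|I|%:R * \sum_t Q t * (g t - m) ^+ 2.
Proof.
move=> [Q0 Q1].
rewrite -(@sum_prodm_sqr0 Q (fun t => g t - m))//.
  by apply: eq_bigr => s _; rewrite sumrB sumr_const mulr_natl.
under eq_bigr do rewrite mulrBr.
by rewrite sumrB -mulr_suml Q1 mul1r subrr.
Qed.

Lemma variance_prodm_le Q (g : T -> R) (m := \sum_t Q t * g t) : is_pmf Q ->
  \sum_s prodm Q s * (\sum_i g (s i) - #|I|%:R * m) ^+ 2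
    <= #|I|%:R * \sum_t Q t * g t ^+ 2.
Proof.
move=> hQ; rewrite variance_prodm// -/m; case: hQ => [Q0 Q1].
rewrite ler_wpM2l//.
rewrite (eq_bigr (fun t => Q t * g t ^+ 2 - 2 * m * (Q t * g t) + m ^+ 2 * Q t)).
  rewrite big_split/= sumrB -!mulr_sumr -/m Q1; nra.
by move=> t _; ring.
Qed.

Lemma markov_ineq (W : finType) (p : W -> R) (f : W -> R) (c : R) (P : pred W) :
  (forall w, 0 <= p w) -> (forall w, 0 <= f w) -> 0 < c ->
  (forall w, P w -> c <= f w) ->
  \sum_(w | P w) p w <= (\sum_w p w * f w) / c.
Proof.
move=> p0 f0 c0 cf; rewrite ler_pdivlMr// mulr_suml [leRHS](bigID P)/=.
rewrite -[leLHS]addr0 lerD// ?sumr_ge0// => [|w _]; last by rewrite mulr_ge0.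
by apply: ler_sum => w Pw; rewrite ler_wpM2l// cf.
Qed.

Lemma chebyshev_prodm Q (g : T -> R) (m := \sum_t Q t * g t) (d : R) : is_pmf Q ->
  0 < d -> (0 < #|I|)%N ->
  \sum_(s : {ffun I -> T} | \sum_i g (s i) < #|I|%:R * (m - d)) prodm Q s
    <= (\sum_t Q t * (g t - m) ^+ 2) / d ^+ 2 / #|I|%:R.
Proof.
move=> hQ d0 I0.
have I0' : 0 < #|I|%:R :> R by rewrite ltr0n.
apply: le_trans (@markov_ineq _ (prodm Q)
  (fun s : {ffun I -> T} => (\sum_i g (s i) - #|I|%:R * m) ^+ 2) ((#|I|%:R * d) ^+ 2) _ _ _ _ _) _.
- by move=> s; apply: prodm_ge0; case: hQ.
- by move=> s; exact: sqr_ge0.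
- by rewrite exprn_gt0// mulr_gt0.
- move=> s; rewrite mulrBr => hs; have nd : 0 < #|I|%:R * d by rewrite mulr_gt0.
  by rewrite -[leRHS]sqrrN ler_sqr ?nnegrE; lra.
rewrite variance_prodm// -/m exprMn.
rewrite le_eqVlt; apply/orP; left; apply/eqP; field.
by rewrite !gt_eqF.
Qed.

End Product.

Section ProductEntropy.
Context {R : realType} {I T : finType}.

Lemma log2_prod (J : finType) (F : J -> R) : (forall j, 0 < F j) ->
  log2 (\prod_j F j) = \sum_j log2 (F j).
Proof.
move=> F0.
suff [] : 0 < \prod_j F j /\ log2 (\prod_j F j) = \sum_j log2 (F j) by [].
elim/big_rec2 : _ => [|j y1 y2 _ [h1 h2]]; first by rewrite log21.
by rewrite mulr_gt0// log2M// h2.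
Qed.

Lemma prodm_neq0 (Q : T -> R) (s : {ffun I -> T}) i : prodm Q s != 0 -> Q (s i) != 0.
Proof. by move/prodf_neq0; apply. Qed.

Lemma log2_law_prodm (A : finType) (Q : T -> R) (f : T -> A) (s : {ffun I -> T}) :
  (forall t, 0 <= Q t) -> prodm Q s != 0 ->
  log2 (law (prodm Q) (fcomp f) (fcomp f s)) = \sum_i log2 (law Q f (f (s i))).
Proof.
move=> Q0 Qs; rewrite law_prodm log2_prod.
  by apply: eq_bigr => i _; rewrite ffunE.
move=> i; rewrite ffunE.
have := prodm_neq0 i Qs; rewrite neq_lt ltNge Q0/= => h.
by apply: lt_le_trans h _; rewrite /law (bigD1 (s i))//= lerDl sumr_ge0.
Qed.

Lemma entropy_prodm (A : finType) (Q : T -> R) (f : T -> A) : is_pmf Q ->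
  entropy (prodm Q) (@fcomp I T A f) = #|I|%:R * entropy Q f.
Proof.
move=> [Q0 Q1]; rewrite !entropyE mulrN; congr (- _).
rewrite -sum_prodm_sum//; apply: eq_bigr => s _.
have [->|Qs] := eqVneq (prodm Q s) 0; first by rewrite !mul0r.
by rewrite log2_law_prodm.
Qed.

End ProductEntropy.

(** * Csiszar's sum identity and single-letterization *)

Section Hybrid.
Context {R : realType} {W L M B C : finType} {n : nat}.
Variables (p : W -> R) (S : W -> {ffun 'I_n -> L}) (m : W -> M) (f : L -> B) (g : L -> C).
Hypothesis p0 : forall w, 0 <= p w.

(** The [None] at position [t] gives all [t] one codomain and makes the value insensitive to the
    letter at [t]. *)
Definition past_future (t : 'I_n) (s : {ffun 'I_n -> L}) : {ffun 'I_n -> option (B + C)} :=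
  [ffun j : 'I_n => if (j < t)%N then Some (inl (f (s j)))
             else if (t < j)%N then Some (inr (g (s j))) else None].

Definition hybrid (k : nat) (s : {ffun 'I_n -> L}) : {ffun 'I_n -> (B + C)%type} :=
  [ffun j : 'I_n => if (j < k)%N then inl (f (s j)) else inr (g (s j))].

(** Filling the hole at [t] with [f] advances the hybrid to [t.+1]; filling it with [g], as in the
    next lemma, leaves it at [t]. *)
Lemma entropy_past_future_l (t : 'I_n) :
  entropy p (pairRV (pairRV m (past_future t \o S)) (fun w => f (S w t)))
  = entropy p (pairRV m (hybrid t.+1 \o S)).
Proof.
apply: entropy_eq => // w w' _ _; rewrite /pairRV/=; split.
  move=> [-> /ffunP e]; congr (_, _, _).
    apply/ffunP => j; have := e j; rewrite !ffunE ltnS.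
    by case: ltngtP => //= _ [->].
  by have := e t; rewrite !ffunE ltnSn => -[].
move=> [-> /ffunP e ft]; congr (_, _); apply/ffunP => j.
have := e j; rewrite !ffunE ltnS.
by case: ltngtP => //= [_ [->]|_ [->]|/val_inj ->]//; rewrite ft.
Qed.

Lemma entropy_past_future_r (t : 'I_n) :
  entropy p (pairRV (pairRV m (past_future t \o S)) (fun w => g (S w t)))
  = entropy p (pairRV m (hybrid t \o S)).
Proof.
apply: entropy_eq => // w w' _ _; rewrite /pairRV/=; split.
  move=> [-> /ffunP e]; congr (_, _, _).
    apply/ffunP => j; have := e j; rewrite !ffunE.
    by case: ltngtP => //= _ [->].
  by have := e t; rewrite !ffunE ltnn => -[].
move=> [-> /ffunP e ft]; congr (_, _); apply/ffunP => j.
have := e j; rewrite !ffunE.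
by case: ltngtP => //= [_ [->]|_ [->]|/val_inj ->]//; rewrite ft.
Qed.

(* The hybrids [(m, hybrid k)] telescope from [(m, g^n)] to [(m, f^n)]. *)
Lemma hybrid_telescope :
  \sum_(t < n) (entropy p (pairRV (pairRV m (past_future t \o S)) (fun w => f (S w t)))
    - entropy p (pairRV (pairRV m (past_future t \o S)) (fun w => g (S w t))))
  = entropy p (pairRV m (fcomp f \o S)) - entropy p (pairRV m (fcomp g \o S)).
Proof.
under eq_bigr do rewrite entropy_past_future_l entropy_past_future_r.
rewrite -(big_mkord xpredT (fun t => entropy p (pairRV m (hybrid t.+1 \o S)) -
  entropy p (pairRV m (hybrid t \o S)))) telescope_sumr//.
congr (_ - _); apply: entropy_eq => // w w' _ _; rewrite /pairRV/=.
- split=> -[-> /ffunP e]; congr (_, _); apply/ffunP => j; have := e j;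
    by rewrite !ffunE ltn_ord; first [by move=> ->|by move=> [->]].
- split=> -[-> /ffunP e]; congr (_, _); apply/ffunP => j; have := e j;
    by rewrite !ffunE ltn0; first [by move=> ->|by move=> [->]].
Qed.

End Hybrid.

Section SingleLetter.
Context {R : realType} {L X M : finType} {n : nat}.
Variables (P : L -> R) (x : L -> X) (enc : {ffun 'I_n -> X} -> M -> R).
Hypotheses (hP : is_pmf P) (henc : forall u, is_pmf (enc u)).

Let P0 : forall l, 0 <= P l. Proof. by case: hP. Qed.
Let P1 : \sum_l P l = 1. Proof. by case: hP. Qed.

Definition nlaw (w : {ffun 'I_n -> L} * M) : R := prodm P w.1 * enc (fcomp x w.1) w.2.

Lemma nlaw_ge0 w : 0 <= nlaw w.
Proof. by rewrite /nlaw mulr_ge0 ?prodm_ge0//; case: (henc (fcomp x w.1)). Qed.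

Lemma sum_nlaw_fst (phi : {ffun 'I_n -> L} -> R) :
  \sum_w nlaw w * phi w.1 = \sum_s prodm P s * phi s.
Proof.
rewrite -(pair_bigA _ (fun s m => nlaw (s, m) * phi s))/=; apply: eq_bigr => s _.
by rewrite /nlaw/= -mulr_suml -mulr_sumr; case: (henc (fcomp x s)) => _ ->; rewrite mulr1.
Qed.

Lemma law_nlaw_fst (A : finType) (F : {ffun 'I_n -> L} -> A) :
  law nlaw (F \o fst) = law (prodm P) F.
Proof.
apply/funext => a; rewrite /law [LHS]sum_indicator [RHS]sum_indicator.
by rewrite (sum_nlaw_fst (fun s => (F s == a)%:R)).
Qed.

Lemma sum_nlaw : \sum_w nlaw w = 1.
Proof.
rewrite -[RHS](@sum_prodm R 'I_n _ P)//.
under eq_bigr do rewrite -[nlaw _]mulr1.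
by rewrite (sum_nlaw_fst (fun=> 1)); apply: eq_bigr => s _; rewrite mulr1.
Qed.

Lemma nlaw_pmf : is_pmf nlaw.
Proof. by split; [exact: nlaw_ge0|exact: sum_nlaw]. Qed.

Lemma entropy_nlaw_fcomp (A : finType) (f : L -> A) :
  entropy nlaw (fcomp f \o fst) = n%:R * entropy P f.
Proof. by rewrite /entropy law_nlaw_fst -/(entropy _ _) entropy_prodm// card_ord. Qed.

Lemma entropy_nlaw_letter (A : finType) (f : L -> A) (t : 'I_n) :
  entropy nlaw (fun w => f (w.1 t)) = entropy P f.
Proof.
rewrite /entropy; apply: eq_bigr => a _; congr xlog.
have -> := law_nlaw_fst (fun s : {ffun 'I_n -> L} => f (s t)).
rewrite /law [LHS]sum_indicator [RHS]sum_indicator.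
by rewrite (sum_prodm1 t (fun l => (f l == a)%:R)).
Qed.

(** Csiszar's sum identity: the letter entropies add up by independence and the joint ones
    telescope. It serves four times in [single_letterization], with different [f] and [g]. *)
Lemma mi_diff_hybrid (B C : finType) (f : L -> B) (g : L -> C) :
  \sum_(t < n) mi_diff nlaw (pairRV snd (past_future f g t \o fst))
      (fun w => f (w.1 t)) (fun w => g (w.1 t))
  = mi_diff nlaw snd (fcomp f \o fst) (fcomp g \o fst).
Proof.
rewrite /mi_diff.
under eq_bigr do rewrite !entropy_nlaw_letter.
rewrite sumrB sumr_const card_ord (hybrid_telescope fst snd f g nlaw_ge0).
by rewrite !entropy_nlaw_fcomp -mulr_natl; ring.
Qed.

(** Conditional law of [U] given the source symbol [x0] at time [t]. Substituting [x0] into a random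
    sequence, instead of dividing by a probability, gives a pmf for every [x0], even one of
    probability zero. *)
Definition letter_kernel (A : finType) (U : {ffun 'I_n -> L} * M -> A) (t : 'I_n)
    (x0 : X) (u : A) : R :=
  \sum_s prodm P s * \sum_(m | U (s, m) == u) enc (upd (fcomp x s) t x0) m.

Lemma letter_kernel_pmf (A : finType) (U : {ffun 'I_n -> L} * M -> A) t x0 :
  is_pmf (letter_kernel U t x0).
Proof.
split=> [u|].
  apply: sumr_ge0 => s _; rewrite mulr_ge0 ?prodm_ge0// sumr_ge0// => m _.
  by case: (henc (upd (fcomp x s) t x0)).
rewrite /letter_kernel exchange_big/= -[RHS](@sum_prodm R 'I_n _ P)//.
apply: eq_bigr => s _; rewrite -mulr_sumr.
case: (henc (upd (fcomp x s) t x0)) => _.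
by rewrite (partition_big (fun m => U (s, m)) xpredT)//= => ->; rewrite mulr1.
Qed.

(** [U] ignores the letter at [t] except through the message, and the encoder sees only the source
    symbol of that letter; hence the Markov chain from [U] over [X_t] to the letter. *)
Lemma law_letter_kernel (A : finType) (U : {ffun 'I_n -> L} * M -> A) t :
  (forall s m l, U (upd s t l, m) = U (s, m)) ->
  forall u l, law nlaw (pairRV U (fun w => w.1 t)) (u, l)
    = P l * letter_kernel U t (x l) u.
Proof.
move=> hU u l.
rewrite /law big_mkcond/=.
transitivity (\sum_s \sum_m if pairRV U (fun w : {ffun 'I_n -> L} * M => w.1 t) (s, m) == (u, l)
    then nlaw (s, m) else 0).
  by rewrite pair_bigA; apply: eq_bigr => -[].
transitivity (\sum_s prodm P s * ((s t == l)%:R * \sum_(m | U (s, m) == u) enc (fcomp x s) m)).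
  apply: eq_bigr => s _; rewrite mulrA mulr_sumr [RHS]big_mkcond/=.
  apply: eq_bigr => m _; rewrite /pairRV xpair_eqE/= /nlaw/=.
  by case: (U _ == u); case: (s t == l); rewrite ?mulr1 ?mulr0 ?mul0r.
rewrite (resample t)// /letter_kernel mulr_sumr; apply: eq_bigr => s _.
rewrite mulrCA; congr (_ * _).
rewrite (bigD1 l)//= [X in _ + X]big1 ?addr0; last first.
  by move=> k kl; rewrite ffunE eqxx (negbTE kl) mul0r mulr0.
rewrite ffunE eqxx eqxx mul1r; congr (_ * _).
rewrite (eq_bigl (fun m => U (s, m) == u)); last by move=> m; rewrite hU.
apply: eq_bigr => m _; congr (enc _ m); apply/ffunP => j.
by rewrite !ffunE; case: eqP.
Qed.

End SingleLetter.

Section Kernel.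
Context {R : realType} {L X U : finType}.
Variables (x : L -> X) (P : L -> R) (k : X -> U -> R).
Hypotheses (hP : is_pmf P).

Definition is_kernel (k : X -> U -> R) : Prop := forall x0, is_pmf (k x0).

(** The auxiliary is generated from the letter through [x] alone, so the Markov chain is built
    in. *)
Definition kjoint (w : U * L) : R := P w.2 * k (x w.2) w.1.

Hypothesis hk : is_kernel k.

Lemma kjoint_ge0 w : 0 <= kjoint w.
Proof. by rewrite mulr_ge0//; [case: hP|case: (hk (x w.2))]. Qed.

Lemma law_kjoint_snd (A : finType) (f : L -> A) : law kjoint (f \o snd) = law P f.
Proof.
apply/funext => a; rewrite /law.
transitivity (\sum_u \sum_(l | f l == a) kjoint (u, l)).
  by rewrite pair_big_dep; apply: eq_big => -[].
rewrite exchange_big/=; apply: eq_bigr => l _.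
by rewrite /kjoint/= -mulr_sumr; case: (hk (x l)) => _ ->; rewrite mulr1.
Qed.

Lemma kjoint_pmf : is_pmf kjoint.
Proof.
split=> [w|]; first exact: kjoint_ge0.
rewrite -(sum_law1 _ (id \o snd)) law_kjoint_snd sum_law1.
by case: hP.
Qed.

Lemma entropy_kjoint_snd (A : finType) (f : L -> A) :
  entropy kjoint (f \o snd) = entropy P f.
Proof. by rewrite /entropy law_kjoint_snd. Qed.

End Kernel.

Lemma law_inj {R : realType} {W A B : finType} (p : W -> R) (F : W -> A) (h : A -> B) a :
  injective h -> law p (h \o F) (h a) = law p F a.
Proof. by move=> hinj; apply: eq_bigl => w; rewrite /= (inj_eq hinj). Qed.

Section TimeSharing.
Context {R : realType} {L X M : finType} {n : nat}.
Variables (P : L -> R) (x : L -> X) (enc : {ffun 'I_n -> X} -> M -> R).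
Hypotheses (hP : is_pmf P) (henc : forall u, is_pmf (enc u)) (n0 : (0 < n)%N).

Local Notation pn := (nlaw P x enc).

Let n0R : 0 < n%:R :> R. Proof. by rewrite ltr0n. Qed.

Let pi (t : 'I_n) : R := n%:R^-1.

Let hpi : is_pmf pi.
Proof.
split=> [t|]; first by rewrite invr_ge0 ltW.
by rewrite sumr_const card_ord -(mulr_natr n%:R^-1) mulVf// gt_eqF.
Qed.

Section Fixed.
Context {VT WT : finType}.
Variables (V : 'I_n -> {ffun 'I_n -> L} * M -> VT) (V' : 'I_n -> {ffun 'I_n -> L} * M -> WT).
Hypothesis hV : forall t s m l, V t (upd s t l, m) = V t (s, m).
Hypothesis hV' : forall t s m l, V' t (upd s t l, m) = V' t (s, m).

(** The uniform time index is stored with [V], so both [V] and [(V, W)] contain it and the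
    single-letter informations are averages over time. *)
Definition ts_kernel (x0 : X) (u : ('I_n * VT) * WT) : R :=
  n%:R^-1 * letter_kernel P x enc (pairRV (V u.1.1) (V' u.1.1)) u.1.1 x0 (u.1.2, u.2).

Lemma ts_kernelP : is_kernel ts_kernel.
Proof.
move=> x0; split=> [u|].
  rewrite mulr_ge0 ?invr_ge0//.
  by have [] := letter_kernel_pmf x hP henc (pairRV (V u.1.1) (V' u.1.1)) u.1.1 x0.
rewrite -(pair_bigA _ (fun tv w => ts_kernel x0 (tv, w)))/=.
rewrite -(pair_bigA _ (fun t v => \sum_w ts_kernel x0 (t, v, w)))/=.
rewrite -[RHS](proj2 hpi); apply: eq_bigr => t _.
rewrite pair_big/= /ts_kernel/= -mulr_sumr.
have [_ e] := letter_kernel_pmf x hP henc (pairRV (V t) (V' t)) t x0.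
by under eq_bigr do rewrite -surjective_pairing; rewrite e mulr1.
Qed.

Let emb (w : 'I_n * ({ffun 'I_n -> L} * M)) : ('I_n * VT * WT) * L :=
  (w.1, V w.1 w.2, V' w.1 w.2, w.2.1 w.1).

Let p' (w : 'I_n * ({ffun 'I_n -> L} * M)) : R := pi w.1 * pn w.2.

Lemma law_ts_kernel : kjoint x P ts_kernel = law p' emb.
Proof.
apply/funext => -[[[t v] w] l].
pose h (a : 'I_n * (VT * WT * L)) : ('I_n * VT * WT) * L :=
  (a.1, a.2.1.1, a.2.1.2, a.2.2).
have hinj : injective h by move=> [? [[? ?] ?]] [? [[? ?] ?]] [-> -> -> ->].
pose G t := pairRV (pairRV (V t) (V' t)) (fun w : {ffun 'I_n -> L} * M => w.1 t).
rewrite -[emb]/(h \o (fun w => (w.1, G w.1 w.2))) -[(t, v, w, l)]/(h (t, ((v, w), l))).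
rewrite (law_inj _ _ _ hinj) /p' law_mixture law_letter_kernel//.
  by rewrite /kjoint/= /ts_kernel /=; rewrite mulrCA.
by move=> s m l'; rewrite /pairRV hV hV'.
Qed.

(** The condition on [F] says that it carries exactly the time index and [U]. *)
Lemma mi_diff_ts (A B C : finType) (F : ('I_n * VT) * WT -> A) (U : 'I_n -> {ffun 'I_n -> L} * M -> B)
  (f : L -> C) (D : finType) (g : L -> D) :
  (forall w w', (F (emb w).1 = F (emb w').1) <-> (w.1 = w'.1 /\ U w.1 w.2 = U w'.1 w'.2)) ->
  mi_diff (kjoint x P ts_kernel) (F \o fst) (f \o snd) (g \o snd) =
  n%:R^-1 * \sum_(t < n) mi_diff pn (U t) (fun w => f (w.1 t)) (fun w => g (w.1 t)).
Proof.
move=> FU.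
have p'0 w : 0 <= p' w.
  by rewrite mulr_ge0 ?(nlaw_ge0 x hP henc)//; case: hpi.
have e (E : finType) (k : L -> E) t :
   entropy pn (fun w => k (w.1 t)) = entropy p' (fun w => k (w.2.1 w.1)).
  rewrite entropy_nlaw_letter//.
  have <- := entropy_kjoint_snd x P ts_kernelP k.
  by rewrite law_ts_kernel entropy_law.
rewrite mulr_sumr -(mi_diff_mixture (p := pn) (pi := pi)
   (f := fun t w => f (w.1 t)) (g := fun t w => g (w.1 t)) U hpi); first last.
- by move=> t; exact: e.
- by move=> t; exact: e.
- exact: nlaw_ge0.
rewrite law_ts_kernel /mi_diff !entropy_law; congr (_ - _ - (_ - _)).
- apply: entropy_eq => // w w' _ _; rewrite /pairRV /=; split.
    by move=> [t u ->]; congr (_, _); apply/FU.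
  by move=> [/FU[-> ->] ->].
- apply: entropy_eq => // w w' _ _; rewrite /pairRV /=; split.
    by move=> [t u ->]; congr (_, _); apply/FU.
  by move=> [/FU[-> ->] ->].
Qed.

End Fixed.

Lemma past_future_upd (B C : finType) (f : L -> B) (g : L -> C) t (s : {ffun 'I_n -> L}) l :
  past_future f g t (upd s t l) = past_future f g t s.
Proof.
apply/ffunP => j; rewrite !ffunE; have [->|jt] := eqVneq j t; first by rewrite ltnn.
by [].
Qed.

Lemma past_future_det (B C B' C' : finType) (f : L -> B) (g : L -> C) (f' : L -> B')
   (g' : L -> C') t (w w' : {ffun 'I_n -> L} * M) :
  (forall l l', f l = f l' -> f' l = f' l') -> (forall l l', g l = g l' -> g' l = g' l') ->
  pairRV snd (past_future f g t \o fst) w = pairRV snd (past_future f g t \o fst) w' ->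
  pairRV snd (past_future f' g' t \o fst) w = pairRV snd (past_future f' g' t \o fst) w'.
Proof.
move=> ff gg [m /ffunP e]; rewrite /pairRV/= m; congr (_, _).
apply/ffunP => j; have := e j; rewrite !ffunE.
by case: ltngtP => // _ [] => [/ff|/gg] ->.
Qed.

(* With [V_t = (M, Y^{t-1}, Z_{t+1}^n)] and [W_t = (M, L^{t-1}, Z_{t+1}^n)] the
   differences [sum_t (I(V_t; Y_t) - I(V_t; Z_t))] telescope (Csiszar's sum
   identity); the excess of [sum_t I(V_t; Z_t)] over [I(M; Z^n)] is absorbed
   by the left-hand side of the third inequality. *)
Lemma single_letterization (B C D : finType) (y1 : L -> B) (y2 : L -> C) (z : L -> D) :
  exists (VT WT : finType) (k : X -> VT * WT -> R),
    let q := kjoint x P k in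
    [/\ is_kernel k,
        n%:R^-1 * mi_diff pn snd (fcomp (pairRV y1 z) \o fst) (fcomp z \o fst)
          <= mi_diff q fst (pairRV y1 z \o snd) (z \o snd),
        n%:R^-1 * mi_diff pn snd (fcomp y2 \o fst) (fun=> tt)
          <= mi_diff q (fst \o fst) (y2 \o snd) (fun=> tt) &
        n%:R^-1 * mi_diff pn snd (fcomp y2 \o fst) (fun=> tt)
          + mi_diff q (fst \o fst) (z \o snd) (y2 \o snd)
          + mi_diff q fst (pairRV x z \o snd) (z \o snd)
          <= n%:R^-1 * mi_diff pn snd fst (fun=> tt)].
Proof.
pose V t := pairRV (@snd {ffun 'I_n -> L} M) (past_future y2 z t \o fst).
pose V' t := pairRV (@snd {ffun 'I_n -> L} M) (past_future id z t \o fst).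
have hV t s m l : V t (upd s t l, m) = V t (s, m).
  by rewrite /V /pairRV/= past_future_upd.
have hV' t s m l : V' t (upd s t l, m) = V' t (s, m).
  by rewrite /V' /pairRV/= past_future_upd.
exists _, _, (ts_kernel V V') => q.
have q0 : forall w, 0 <= q w by apply: kjoint_ge0 => //; exact: ts_kernelP.
have pn0 : forall w, 0 <= pn w by exact: nlaw_ge0.
have VV' t w w' : V' t w = V' t w' -> V t w = V t w'.
  by move=> e; apply: past_future_det e => // l l' ->.
have eV (E F : finType) (f : L -> E) (g : L -> F) :
   mi_diff q (fst \o fst) (f \o snd) (g \o snd)
   = n%:R^-1 * \sum_(t < n) mi_diff pn (V t) (fun w => f (w.1 t)) (fun w => g (w.1 t)).
  apply: (mi_diff_ts hV hV' (F := fst)) => -[t w] [t' w'] /=.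
  by split=> [e|[-> ->//]]; split; [exact: (congr1 fst e)|exact: (congr1 snd e)].
have eW (E F : finType) (f : L -> E) (g : L -> F) :
   mi_diff q fst (f \o snd) (g \o snd)
   = n%:R^-1 * \sum_(t < n) mi_diff pn (V' t) (fun w => f (w.1 t)) (fun w => g (w.1 t)).
  rewrite -[fst in LHS]/(id \o fst).
  apply: (mi_diff_ts hV hV' (F := id)) => -[t w] [t' w'] /=.
  split=> [e|[tt' e]].
    by split; [exact: (congr1 (fst \o fst) e)|exact: (congr1 snd e)].
  by rewrite tt' in e *; rewrite e (VV' _ _ _ e).
have n1 : 0 <= n%:R^-1 :> R by rewrite invr_ge0 ltW.
split.
- exact: ts_kernelP.
- rewrite eW -(mi_diff_hybrid x hP henc) ler_wpM2l//; apply: ler_sum => t _.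
  apply: mi_diff_monoU => //; first by move=> w w' _ _ [].
  by move=> w w' _ _ e; apply: past_future_det e => // l l' ->.
- have -> : mi_diff pn snd (fcomp y2 \o fst) (fun=> tt)
     = mi_diff pn snd (fcomp y2 \o fst) (fcomp (fun=> tt) \o fst).
    by apply: eq_mi_diff => // w w' _ _ _; apply/ffunP => j; rewrite !ffunE.
  rewrite -[fun=> tt in leRHS]/((fun=> tt) \o snd) eV -(mi_diff_hybrid x hP henc) ler_wpM2l//; apply: ler_sum => t _.
  apply: mi_diff_monoU => //.
  by move=> w w' _ _ e; apply: past_future_det e.
(* [I(M; L^n)] is split into [I(M; L^n | Z^n)], [I(M; Z^n) - I(M; Y2^n)] and [I(M; Y2^n)]. The first
   two are sums over time by the identity; the third is the leading term of the claim. *)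
- rewrite eV eW (mi_diffD _ snd fst (fcomp z \o fst)).
  have -> : \sum_(t < n) mi_diff pn (V t) (fun w => z (w.1 t)) (fun w => y2 (w.1 t))
     = mi_diff pn snd (fcomp z \o fst) (fcomp y2 \o fst).
    rewrite [RHS]mi_diffN -(mi_diff_hybrid x hP henc) -sumrN.
    by apply: eq_bigr => t _; rewrite mi_diffN.
  have -> : mi_diff pn snd fst (fcomp z \o fst)
    = mi_diff pn snd (fcomp id \o fst) (fcomp z \o fst).
    apply: eq_mi_diff => // w w' _ _.
      by rewrite /= => ->.
    by rewrite /= => /ffunP e; apply/ffunP => j; have := e j; rewrite !ffunE.
  rewrite -(mi_diff_hybrid x hP henc id z) (mi_diffD _ snd (fcomp z \o fst) (fcomp y2 \o fst)).
  have le : \sum_(t < n) mi_diff pn (V' t) (fun w : {ffun 'I_n -> L} * M => pairRV x z (w.1 t)) (fun w => z (w.1 t))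
    <= \sum_(t < n) mi_diff pn (V' t) (fun w => id (w.1 t)) (fun w => z (w.1 t)).
    apply: ler_sum => t _; rewrite [leRHS](mi_diffD _ _ _ (fun w : {ffun 'I_n -> L} * M => pairRV x z (w.1 t))).
    rewrite lerDr; apply: mi_diff_ge0 => // w w' _ _.
    by rewrite /pairRV => ->.
  rewrite -!mulrDr ler_wpM2l//; apply: le_trans (lerD (lexx _) le) _.
  by rewrite [leRHS]addrC lerD// addrC -!mi_diffD lexx.
Qed.

End TimeSharing.

(** * Exponents and mutual informations *)

Section Testing.
Context {R : realType}.

(* Gibbs' inequality against [Q] reweighted by [1 / b] on the acceptance set. *)
Lemma divergence_test (T : finType) (P Q : T -> R) (A : pred T) (b : R) :
  is_pmf P -> (forall t, 0 <= Q t) -> \sum_t Q t <= 1 ->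
  (forall t, 0 < P t -> 0 < Q t) -> 0 < b -> \sum_(t | A t) Q t <= b ->
  (\sum_(t | A t) P t) * - log2 b - (ln 2)^-1 <= \sum_t P t * log2 (P t / Q t).
Proof.
move=> [P0 P1] Q0 Q1 PQ b0 Qb.
pose c t := if A t then b^-1 else 1.
have c0 t : 0 < c t by rewrite /c; case: ifP => // _; rewrite invr_gt0.
have step t : P t * log2 (c t) + (P t - Q t * c t) / ln 2 <= P t * log2 (P t / Q t).
  have := @ler_mul_log2 R (P t) (Q t * c t) (P0 t).
  rewrite mulr_ge0 ?(ltW (c0 t))// => /(_ isT).
  move=> /(_ (fun h => mulr_gt0 (PQ t h) (c0 t))).
  have := P0 t; rewrite le_eqVlt => /predU1P[<-|Pt].
    by rewrite !mul0r; lra.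
  rewrite !log2_div ?mulr_gt0 ?PQ// log2M ?PQ//; lra.
apply: le_trans (ler_sum _ (fun t _ => step t)).
rewrite big_split/= -mulr_suml sumrB P1.
have -> : \sum_t P t * log2 (c t) = (\sum_(t | A t) P t) * - log2 b.
  rewrite mulr_suml [RHS]big_mkcond/=; apply: eq_bigr => t _.
  by rewrite /c; case: ifP => _; rewrite ?log2V// log21 mulr0.
rewrite lerD2l -mulN1r ler_wpM2r ?invr_ge0 ?(ltW ln2_gt0)//.
(* The reweighted [Q] has mass at most 1 on [A] and at most 1 off it; the excess 2 - 1 over the mass
   of [P] costs [(ln 2)^-1]. *)
have : \sum_t Q t * c t <= 2; last by lra.
rewrite (bigID A)/= -[2]/(1 + 1) lerD//.
  rewrite (eq_bigr (fun t => Q t * b^-1)) => [|t At]; last by rewrite /c At.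
  by rewrite -mulr_suml ler_pdivrMr// mul1r.
rewrite (eq_bigr Q) => [|t /negbTE At]; last by rewrite /c At mulr1.
apply: le_trans Q1; rewrite [leRHS](bigID A)/= lerDr sumr_ge0//.
Qed.

(** The divergence of [p] from the law under which [f] and [g] are independent given [h] is the
    conditional information. *)
Lemma cond_mutual_info_test (W A B C : finType) (p : W -> R) (f : W -> A) (g : W -> B)
    (h : W -> C) (acc : A -> B -> C -> bool) (b : R) :
  is_pmf p -> 0 < b ->
  \sum_a \sum_g0 \sum_c (acc a g0 c)%:R * (law p (pairRV f h) (a, c) *
     (law p (pairRV g h) (g0, c) / law p h c)) <= b ->
  (\sum_(w | acc (f w) (g w) (h w)) p w) * - log2 b - (ln 2)^-1
    <= cond_mutual_info p f g h.
Proof.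
move=> [p0 p1] b0 hb.
pose T := pairRV (pairRV f g) h.
pose Q (t : A * B * C) := law p (pairRV f h) (t.1.1, t.2) *
     (law p (pairRV g h) (t.1.2, t.2) / law p h t.2).
have Q0 t : 0 <= Q t by rewrite /Q mulr_ge0 ?divr_ge0 ?law_ge0.
have -> : cond_mutual_info p f g h = \sum_t law p T t * log2 (law p T t / Q t).
  rewrite /cond_mutual_info pair_big pair_big/=; apply: eq_bigr => -[[a c] d] _ /=; rewrite -/T; congr (_ * log2 _).
  by rewrite /Q /= mulrA invf_div mulrA.
have -> : \sum_(w | acc (f w) (g w) (h w)) p w =
    \sum_(t | acc t.1.1 t.1.2 t.2) law p T t.
  by rewrite [LHS]sum_indicator [RHS]sum_indicator (sum_law p T (fun t => (acc t.1.1 t.1.2 t.2)%:R)).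
apply: divergence_test => //.
- by split=> [t|]; [exact: law_ge0|rewrite sum_law1].
- rewrite -(pair_bigA _ (fun ab c => Q (ab, c)))/=.
  rewrite -(pair_bigA _ (fun a b => \sum_c Q (a, b, c)))/=.
  under eq_bigr do rewrite exchange_big/=.
  rewrite exchange_big/= -p1 -(sum_law1 p h); apply: ler_sum => c _.
  under eq_bigr do rewrite /Q/= -mulr_sumr -mulr_suml -law_suml.
  rewrite -mulr_suml -law_suml.
  have [->|hc] := eqVneq (law p h c) 0; first by rewrite mul0r.
  by rewrite divff// mulr1.
- move=> t k; have hc := law_gt0_comp snd p0 k.
  have hac := law_gt0_comp (fun x => (x.1.1, x.2)) p0 k.
  have hbc := law_gt0_comp (fun x => (x.1.2, x.2)) p0 k.
  by rewrite /Q mulr_gt0 ?divr_gt0.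
- apply: le_trans hb; rewrite big_mkcond/= pair_big pair_big/=.
  by apply: ler_sum => -[[a c] d] _ /=; case: (acc _ _ _); rewrite ?mul1r ?mul0r.
Qed.

Lemma entropy_le_card (W A : finType) (p : W -> R) (f : W -> A) :
  is_pmf p -> (0 < #|A|)%N -> entropy p f <= log2 #|A|%:R.
Proof.
move=> [p0 p1] A0; have N0 : 0 < #|A|%:R :> R by rewrite ltr0n.
have step a : (law p f a - #|A|%:R^-1) / ln 2 <=
    law p f a * log2 #|A|%:R - xlog (law p f a).
  have := @ler_mul_log2 R (law p f a) #|A|%:R^-1 (law_ge0 f a p0).
  rewrite invr_ge0 (ltW N0) => /(_ isT).
  rewrite invr_gt0 N0 => /(_ (fun=> isT)) h; apply: le_trans h _.
  have := law_ge0 f a p0; rewrite le_eqVlt => /predU1P[<-|la].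
    by rewrite !mul0r xlog0 subr0.
  by rewrite invrK log2M// /xlog; lra.
have : \sum_a (law p f a - #|A|%:R^-1) / ln 2 <=
    \sum_a (law p f a * log2 #|A|%:R - xlog (law p f a)).
  by apply: ler_sum => a _; exact: step.
rewrite -mulr_suml !sumrB sum_law1 p1 sumr_const -(mulr_natr #|A|%:R^-1).
rewrite mulVf ?gt_eqF// subrr mul0r -mulr_suml sum_law1 p1 mul1r subr_ge0.
by [].
Qed.

End Testing.

Section Alternative.
Context {R : realType} {L X Y Z : finType} {n : nat}.
Variables (P Q : L -> R) (x : L -> X) (y : L -> Y) (z : L -> Z).
Hypothesis hP : is_pmf P.
Hypothesis hQ : forall a b c, law Q (pairRV (pairRV x z) y) (a, c, b) =
  law P (pairRV x z) (a, c) * (law P (pairRV y z) (b, c) / law P z c).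

Lemma sum_ffun_pair (I A B : finType) (F : {ffun I -> A * B} -> R) :
  \sum_u F u = \sum_(a : {ffun I -> A}) \sum_(b : {ffun I -> B}) F [ffun i => (a i, b i)].
Proof.
rewrite pair_bigA/=.
rewrite (reindex (fun ab : {ffun I -> A} * {ffun I -> B} => [ffun i => (ab.1 i, ab.2 i)])).
  by [].
exists (fun u : {ffun I -> A * B} => ([ffun i => (u i).1], [ffun i => (u i).2])).
- by move=> [a b] _; congr (_, _); apply/ffunP => i; rewrite !ffunE.
- by move=> u _; apply/ffunP => i; rewrite !ffunE; case: (u i).
Qed.

Lemma sum_prodm_fcomp (A : finType) (S : L -> R) (f : L -> A)
    (phi : {ffun 'I_n -> A} -> R) :
  \sum_s prodm S s * phi (fcomp f s) = \sum_u prodm (law S f) u * phi u.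
Proof.
by rewrite sum_law; apply: eq_bigr => u _; rewrite law_prodm.
Qed.

(** Under [Q] the sequence [Y^n] is redrawn from [Z^n] alone, through the product of the conditional
    letter laws. *)
Lemma sum_alt (phi : {ffun 'I_n -> X} -> {ffun 'I_n -> Y} -> {ffun 'I_n -> Z} -> R) :
  \sum_s prodm Q s * phi (fcomp x s) (fcomp y s) (fcomp z s) =
  \sum_s prodm P s * \sum_(b : {ffun 'I_n -> Y})
     (\prod_j (law P (pairRV y z) (b j, z (s j)) / law P z (z (s j)))) *
     phi (fcomp x s) b (fcomp z s).
Proof.
pose phi' (u : {ffun 'I_n -> X * Z * Y}) :=
  phi [ffun j => (u j).1.1] [ffun j => (u j).2] [ffun j => (u j).1.2].
transitivity (\sum_s prodm Q s * phi' (fcomp (pairRV (pairRV x z) y) s)).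
  apply: eq_bigr => s _; congr (_ * _); rewrite /phi'.
  by congr phi; apply/ffunP => j; rewrite !ffunE.
rewrite sum_prodm_fcomp sum_ffun_pair.
pose psi (v : {ffun 'I_n -> X * Z}) := \sum_(b : {ffun 'I_n -> Y})
     (\prod_j (law P (pairRV y z) (b j, (v j).2) / law P z (v j).2)) *
     phi [ffun j => (v j).1] b [ffun j => (v j).2].
transitivity (\sum_s prodm P s * psi (fcomp (pairRV x z) s)).
  rewrite sum_prodm_fcomp; apply: eq_bigr => v _; rewrite /psi mulr_sumr.
  apply: eq_bigr => b _; rewrite mulrA; congr (_ * _).
    rewrite /prodm -big_split/=; apply: eq_bigr => j _.
    by rewrite ffunE; case: (v j) => a c; rewrite hQ.
  by rewrite /phi'; congr phi; apply/ffunP => j; rewrite !ffunE.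
apply: eq_bigr => s _; congr (_ * _); apply: eq_bigr => b _; congr (_ * _).
  by apply: eq_bigr => j _; rewrite !ffunE.
by congr phi; apply/ffunP => j; rewrite !ffunE.
Qed.

Section Encoder.
Context {M : finType} (enc : {ffun 'I_n -> X} -> M -> R).
Hypothesis henc : forall u, is_pmf (enc u).

Lemma sum_law_cond (W A B : finType) (p : W -> R) (f : W -> A) (g : W -> B)
   (phi : A -> B -> R) :
  \sum_a \sum_b law p (pairRV f g) (a, b) * phi a b = \sum_w p w * phi (f w) (g w).
Proof.
by rewrite (sum_law p (pairRV f g) (fun ab => phi ab.1 ab.2)) pair_big; apply: eq_bigr => -[].
Qed.

(** The encoder sees [X^n] only, so under [Q] the message and [Y^n] are independent given [Z^n],
    while the pair of message and [Z^n] has the same law as under [P]. The acceptance probability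
    thus has the form required by [cond_mutual_info_test]. *)
Lemma alt_acceptance (acc : M -> {ffun 'I_n -> Y} -> {ffun 'I_n -> Z} -> bool) :
  let p := nlaw P x enc in
  \sum_(w | acc w.2 (fcomp y w.1) (fcomp z w.1)) nlaw Q x enc w =
  \sum_m \sum_b \sum_c (acc m b c)%:R * (law p (pairRV snd (fcomp z \o fst)) (m, c) *
     (law p (pairRV (fcomp y \o fst) (fcomp z \o fst)) (b, c) / law p (fcomp z \o fst) c)).
Proof.
move=> p.
pose K (b : {ffun 'I_n -> Y}) (c : {ffun 'I_n -> Z}) :=
  \prod_j (law P (pairRV y z) (b j, c j) / law P z (c j)).
have hK b c : law p (pairRV (fcomp y \o fst) (fcomp z \o fst)) (b, c) /
     law p (fcomp z \o fst) c = K b c.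
  rewrite law_nlaw_fst// law_prodm /K prodf_div; congr (_ / _).
  rewrite -[pairRV _ _]/(pairRV (fcomp y) (fcomp z) \o fst) law_nlaw_fst//.
  pose h (u : {ffun 'I_n -> Y * Z}) : {ffun 'I_n -> Y} * {ffun 'I_n -> Z} :=
    ([ffun j => (u j).1], [ffun j => (u j).2]).
  have hinj : injective h.
    move=> u v [/ffunP e1 /ffunP e2]; apply/ffunP => j.
    by have := e1 j; have := e2 j; rewrite !ffunE => e e'; apply: injective_projections.
  have -> : pairRV (fcomp y) (fcomp z) = h \o @fcomp 'I_n _ _ (pairRV y z).
    by apply/funext => s; congr (_, _); apply/ffunP => j; rewrite !ffunE.
  have -> : (b, c) = h [ffun j => (b j, c j)].
    by congr (_, _); apply/ffunP => j; rewrite !ffunE.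
  by rewrite law_inj// law_prodm; apply: eq_bigr => j _; rewrite ffunE.
under [RHS]eq_bigr do under eq_bigr do under eq_bigr do rewrite hK mulrCA.
under [RHS]eq_bigr do rewrite exchange_big/=.
under [RHS]eq_bigr do under eq_bigr do rewrite -mulr_sumr.
rewrite (sum_law_cond p snd (fcomp z \o fst) (fun m c => \sum_b (acc m b c)%:R * K b c)).
rewrite big_mkcond/=.
transitivity (\sum_s prodm Q s * \sum_m enc (fcomp x s) m * (acc m (fcomp y s) (fcomp z s))%:R).
  under [RHS]eq_bigr do rewrite mulr_sumr.
  rewrite pair_big/=; apply: eq_bigr => -[s m] _ /=.
  by rewrite /nlaw; case: (acc _ _ _); rewrite ?mulr1 ?mulr0//= ?mulr0.
rewrite (sum_alt (fun x y z => \sum_m enc x m * (acc m y z)%:R)).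
rewrite /p /nlaw.
transitivity (\sum_s \sum_m prodm P s * enc (fcomp x s) m *
   \sum_b (acc m b (fcomp z s))%:R * K b (fcomp z s)); last first.
  by rewrite pair_bigA; apply: eq_bigr => -[].
apply: eq_bigr => s _; under eq_bigr do rewrite mulr_sumr.
rewrite exchange_big/= mulr_sumr; apply: eq_bigr => m _.
rewrite -mulrA; congr (_ * _); rewrite mulr_sumr; apply: eq_bigr => b _.
rewrite mulrCA; congr (_ * _); rewrite mulrC; congr (_ * _).
by apply: eq_bigr => j _; rewrite ffunE.
Qed.

End Encoder.
End Alternative.

Section AltLaw.
Context {R : realType} {X Y1 Y2 Z1 Z2 : finType}.
Local Notation L := (letter X Y1 Y2 Z1 Z2).
Variable P : L -> R.
Hypothesis hP : is_pmf P.

Let P0 : forall l, 0 <= P l. Proof. by case: hP. Qed.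

(** If [c] has probability zero, the conditional law sums to 0 instead of 1, but the factor in front
    vanishes too. *)
Lemma sum_cond_law (A C D : finType) (y : L -> A) (z : L -> C) (u : L -> D) c d :
  \sum_b law P (pairRV u z) (d, c) * cond_law P y z b c = law P (pairRV u z) (d, c).
Proof.
rewrite -mulr_sumr /cond_law -mulr_suml -law_suml.
have [zc|zc] := eqVneq (law P z c) 0; last by rewrite divff// mulr1.
rewrite zc mul0r mulr0; apply/esym; apply: contraTeq (lexx (0 : R)) => k.
have : 0 < law P (pairRV u z) (d, c) by rewrite lt_neqAle eq_sym k law_ge0.
by move=> /(law_gt0_comp snd P0)/=; rewrite -[_ \o _]/z zc ltxx.
Qed.

Lemma law_alt_law1 a b c :
  law (alt_law P) (pairRV (pairRV rvX rvZ1) rvY1) (a, c, b) =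
  law P (pairRV rvX rvZ1) (a, c) * (law P (pairRV rvY1 rvZ1) (b, c) / law P rvZ1 c).
Proof.
rewrite /law (reindex_onto (fun yz : Y2 * Z2 => (a, b, yz.1, c, yz.2) : L)
  (fun s => (rvY2 s, rvZ2 s))); last first.
  by move=> [[[[x' y1'] y2'] z1'] z2'] /= /eqP[<- <- <-].
rewrite (eq_bigl xpredT); last by case=> y2 z2; rewrite /pairRV /= !eqxx.
rewrite -(pair_bigA _ (fun y2 z2 => alt_law P (a, b, y2, c, z2)))/= exchange_big/=.
rewrite -!/(law _ _ _) (law_sumr P (pairRV rvX rvZ1) rvZ2) mulr_suml.
apply: eq_bigr => z2 _; rewrite -[RHS]/(_ * cond_law P rvY1 rvZ1 b c).
rewrite /alt_law /rvX /rvY1 /rvY2 /rvZ1 /rvZ2/=.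
under eq_bigr do rewrite mulrAC.
by rewrite -mulr_suml sum_cond_law.
Qed.

Lemma law_alt_law2 a b c :
  law (alt_law P) (pairRV (pairRV rvX rvZ2) rvY2) (a, c, b) =
  law P (pairRV rvX rvZ2) (a, c) * (law P (pairRV rvY2 rvZ2) (b, c) / law P rvZ2 c).
Proof.
rewrite /law (reindex_onto (fun yz : Y1 * Z1 => (a, yz.1, b, yz.2, c) : L)
  (fun s => (rvY1 s, rvZ1 s))); last first.
  by move=> [[[[x' y1'] y2'] z1'] z2'] /= /eqP[<- <- <-].
rewrite (eq_bigl xpredT); last by case=> y1 z1; rewrite /pairRV /= !eqxx.
rewrite -(pair_bigA _ (fun y1 z1 => alt_law P (a, y1, b, z1, c)))/= exchange_big/=.
rewrite -!/(law _ _ _) -[X in _ = _ * X]/(cond_law P rvY2 rvZ2 b c).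
have e z1 : law P (pairRV (pairRV rvX rvZ1) rvZ2) (a, z1, c) =
    law P (pairRV (pairRV rvX rvZ2) rvZ1) (a, c, z1).
  by apply: eq_bigl => s; rewrite /pairRV !xpair_eqE andbAC.
rewrite (law_sumr P (pairRV rvX rvZ2) rvZ1) mulr_suml.
apply: eq_bigr => z1 _.
rewrite /alt_law /rvX /rvY1 /rvY2 /rvZ1 /rvZ2/=.
rewrite -mulr_suml; congr (_ * _).
by rewrite e sum_cond_law.
Qed.

Section Code.
Context {n : nat} {R0 R1 R2 : R}.
Variable c : @Defs.code R X Y1 Y2 Z1 Z2 n R0 R1 R2.

Lemma prob_dec1E (Q : L -> R) b : prob_dec1 c Q b =
  \sum_(w | dec1 c (fcomp rvY1 w.1) (fcomp rvZ1 w.1) w.2.1.1 w.2.1.2 == b)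
    nlaw Q rvX (enc c) w.
Proof.
rewrite /prob_dec1 pair_big_dep/=; apply: eq_big => [[s m]|[s m] _] //=.
Qed.

Lemma prob_dec2E (Q : L -> R) b : prob_dec2 c Q b =
  \sum_(w | dec2 c (fcomp rvY2 w.1) (fcomp rvZ2 w.1) w.2.1.1 w.2.2 == b)
    nlaw Q rvX (enc c) w.
Proof.
rewrite /prob_dec2 pair_big_dep/=; apply: eq_big => [[s m]|[s m] _] //=.
Qed.

Local Notation pn := (nlaw P rvX (enc c)).

Lemma sum_nlaw_predC (A : pred ({ffun 'I_n -> L} * (message n R0 * message n R1 * message n R2))) :
  \sum_(w | A w) pn w = 1 - \sum_(w | ~~ A w) pn w.
Proof.
have <- := sum_nlaw rvX hP (enc_pmf c).
by rewrite [in RHS](bigID A)/= addrK.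
Qed.

(** Common to both receivers. With the null accepted with probability at least [1 - eps], the change
    of measure gives [(1 - eps) n tau - (ln 2)^-1 <= I(M; Y^n | Z^n)]. *)
Lemma testing_converse (Y Z : finType) (y : L -> Y) (z : L -> Z)
    (dec : {ffun 'I_n -> Y} -> {ffun 'I_n -> Z} ->
       message n R0 * message n R1 * message n R2 -> bool) (eps tau : R) :
  (forall a b c', law (alt_law P) (pairRV (pairRV rvX z) y) (a, c', b) =
    law P (pairRV rvX z) (a, c') * (law P (pairRV y z) (b, c') / law P z c')) ->
  (0 < n)%N -> 0 < eps < 1 ->
  \sum_(w | dec (fcomp y w.1) (fcomp z w.1) w.2 == true) pn w <= eps ->
  \sum_(w | dec (fcomp y w.1) (fcomp z w.1) w.2 == false) nlaw (alt_law P) rvX (enc c) w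
    <= 2 `^ (- (n%:R * tau)) ->
  (1 - eps) * tau <= n%:R^-1 * mi_diff pn snd (fcomp (pairRV y z) \o fst) (fcomp z \o fst)
    + (n%:R * ln 2)^-1.
Proof.
move=> halt n0 /andP[e0 e1] ha hb.
have hpn := nlaw_pmf rvX hP (enc_pmf c); have [pn0 _] := hpn.
have <- : cond_mutual_info pn snd (fcomp y \o fst) (fcomp z \o fst) =
    mi_diff pn snd (fcomp (pairRV y z) \o fst) (fcomp z \o fst).
  rewrite cond_mutual_info_mi_diff//; apply: eq_mi_diff => // w w' _ _ /=.
    by case=> /ffunP e2 /ffunP e3; apply/ffunP => j; have := e2 j; have := e3 j;
      rewrite !ffunE /pairRV => -> ->.
  by move=> /ffunP e; rewrite /pairRV; congr (_, _); apply/ffunP => j; have := e j;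
      rewrite !ffunE => -[].
have D0 := cond_mutual_info_ge0 snd (fcomp y \o fst) (fcomp z \o fst) pn0.
have := @cond_mutual_info_test _ _ _ _ _ pn snd (fcomp y \o fst) (fcomp z \o fst)
  (fun m y z => ~~ dec y z m) (2 `^ (- (n%:R * tau))) hpn.
rewrite powR_gt0// => /(_ isT); rewrite -(alt_acceptance halt (enc_pmf c)).
have e b : ~~ b = (b == false) by case: b.
rewrite (eq_bigl _ _ (fun w => e _)) => /(_ hb).
rewrite sum_nlaw_predC (eq_bigl (fun w => dec (fcomp y w.1) (fcomp z w.1) w.2 == true)); last first.
  by move=> w; rewrite /= negbK eqb_id.
rewrite log2_powR opprK; set D := cond_mutual_info _ _ _ _ => H; rewrite -/D in D0.
have nR : 0 < n%:R :> R by rewrite ltr0n.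
have l2 := @ln2_gt0 R.
(* For negative [tau] the acceptance probability cannot be replaced by its lower bound [1 - eps];
   but then the left side is at most 0 and the right side is nonnegative. *)
have [t0|t0] := leP 0 tau; last first.
  apply: (@le_trans _ _ 0); first by rewrite mulr_ge0_le0 ?subr_ge0 ?ltW.
  by apply: addr_ge0; [apply: mulr_ge0 => //; rewrite invr_ge0 ltW|rewrite invr_ge0 ltW// mulr_gt0].
rewrite -(ler_pM2l nR) [leRHS]mulrDr mulVKf ?gt_eqF//.
rewrite invfM mulVKf ?gt_eqF// -lerBlDr; apply: le_trans H.
by rewrite lerD2r mulrCA ler_wpM2r ?mulr_ge0 ?(ltW nR)//; lra.
Qed.

Lemma converse1 (eps tau : R) : (0 < n)%N -> 0 < eps < 1 ->
  prob_dec1 c P true <= eps ->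
  prob_dec1 c (alt_law P) false <= 2 `^ (- (n%:R * tau)) ->
  (1 - eps) * tau <=
    n%:R^-1 * mi_diff pn snd (fcomp (pairRV rvY1 rvZ1) \o fst) (fcomp rvZ1 \o fst)
    + (n%:R * ln 2)^-1.
Proof.
rewrite !prob_dec1E; exact: (@testing_converse _ _ _ _ (fun y z m => dec1 c y z m.1.1 m.1.2) _ _ law_alt_law1).
Qed.

Lemma converse2 (eps tau : R) : (0 < n)%N -> 0 < eps < 1 ->
  prob_dec2 c P true <= eps ->
  prob_dec2 c (alt_law P) false <= 2 `^ (- (n%:R * tau)) ->
  (1 - eps) * tau <=
    n%:R^-1 * mi_diff pn snd (fcomp (pairRV rvY2 rvZ2) \o fst) (fcomp rvZ2 \o fst)
    + (n%:R * ln 2)^-1.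
Proof.
rewrite !prob_dec2E; exact: (@testing_converse _ _ _ _ (fun y z m => dec2 c y z m.1.1 m.2) _ _ law_alt_law2).
Qed.

End Code.

(** The message set has at most [2^(nr) + 1] elements, hence at most twice [2^(nr)], which costs one
    extra bit. *)
Lemma log2_card_message n (r : R) : 0 <= r ->
  log2 #|message n r|%:R <= n%:R * r + 1.
Proof.
move=> r0; rewrite card_ord.
have nr0 : 0 <= n%:R * r by rewrite mulr_ge0.
have p1 : 1 <= 2 `^ (n%:R * r).
  by rewrite -[leLHS](powRr0 2) ler_powR// ler1n.
rewrite -[leRHS]log2_powR; apply: ler_log2; first by rewrite ltr0n.
rewrite powRD ?powRr1//; last by rewrite pnatr_eq0/= implybT.
rewrite -natr1 mulr_natr mulr2n lerD//.
by rewrite truncn_le// (le_trans _ p1).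
Qed.

(** The 3 is one extra bit for each of the three messages; it disappears after division by [n]. *)
Lemma mi_diff_message_le n (R0 : R) (c : @Defs.code R X Y1 Y2 Z1 Z2 n R0 0 0) : 0 <= R0 ->
  mi_diff (nlaw P rvX (enc c)) snd fst (fun=> tt) <= n%:R * R0 + 3.
Proof.
move=> R00.
have hpn := nlaw_pmf rvX hP (enc_pmf c); have [pn0 pn1] := hpn.
set pn := nlaw _ _ _ in hpn pn0 pn1 *.
apply: (@le_trans _ _ (entropy pn snd)).
  rewrite -mutual_info_mi_diff// mutual_infoE// -addrA gerDl subr_le0.
  by apply: entropy_det => // w w' _ _ [].
apply: le_trans (entropy_le_card snd hpn _) _.
  by rewrite !card_prod !card_ord.
rewrite !card_prod !natrM.
have g0 r : 0 < #|message n r|%:R :> R by rewrite card_ord ltr0n.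
rewrite !log2M ?mulr_gt0//.
have := log2_card_message n R00; have := @log2_card_message n 0 (lexx _).
rewrite mulr0; lra.
Qed.

End AltLaw.

Section Exponent.
Local Open Scope classical_set_scope.
Local Open Scope ring_scope.
Context {R : realType}.

(** For [b <= 0] both sides are true, [lne] being minus infinity there. *)
Lemma elog2_le (n : nat) (b c : R) : (0 < n)%N ->
  ((n%:R^-1)%:E * elog2 b <= c%:E)%E = (b <= 2 `^ (n%:R * c)).
Proof.
move=> n0; have nR : 0 < n%:R :> R by rewrite ltr0n.
have p0 : 0 < 2 `^ (n%:R * c) :> R by rewrite powR_gt0.
rewrite /elog2; have [b0|b0] := leP b 0.
  rewrite le0_lneNy ?lee_fin// gt0_mulNye ?lte_fin ?invr_gt0 ?ln2_gt0//.
  rewrite gt0_muleNy ?lte_fin ?invr_gt0// leNye; apply/esym.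
  by apply: le_trans b0 _; exact: ltW.
rewrite lne_EFin// -!EFinM lee_fin -/(log2 b) ler_pdivrMl//.
rewrite -{1}(log2_powR (n%:R * c)) /log2 ler_pM2r ?invr_gt0 ?ln2_gt0//.
by rewrite ler_ln ?posrE.
Qed.

Lemma error_exponent_near (beta : nat -> R) (theta d : R) : 0 < d ->
  (theta%:E <= error_exponent beta)%E ->
  exists N, forall n, (N <= n)%N -> (0 < n)%N -> beta n <= 2 `^ (- (n%:R * (theta - d))).
Proof.
move=> d0; rewrite /error_exponent leeNr => h.
have : (limn_esup (fun n => (n%:R^-1)%:E * elog2 (beta n)) < (- theta + d)%:E)%E.
  by apply: le_lt_trans h _; rewrite -EFinN lte_fin ltrDl.
move=> /ereal_inf_lt[_ [A [N _ NA] <-] H]; exists N => n Nn n0.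
rewrite -mulrN opprB addrC -elog2_le//; apply: ltW; apply: le_lt_trans H.
by apply: ereal_sup_ubound; exists n => //; exact: NA.
Qed.

Lemma error_exponent_ge (beta : nat -> R) (theta : R) N :
  (forall n, (N <= n)%N -> (0 < n)%N -> beta n <= 2 `^ (- (n%:R * theta))) ->
  (theta%:E <= error_exponent beta)%E.
Proof.
move=> H; rewrite /error_exponent leeNr.
(* The tail starts at [N.+1] to exclude [n = 0]. *)
apply: (@le_trans _ _ (ereal_sup [set (n%:R^-1)%:E * elog2 (beta n) | n in [set n | (N.+1 <= n)%N]]))%E.
  apply: ereal_inf_lbound; exists [set n | (N.+1 <= n)%N] => //.
  by exists N.+1.
apply: ge_ereal_sup => _ [n /= Nn <-].
have n0 : (0 < n)%N by exact: leq_trans Nn.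
by rewrite elog2_le// mulrN; apply: H => //; exact: ltnW.
Qed.

End Exponent.

(** * Finite alphabets and limits *)

Section Caratheodory.
Context {R : realType} {I J : finType}.
Implicit Types (f : I -> J -> R) (lam : I -> R).

(** The coefficients form a nonzero vector in the left kernel of the matrix of the [f i] with [i] in
    [D]. Multiplying it by the sign of a nonzero entry makes that coefficient positive. *)
Lemma linear_dependence f (D : {set I}) : (#|J| < #|D|)%N ->
  exists c : I -> R, [/\ exists2 i, i \in D & 0 < c i,
    forall i, i \notin D -> c i = 0 & forall j, \sum_i c i * f i j = 0].
Proof.
move=> JD.
pose A : 'M[R]_(#|D|, #|J|) := \matrix_(a, b) f (enum_val a) (enum_val b).
have : kermx A != 0.
  rewrite kermx_eq0 /row_free; apply: contraTneq JD => <-.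
  by rewrite -leqNgt rank_leq_col.
move=> /rowV0Pn[v /sub_kermxP vA v0].
pose c (s : R) i := s * \sum_a v 0 a * (enum_val a == i)%:R.
have cE s a : c s (enum_val a) = s * v 0 a.
  rewrite /c (bigD1 a)//= eqxx mulr1 big1 ?addr0// => b ba.
  by rewrite (inj_eq enum_val_inj) (negbTE ba) mulr0.
have c0 s i : i \notin D -> c s i = 0.
  move=> iD; rewrite /c big1 ?mulr0// => a _; case: eqP => [ai|]; rewrite ?mulr0//.
  by move: iD; rewrite -ai enum_valP.
have cf s j : \sum_i c s i * f i j = 0.
  transitivity (s * (v *m A) 0 (enum_rank j)); last by rewrite vA mxE mulr0.
  rewrite mxE; under eq_bigr do rewrite /c -mulrA mulr_suml.
  rewrite -mulr_sumr exchange_big/=; congr (_ * _); apply: eq_bigr => a _.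
  rewrite mxE enum_rankK (bigD1 (enum_val a))//= eqxx mulr1 big1 ?addr0//.
  by move=> i ia; rewrite eq_sym (negbTE ia) mulr0 mul0r.
have [a va] : exists a, v 0 a != 0.
  apply/existsP; apply: contraNT v0; rewrite negb_exists => /forallP H.
  by apply/eqP/rowP => a; rewrite mxE; apply/eqP; have := H a; rewrite negbK.
exists (c (Num.sg (v 0 a))); split=> //; last exact: c0.
exists (enum_val a); first exact: enum_valP.
by rewrite cE -normrEsg normr_gt0.
Qed.

(** The weights move along a linear dependence until the first of them reaches zero, which happens
    at the least ratio [lam i / c i] with [c i] positive. *)
Lemma caratheodory_step f lam (D := [set i | lam i != 0%R]) :
  (forall i, 0 <= lam i) -> (#|J| < #|D|)%N ->
  exists lam', [/\ forall i, 0 <= lam' i,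
    forall j, \sum_i lam' i * f i j = \sum_i lam i * f i j &
    (#|[set i | lam' i != 0%R]| < #|D|)%N].
Proof.
move=> lam0 /(linear_dependence f)[c [[i0 i0D ci0] c0 cf]].
pose i1 := [arg min_(i < i0 | 0 < c i) lam i / c i]%O.
have [ci1 mini] : 0 < c i1 /\ forall i, 0 < c i -> lam i1 / c i1 <= lam i / c i.
  by rewrite /i1; case: arg_minP.
pose t := lam i1 / c i1.
have t0 : 0 <= t by rewrite divr_ge0// ltW.
exists (fun i => lam i - t * c i); split.
- move=> i; rewrite subr_ge0; have [ci|ci] := ltP 0 (c i).
    by rewrite -ler_pdivlMr// mini.
  by apply: le_trans (lam0 i); rewrite mulr_ge0_le0.
- move=> j; under eq_bigr do rewrite mulrBl -mulrA.
  by rewrite sumrB -mulr_sumr cf mulr0 subr0.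
- apply: proper_card; apply/properP; split.
    apply/fintype.subsetP => i; rewrite !inE; apply: contraNN => /eqP li.
    by rewrite li c0 ?inE ?li ?eqxx// mulr0 subr0.
  exists i1; first by rewrite inE; apply: contraTneq ci1 => li; rewrite c0 ?ltxx// inE li eqxx.
  by rewrite inE /t divfK ?subrr ?eqxx// gt_eqF.
Qed.

Lemma caratheodory f : exists lam, [/\ forall i, 0 <= lam i,
    forall j, \sum_i lam i * f i j = \sum_i f i j &
    (#|[set i | lam i != 0%R]| <= #|J|)%N].
Proof.
suff H N lam : (forall i, 0 <= lam i) -> (#|[set i | lam i != 0%R]| <= N)%N ->
  exists lam', [/\ forall i, 0 <= lam' i,
    forall j, \sum_i lam' i * f i j = \sum_i lam i * f i j &
    (#|[set i | lam' i != 0%R]| <= #|J|)%N].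
  have [] := H _ (fun=> 1) _ (leqnn _) => // lam [h1 h2 h3]; exists lam; split=> // j.
  by rewrite h2; under eq_bigr do rewrite mul1r.
elim: N lam => [|N IH] lam lam0 hN.
  by exists lam; split=> //; apply: leq_trans hN _.
have [JD|DJ] := ltnP #|J| #|[set i | lam i != 0%R]|; last by exists lam; split.
have [lam1 [l0 lf lD]] := caratheodory_step f lam0 JD.
have [] := IH lam1 l0; first by rewrite -ltnS (leq_trans lD).
by move=> lam' [h1 h2 h3]; exists lam'; split=> // j; rewrite h2.
Qed.

End Caratheodory.

Section KernelEntropy.
Context {R : realType} {L X : finType}.
Variables (x : L -> X) (P : L -> R).
Hypothesis hP : is_pmf P.

Let P0 l : 0 <= P l. Proof. by case: hP. Qed.

Definition column_law (A : finType) (f : L -> A) (k : X -> R) (a : A) : R :=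
  \sum_(l | f l == a) P l * k (x l).

Definition column_entropy (A : finType) (f : L -> A) (k : X -> R) : R :=
  \sum_a xlog (column_law f k a).

Definition column_diff (A B : finType) (f : L -> A) (g : L -> B) (k : X -> R) : R :=
  column_entropy f k - column_entropy g k.

(** Scaling adds [xlog c] times the total mass to both column entropies; the two additions cancel in
    the difference. *)
Lemma column_diffZ (A B : finType) (f : L -> A) (g : L -> B) (k : X -> R) (c : R) :
  0 <= c -> (forall a, 0 <= k a) ->
  column_diff f g (fun a => c * k a) = c * column_diff f g k.
Proof.
move=> c0 k0.
have Z (C : finType) (h : L -> C) : column_entropy h (fun a => c * k a) =
    c * column_entropy h k + xlog c * \sum_l P l * k (x l).
  rewrite [X in xlog c * X](partition_big h xpredT)//= !mulr_sumr -big_split/=.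
  apply: eq_bigr => b _; rewrite /column_law/=.
  under eq_bigr do rewrite mulrCA.
  rewrite -mulr_sumr xlogM//; first by rewrite [xlog c * _]mulrC.
  by apply: sumr_ge0 => l _; rewrite mulr_ge0.
by rewrite /column_diff !Z; ring.
Qed.

Section Joint.
Context {U A : finType}.
Variable k : X -> U -> R.
Hypothesis hk : is_kernel k.

Lemma entropy_kjoint (V : finType) (g : U -> V) (f : L -> A) :
  entropy (kjoint x P k) (pairRV (g \o fst) (f \o snd))
  = \sum_v column_entropy f (fun a => \sum_(u | g u == v) k a u).
Proof.
rewrite /entropy pair_bigA/=; apply: eq_bigr => -[v a] _ /=; congr xlog.
rewrite /law /column_law.
transitivity (\sum_(u | g u == v) \sum_(l | f l == a) P l * k (x l) u).
  by rewrite pair_big_dep; apply: eq_big => -[].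
by rewrite exchange_big/=; apply: eq_bigr => l _; rewrite mulr_sumr.
Qed.

End Joint.

(** The information is a constant minus a sum, over the values of the auxiliary, of homogeneous
    functionals of its columns; this is what makes conic combinations applicable. *)
Lemma mi_diff_kjoint (U V A B : finType) (k : X -> U -> R) (g : U -> V) (f : L -> A) (f' : L -> B) :
  is_kernel k ->
  mi_diff (kjoint x P k) (g \o fst) (f \o snd) (f' \o snd) =
  entropy P f - entropy P f' - \sum_v column_diff f f' (fun a => \sum_(u | g u == v) k a u).
Proof.
by move=> hk; rewrite /mi_diff !entropy_kjoint !entropy_kjoint_snd// sumrB.
Qed.

Section Reduce.
Context {V W : finType}.
Variable k : X -> V * W -> R.
Hypothesis hk : is_kernel k.
Variables (A1 B1 A2 B2 A3 B3 A4 B4 : finType).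
Variables (h1 : L -> A1) (h1' : L -> B1) (h2 : L -> A2) (h2' : L -> B2).
Variables (h3 : L -> A3) (h3' : L -> B3) (h4 : L -> A4) (h4' : L -> B4).

Lemma sum_fst (F' : V * W -> R) v : \sum_(u | u.1 == v) F' u = \sum_w F' (v, w).
Proof.
rewrite (reindex_onto (fun w => (v, w)) snd)/=; last by move=> [v' w] /= /eqP ->.
by apply: eq_bigl => w; rewrite !eqxx.
Qed.

Lemma sum_id (U : finType) (F' : U -> R) v : \sum_(u | u == v) F' u = F' v.
Proof. by rewrite big_pred1_eq. Qed.

(* Conic Caratheodory, first on the columns [k(., (v, w))] of each [v], then on
   the aggregated columns of the [v]; [column_diff] is homogeneous, so rescaling
   a column rescales its contribution. *)
Lemma kernel_support : exists k' : X -> V * W -> R,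
  [/\ is_kernel k',
      (#|[set v | [exists a, exists w, k' a (v, w) != 0%R]]| <= #|X| + 4)%N,
      (forall v, #|[set w | [exists a, k' a (v, w) != 0%R]]| <= #|X| + 2)%N &
      [/\ mi_diff (kjoint x P k') (id \o fst) (h1 \o snd) (h1' \o snd) =
          mi_diff (kjoint x P k) (id \o fst) (h1 \o snd) (h1' \o snd),
          mi_diff (kjoint x P k') (id \o fst) (h2 \o snd) (h2' \o snd) =
          mi_diff (kjoint x P k) (id \o fst) (h2 \o snd) (h2' \o snd),
          mi_diff (kjoint x P k') (fst \o fst) (h3 \o snd) (h3' \o snd) =
          mi_diff (kjoint x P k) (fst \o fst) (h3 \o snd) (h3' \o snd) &
          mi_diff (kjoint x P k') (fst \o fst) (h4 \o snd) (h4' \o snd) =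
          mi_diff (kjoint x P k) (fst \o fst) (h4 \o snd) (h4' \o snd)]].
Proof.
(* These are [#|X| + 2] coordinates: the entries of the column keep the aggregate over [w], the
   other two keep the contributions to the first two differences. *)
pose ft v w (j : X + bool) := match j with
  | inl a => k a (v, w)
  | inr true => column_diff h1 h1' (fun a => k a (v, w))
  | inr false => column_diff h2 h2' (fun a => k a (v, w)) end.
have [lam hlam] := choice (fun v => caratheodory (ft v)).
pose kV v a := \sum_w k a (v, w).
(* These are [#|X| + 4] coordinates: the entries keep the total mass of the kernel at each symbol
   equal to one, the other four keep the four differences. *)
pose gt v (j : X + bool * bool) := match j with
  | inl a => kV v a
  | inr (true, true) => \sum_w column_diff h1 h1' (fun a => k a (v, w))
  | inr (true, false) => \sum_w column_diff h2 h2' (fun a => k a (v, w))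
  | inr (false, true) => column_diff h3 h3' (kV v)
  | inr (false, false) => column_diff h4 h4' (kV v) end.
have [mu [mu0 mug muc]] := caratheodory gt.
have k0 a u : 0 <= k a u by case: (hk a).
have kV0 v a : 0 <= kV v a by exact: sumr_ge0.
have lam0 v w : 0 <= lam v w by case: (hlam v).
pose k' a u := mu u.1 * (lam u.1 u.2 * k a u).
have kV' v a : \sum_w k' a (v, w) = mu v * kV v a.
  rewrite /k'/= -mulr_sumr; congr (_ * _).
  by have [_ /(_ (inl a))] := hlam v.
have hk' : is_kernel k'.
  move=> a; split=> [u|]; first by rewrite /k' !mulr_ge0.
  rewrite sum_pair.
  under eq_bigr do rewrite kV'.
  have /= -> := mug (inl a); rewrite pair_bigA/=.
  by case: (hk a) => _ <-; apply: eq_bigr => -[].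
exists k'; split => //.
- rewrite -[4%N]/(2 * 2)%N -card_bool -card_prod -card_sum; apply: leq_trans muc.
  apply/subset_leq_card/fintype.subsetP => v; rewrite !inE.
  by move=> /existsP[a /existsP[w]]; apply: contraNN => /eqP; rewrite /k'/= => ->; rewrite mul0r.
- move=> v; rewrite -card_bool -card_sum; have [_ _] := hlam v; apply: leq_trans.
  apply/subset_leq_card/fintype.subsetP => w; rewrite !inE.
  by move=> /existsP[a]; apply: contraNN => /eqP; rewrite /k'/= => ->; rewrite mul0r mulr0.
rewrite !mi_diff_kjoint//.
have eW (A' B' : finType) (h : L -> A') (h' : L -> B') (j j' : _) :
    (forall v w, ft v w (inr j) = column_diff h h' (fun a => k a (v, w))) ->
    (forall v, gt v (inr j') = \sum_w column_diff h h' (fun a => k a (v, w))) ->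
    \sum_v column_diff h h' (fun a => \sum_(u | id u == v) k' a u)
     = \sum_v column_diff h h' (fun a => \sum_(u | id u == v) k a u).
  move=> jE j'E.
  have sid (q : X -> V * W -> R) u : column_diff h h' (fun a => \sum_(u0 | id u0 == u) q a u0)
     = column_diff h h' (fun a => q a u).
    by congr column_diff; apply/funext => a; rewrite sum_id.
  under eq_bigr do rewrite sid; under [RHS]eq_bigr do rewrite sid.
  rewrite !sum_pair.
  under [RHS]eq_bigr do rewrite -j'E.
  rewrite -(mug (inr j')); apply: eq_bigr => v _.
  rewrite j'E mulr_sumr.
  have [_ /(_ (inr j)) e _] := hlam v; rewrite -mulr_sumr.
  under [in RHS]eq_bigr do rewrite -jE.
  rewrite -e mulr_sumr; apply: eq_bigr => w _; rewrite jE.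
  by rewrite column_diffZ// ?column_diffZ// => a; rewrite mulr_ge0.
have eV (A' B' : finType) (h : L -> A') (h' : L -> B') (j' : _) :
    (forall v, gt v (inr j') = column_diff h h' (kV v)) ->
    \sum_v column_diff h h' (fun a => \sum_(u | u.1 == v) k' a u)
     = \sum_v column_diff h h' (fun a => \sum_(u | u.1 == v) k a u).
  move=> j'E.
  transitivity (\sum_v mu v * gt v (inr j')).
    apply: eq_bigr => v _; rewrite j'E -column_diffZ//.
    by congr column_diff; apply/funext => a; rewrite sum_fst kV'.
  rewrite mug; apply: eq_bigr => v _; rewrite j'E.
  by congr column_diff; apply/funext => a; rewrite sum_fst.
split; congr (_ - _ - _).
- exact: (@eW _ _ _ _ true (true, true)).
- exact: (@eW _ _ _ _ false (true, false)).
- exact: (@eV _ _ _ _ (false, true)).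
- exact: (@eV _ _ _ _ (false, false)).
Qed.

End Reduce.
End KernelEntropy.

Lemma mi_diff_law {R : realType} {W W' A B C : finType} (p : W -> R) (F : W -> W')
    (U : W' -> A) (f : W' -> B) (g : W' -> C) :
  mi_diff (law p F) U f g = mi_diff p (U \o F) (f \o F) (g \o F).
Proof. by rewrite /mi_diff !entropy_law. Qed.

Lemma set_label (T : finType) (D : {set T}) K : (#|D| <= K)%N ->
  exists g : T -> 'I_K.+1, {in D &, injective g}.
Proof.
move=> DK; exists (fun t => inord (index t (enum D))) => t t' tD t'D e.
have h u : u \in D -> (index u (enum D) < K.+1)%N.
  by move=> uD; rewrite ltnS (leq_trans _ DK)// cardE ltnW// index_mem mem_enum.
have : index t (enum D) = index t' (enum D).
  by rewrite -[LHS](@inordK K) ?h// e inordK ?h.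
by move=> /(congr1 (nth t (enum D))); rewrite !nth_index ?mem_enum.
Qed.

Section Relabel.
Context {R : realType} {L X : finType}.
Variables (x : L -> X) (P : L -> R).
Hypothesis hP : is_pmf P.

Lemma law_kernel (U U' : finType) (k : X -> U -> R) (r : U -> U') :
  is_kernel k -> is_kernel (fun a => law (k a) r).
Proof.
by move=> hk a; have [k0 k1] := hk a; split=> [u|]; [exact: law_ge0|rewrite sum_law1].
Qed.

Lemma kjoint_law (U U' : finType) (k : X -> U -> R) (r : U -> U') :
  kjoint x P (fun a => law (k a) r) = law (kjoint x P k) (fun w => (r w.1, w.2)).
Proof.
apply/funext => -[u l]; rewrite /kjoint /law/= mulr_sumr.
rewrite (reindex_onto (fun v => (v, l)) fst)/=.
  by apply: eq_big => v; rewrite ?xpair_eqE ?eqxx ?andbT.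
by move=> [v l'] /eqP[_ ->].
Qed.

(** The alphabets now depend on [#|X|] only. The labels of [w] are chosen for each [v] separately,
    so [w] is recovered from both labels together. *)
Lemma kernel_bounded (V W A1 B1 A2 B2 A3 B3 A4 B4 : finType) (k : X -> V * W -> R)
    (h1 : L -> A1) (h1' : L -> B1) (h2 : L -> A2) (h2' : L -> B2)
    (h3 : L -> A3) (h3' : L -> B3) (h4 : L -> A4) (h4' : L -> B4) : is_kernel k ->
  exists k' : X -> 'I_(#|X| + 4).+1 * 'I_(#|X| + 2).+1 -> R,
  [/\ is_kernel k',
      mi_diff (kjoint x P k') fst (h1 \o snd) (h1' \o snd) =
      mi_diff (kjoint x P k) fst (h1 \o snd) (h1' \o snd),
      mi_diff (kjoint x P k') fst (h2 \o snd) (h2' \o snd) =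
      mi_diff (kjoint x P k) fst (h2 \o snd) (h2' \o snd),
      mi_diff (kjoint x P k') (fst \o fst) (h3 \o snd) (h3' \o snd) =
      mi_diff (kjoint x P k) (fst \o fst) (h3 \o snd) (h3' \o snd) &
      mi_diff (kjoint x P k') (fst \o fst) (h4 \o snd) (h4' \o snd) =
      mi_diff (kjoint x P k) (fst \o fst) (h4 \o snd) (h4' \o snd)].
Proof.
move=> hk; have [k1 [hk1 cV cW [e1 e2 e3 e4]]] := kernel_support x hP hk h1 h1' h2 h2' h3 h3' h4 h4'.
have [g gi] := set_label cV.
have [h hi] := choice (fun v => set_label (cW v)).
pose r (u : V * W) := (g u.1, h u.1 u.2).
exists (fun a => law (k1 a) r); rewrite kjoint_law.
have q0 : forall w, 0 <= kjoint x P k1 w by exact: kjoint_ge0.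
have sV u l : kjoint x P k1 (u, l) != 0 -> u.1 \in [set v | [exists a, exists w, k1 a (v, w) != 0%R]].
  rewrite /kjoint mulf_eq0 negb_or/= inE => /andP[_ ne].
  by apply/existsP; exists (x l); apply/existsP; exists u.2; rewrite -surjective_pairing.
have sW u l : kjoint x P k1 (u, l) != 0 -> u.2 \in [set w | [exists a, k1 a (u.1, w) != 0%R]].
  rewrite /kjoint mulf_eq0 negb_or/= inE => /andP[_ ne].
  by apply/existsP; exists (x l); rewrite -surjective_pairing.
have dV : determines (kjoint x P k1) (fun w => g w.1.1) (fun w => w.1.1).
  move=> [u l] [u' l'] /sV uD /sV uD'; exact: gi.
have dW : determines (kjoint x P k1) (fun w => r w.1) (fun w => w.1).
  move=> [u l] [u' l'] ku ku'; rewrite /r /= => -[e].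
  have uu' : u.1 = u'.1 by exact: (dV (u, l) (u', l') ku ku').
  rewrite -uu' => e'; apply: injective_projections => //.
  apply: (hi u.1) e'; first exact: sW ku.
  by rewrite uu'; exact: sW ku'.
split; first exact: law_kernel.
- rewrite mi_diff_law -e1; apply: eq_mi_diff => // w w' _ _.
  by rewrite /= => ->.
- rewrite mi_diff_law -e2; apply: eq_mi_diff => // w w' _ _.
  by rewrite /= => ->.
- rewrite mi_diff_law -e3; apply: eq_mi_diff => // w w' _ _.
  by rewrite /= => ->.
- rewrite mi_diff_law -e4; apply: eq_mi_diff => // w w' _ _.
  by rewrite /= => ->.
Qed.

End Relabel.

(** * Continuity and compactness *)

Section Limit.
Local Open Scope classical_set_scope.
Local Open Scope ring_scope.
Context {R : realType}.

(** The bound [ln u <= u] at [u = y^(-1/2)]; it gives the continuity of [xlog] at 0. *)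
Lemma xlog_sqrt (y : R) : 0 < y < 1 -> `|xlog y| <= 2 / ln 2 * Num.sqrt y.
Proof.
move=> /andP[y0 y1].
have sy : 0 < Num.sqrt y by rewrite sqrtr_gt0.
have ly : ln y < 0 by rewrite ln_lt0// y0.
rewrite /xlog /log2 mulrA -mulNr normrM [`|(ln 2)^-1|]ger0_norm ?invr_ge0 ?(ltW ln2_gt0)//.
rewrite [leRHS]mulrAC ler_pM2r ?invr_gt0 ?ln2_gt0//.
rewrite normrN normrM (ger0_norm (ltW y0)) (ltr0_norm ly).
have ey : y = Num.sqrt y ^+ 2 by rewrite sqr_sqrtr// ltW.
have : ln (Num.sqrt y)^-1 <= (Num.sqrt y)^-1 by rewrite ltW// ln_sublinear// invr_gt0.
rewrite lnV ?posrE// => h.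
have -> : ln y = ln (Num.sqrt y) *+ 2 by rewrite {1}ey lnXn.
rewrite {1}ey expr2 -mulrA mulrC ler_pM2r// mulr2n.
have : Num.sqrt y * - ln (Num.sqrt y) <= 1.
  by rewrite mulrC -ler_pdivlMr// div1r.
by lra.
Qed.

Lemma continuous_xlog : continuous (@xlog R).
Proof.
move=> y; have [y0|y0|<-] := ltgtP 0 y.
- rewrite /xlog /log2; apply: cvgN; apply: cvgM; first exact: cvg_id.
  by apply: cvgMl; exact: continuous_ln.
- rewrite /continuous_at; have -> : xlog y = 0 by rewrite /xlog log2_le0 ?mulr0 ?oppr0//; exact: ltW.
  apply: cvg_near_cst; near=> t; rewrite /xlog log2_le0 ?mulr0 ?oppr0// ltW//.
  by near: t; exact: lt_nbhsl.
- rewrite /continuous_at xlog0; apply/cvgr0Pnorm_le => e e0.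
  have c0 : 0 < 2 / ln 2 :> R by rewrite divr_gt0// ln2_gt0.
  have d0 : 0 < (2 / ln 2)^-1 * e by rewrite mulr_gt0// invr_gt0.
  near=> t.
  have [t0|t0] := ltP 0 t; last first.
    by rewrite /xlog log2_le0// mulr0 oppr0 normr0 ltW.
  have t1 : t < 1 by near: t; exact: lt_nbhsl.
  apply: le_trans (xlog_sqrt _) _; first by rewrite t0.
  rewrite -ler_pdivlMl//.
  have : t < ((2 / ln 2)^-1 * e) ^+ 2.
    by near: t; apply: lt_nbhsl; rewrite exprn_gt0.
  move=> /ltW; rewrite -ler_sqrt; last by rewrite exprn_ge0// ltW.
  by rewrite sqrtr_sqr ger0_norm// ltW.
Unshelve. all: by end_near. Qed.

Lemma cvg_fsum (I T : Type) (r : seq I) (Q : pred I) (G : set_system T) (f : I -> T -> R) (l : I -> R) :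
  Filter G -> (forall i, Q i -> f i n @[n --> G] --> l i) ->
  \sum_(i <- r | Q i) f i n @[n --> G] --> \sum_(i <- r | Q i) l i.
Proof. by move=> GF h; apply: cvg_big => //; exact: add_continuous. Qed.

Context {L X : finType}.
Variables (x : L -> X) (P : L -> R).
Hypothesis hP : is_pmf P.

Section Filter.
Context {U : finType} {G : set_system nat} {GF : ProperFilter G}.
Variables (k : nat -> X -> U -> R) (k' : X -> U -> R).
Hypothesis kk' : forall a u, k n a u @[n --> G] --> k' a u.

Lemma cvg_entropy_kjoint (A : finType) (F : U * L -> A) :
  entropy (kjoint x P (k n)) F @[n --> G] --> entropy (kjoint x P k') F.
Proof.
apply: cvg_fsum => a _.
apply: (@continuous_cvg _ _ _ _ _ (fun n => law (kjoint x P (k n)) F a) (@xlog R)).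
  exact: continuous_xlog.
by apply: cvg_fsum => w _; apply: cvgMr; exact: kk'.
Qed.

Lemma cvg_mi_diff_kjoint (A B C : finType) (F : U * L -> A) (f : U * L -> B) (g : U * L -> C) :
  mi_diff (kjoint x P (k n)) F f g @[n --> G] --> mi_diff (kjoint x P k') F f g.
Proof.
by apply: cvgB; apply: cvgB; exact: cvg_entropy_kjoint.
Qed.

Lemma is_kernel_cvg : (forall n, is_kernel (k n)) -> is_kernel k'.
Proof.
move=> hk a; split=> [u|].
  apply: (cvgr_to_ge (@kk' a u)).
  by apply: nearW => n; case: (hk n a).
have h : \sum_u k n a u @[n --> G] --> \sum_u k' a u by exact: cvg_fsum.
have h1 : \sum_u k n a u @[n --> G] --> (1 : R).
  by apply: cvg_near_cst; apply: nearW => n; case: (hk n a) => _ ->.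
exact: (cvg_unique (@Rhausdorff R) h h1).
Qed.

End Filter.

(** Along an ultrafilter finer than the cofinite filter all entries converge at once, since they lie
    in the compact interval from 0 to 1. *)
Lemma kernel_cluster (U : finType) (k : nat -> X -> U -> R) : (forall n, is_kernel (k n)) ->
  exists (G : set_system nat) (k' : X -> U -> R), [/\ ProperFilter G, \oo `<=` G &
    forall a u, k n a u @[n --> G] --> k' a u].
Proof.
move=> hk; have [G [GU oG]] := @ultraFilterLemma _ \oo _.
exists G.
suff H a u : exists l : R, k n a u @[n --> G] --> l.
  have [k' hk'] := choice (fun au : X * U => H au.1 au.2).
  exists (fun a u => k' (a, u)); split=> [|//|a u]; last exact: (hk' (a, u)).
  exact: ultra_proper.
have PG : ProperFilter G by exact: ultra_proper.
have /segment_compact[] : (k n a u @[n --> G]) `[0, 1]%classic.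
  apply: nearW => n; rewrite /= in_itv/=; have [k0 k1] := hk n a.
  by rewrite k0/= -k1 (bigD1 u)//= lerDl sumr_ge0.
move=> l [_ cl]; exists l => A lA.
have [//|GA] := in_ultra_setVsetC ((fun n => k n a u) @^-1` A) GU.
by have [t [nAt At]] := cl (~` A) A GA lA.
Qed.

End Limit.

(** * From codes to single-letter bounds *)

Section Converse.
Context {R : realType} {X Y1 Y2 Z1 Z2 : finType}.
Local Notation L := (letter X Y1 Y2 Z1 Z2).
Variable P : L -> R.
Hypotheses (hP : is_pmf P) (hZ2 : constant_Z2 P).
Variable R0 : R.
Hypothesis hR0 : 0 <= R0.

(** With [fst] standing for [(V, W)] and [fst \o fst] for [V], the bounds are on [I(V, W; Y1 | Z1)],
    on [I(V; Y2)], and [t.2 + I(V; Z1) - I(V; Y2) + I(V, W; X | Z1) <= R0], each up to the slack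
    [e]. *)
Definition single_letter_bounds (t : R * R) (e : R) (VT WT : finType)
    (k : X -> VT * WT -> R) : Prop :=
  let q := kjoint rvX P k in
  [/\ is_kernel k,
      t.1 <= mi_diff q fst (pairRV rvY1 rvZ1 \o snd) (rvZ1 \o snd) + e,
      t.2 <= mi_diff q (fst \o fst) (rvY2 \o snd) ((fun=> tt) \o snd) + e &
      t.2 + mi_diff q (fst \o fst) (rvZ1 \o snd) (rvY2 \o snd)
        + mi_diff q fst (pairRV rvX rvZ1 \o snd) (rvZ1 \o snd) <= R0 + e].

Lemma constant_Z2_support l : P l != 0 -> forall l', P l' != 0 -> rvZ2 l = rvZ2 l'.
Proof.
case: hP => [P0 P1]; case: hZ2 => z2 hz2.
have H m : P m != 0 -> rvZ2 m = z2.
  move=> Pm; apply/eqP; apply: contraT => mz.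
  have : \sum_(l | rvZ2 l != z2) P l = 0.
    by move: hz2 P1; rewrite /law (bigID (fun l => rvZ2 l == z2) xpredT)/= => ->; lra.
  move=> /eqP; rewrite psumr_eq0// => /allP/(_ m); rewrite mem_index_enum mz/=.
  by move=> /(_ isT); rewrite (negbTE Pm).
by move=> /H -> l' /H ->.
Qed.

Lemma region_near (t : R * R) (d : R) : 0 < d -> exponents_region P R0 0 0 t ->
  exists t' : R * R, [/\ 0 <= t'.1, 0 <= t'.2, t.1 <= t'.1 + d /\ t.2 <= t'.2 + d,
     t'.1 <= t.1 + d /\ t'.2 <= t.2 + d & forall eps : R, 0 < eps < 1 ->
      achievable P eps t'.1 t'.2 R0 0 0].
Proof.
move=> d0 /(_ _ (nbhsx_ballx t d d0)) [t' [[t10 t20 ach] [/= b1 b2]]].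
exists t'; split=> //.
- by move: b1 b2; rewrite /ball/= !ltr_distl => /andP[? ?] /andP[? ?]; split; lra.
- by move: b1 b2; rewrite /ball/= !ltr_distl => /andP[? ?] /andP[? ?]; split; lra.
Qed.

Lemma region_ge0 (t : R * R) : exponents_region P R0 0 0 t -> 0 <= t.1 /\ 0 <= t.2.
Proof.
move=> ht; split; apply/ler_addgt0Pr => d d0;
  by have [t' [h1 h2 _ [h3 h4] _]] := region_near d0 ht; lra.
Qed.

(** The factor [1 - eps] of the change of measure costs [eps] times an exponent. Choosing [eps]
    after the approximating point [t'] makes this at most [d]; a large [n] makes the remainders of
    order [1/n] at most [d] too. *)
Lemma region_single_letter (t : R * R) (e : R) : 0 < e -> exponents_region P R0 0 0 t ->
  exists (VT WT : finType) (k : X -> VT * WT -> R), single_letter_bounds t e k.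
Proof.
move=> e0 ht.
have [d [d0 de d1]] : exists d : R, [/\ 0 < d, d * 8 <= e & d < 1].
  exists (Num.min e 1 / 8); split; first by rewrite divr_gt0// lt_min e0/=.
    by rewrite divfK// ge_min lexx.
  by rewrite ltr_pdivrMr// mul1r gt_min ltr1n orbT.
have [t' [t10 t20 [tt1 tt2] _ ach]] := region_near d0 ht.
pose eps := d / (t'.1 + t'.2 + 1).
have s1 : 1 <= t'.1 + t'.2 + 1 by lra.
have s0 : 0 < t'.1 + t'.2 + 1 by lra.
have eps0 : 0 < eps by rewrite divr_gt0.
have epsd : eps <= d by rewrite ler_pdivrMr// ler_peMr// ltW.
have epsE : eps * (t'.1 + t'.2 + 1) = d by rewrite /eps divfK// gt_eqF.
have heps : 0 < eps < 1 by rewrite eps0 (le_lt_trans epsd).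
have [c [a1 a2 b1 b2]] := ach eps heps.
have [N1 B1] := error_exponent_near d0 b1.
have [N2 B2] := error_exponent_near d0 b2.
pose n := (maxn (maxn N1 N2) (Num.truncn (3 / (d * ln 2) + 3 / d)).+1)%N.
have n0 : (0 < n)%N by rewrite /n !leq_max orbT.
have nR : 0 < n%:R :> R by rewrite ltr0n.
have nN1 : (N1 <= n)%N by rewrite /n !leq_max leqnn.
have nN2 : (N2 <= n)%N by rewrite /n !leq_max leqnn orbT.
have l2 := @ln2_gt0 R.
have nbig : 3 / (d * ln 2) + 3 / d <= n%:R.
  have := truncnS_gt (3 / (d * ln 2) + 3 / d) => /ltW h; apply: le_trans h _.
  by rewrite ler_nat /n leq_max leqnn orbT.
have n1 : 3 / (d * ln 2) <= n%:R.
  by apply: le_trans nbig; rewrite lerDl divr_ge0// ltW.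
have n2 : 3 / d <= n%:R.
  by apply: le_trans nbig; rewrite lerDr divr_ge0// mulr_ge0// ltW.
have i1 : (n%:R * ln 2)^-1 <= d.
  rewrite invfM ler_pdivrMr// -[X in X <= _]mulr1 ler_pdivrMl//.
  move: n1; rewrite ler_pdivrMr ?mulr_gt0//; lra.
have i2 : n%:R^-1 * 3 <= d by rewrite ler_pdivrMl//; move: n2; rewrite ler_pdivrMr.
have := converse1 hP n0 heps (a1 n n0) (B1 n nN1 n0).
have := converse2 hP n0 heps (a2 n n0) (B2 n nN2 n0).
set pn := nlaw P rvX (enc (c n)) => K2 K1.
have hpn : is_pmf pn by exact: nlaw_pmf (enc_pmf (c n)).
have [pn0 _] := hpn.
have [VT [WT [k [hk s1' s2' s3']]]] := single_letterization rvX hP (enc_pmf (c n)) n0 rvY1 rvY2 rvZ1.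
rewrite -/pn in s1' s2' s3'.
have zP w w' : pn w != 0 -> pn w' != 0 -> fcomp (@rvZ2 X Y1 Y2 Z1 Z2) w.1 = fcomp rvZ2 w'.1.
  rewrite /pn /nlaw !mulf_eq0 !negb_or => /andP[pw _] /andP[pw' _].
  apply/ffunP => j; rewrite !ffunE; apply: constant_Z2_support; exact: prodm_neq0.
have e2 : mi_diff pn snd (fcomp (pairRV rvY2 rvZ2) \o fst) (fcomp rvZ2 \o fst) =
   mi_diff pn snd (fcomp rvY2 \o fst) (fun=> tt).
  apply: eq_mi_diff => //.
  - move=> w w' _ _ /= /ffunP E; apply/ffunP => j; have := E j.
    by rewrite !ffunE => -[].
  - move=> w w' pw pw' /= /ffunP E; apply/ffunP => j; have := E j.
    have /ffunP/(_ j) := zP w w' pw pw'.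
    by rewrite !ffunE /pairRV => -> ->.
  - by move=> w w' pw pw' _; exact: zP.
rewrite e2 in K2.
have m3 : n%:R^-1 * mi_diff pn snd fst (fun=> tt) <= R0 + d.
  apply: le_trans (_ : n%:R^-1 * (n%:R * R0 + 3) <= _).
    by rewrite ler_wpM2l ?invr_ge0 ?(ltW nR)//; exact: mi_diff_message_le.
  by rewrite mulrDr mulKf ?gt_eqF// lerD2l.
have ed : 0 <= eps * d by rewrite mulr_ge0// ltW.
have et1 : eps * t'.1 <= d by rewrite -epsE ler_pM2l//; lra.
have et2 : eps * t'.2 <= d by rewrite -epsE ler_pM2l//; lra.
have K1' : (1 - eps) * (t'.1 - d) = t'.1 - d - eps * t'.1 + eps * d by ring.
have K2' : (1 - eps) * (t'.2 - d) = t'.2 - d - eps * t'.2 + eps * d by ring.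
rewrite K1' in K1; rewrite K2' in K2.
exists VT, WT, k; split=> //.
- apply: le_trans (lerD s1' (lexx e)); lra.
- apply: le_trans (lerD s2' (lexx e)); lra.
- move: s3'; set J1 := mi_diff _ _ _ _; set J2 := mi_diff (kjoint _ _ _) _ _ _.
  set J3 := mi_diff (kjoint _ _ _) _ _ _ => s3'.
  rewrite -/J1 in K2 e2; lra.
Qed.

End Converse.

(** * Auxiliary kernels and erasures *)

Section Markov.
Context {R : realType} {L X U : finType}.
Variables (x : L -> X) (P : L -> R) (k : X -> U -> R).

Lemma law_kjoint (V A : finType) (g : U -> V) (f : L -> A) (v : V) (a : X) (b : A) :
  law (kjoint x P k) (pairRV (pairRV (g \o fst) (x \o snd)) (f \o snd)) (v, a, b) =
  law (k a) g v * law P (pairRV x f) (a, b).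
Proof.
rewrite /law mulr_suml.
transitivity (\sum_(u | g u == v) \sum_(l | pairRV x f l == (a, b)) P l * k (x l) u).
  rewrite pair_big_dep; apply: eq_big => -[u l] //=.
  by rewrite /pairRV !xpair_eqE/= andbA.
apply: eq_bigr => u _; rewrite mulr_sumr; apply: eq_bigr => l /eqP[<- _].
by rewrite mulrC.
Qed.

Lemma law_kjoint2 (V : finType) (g : U -> V) (v : V) (a : X) :
  law (kjoint x P k) (pairRV (g \o fst) (x \o snd)) (v, a) = law (k a) g v * law P x a.
Proof.
rewrite (law_sumr _ _ ((fun=> tt) \o snd)) (law_sumr P x (fun=> tt)) mulr_sumr.
by apply: eq_bigr => u _; rewrite law_kjoint.
Qed.

Hypotheses (hP : is_pmf P) (hk : is_kernel k).

Lemma markov_kjoint (V A : finType) (g : U -> V) (f : L -> A) :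
  markov_chain (kjoint x P k) (g \o fst) (x \o snd) (f \o snd).
Proof.
move=> v a b; rewrite law_kjoint law_kjoint2.
rewrite -[pairRV (x \o snd) (f \o snd)]/(pairRV x f \o snd) !law_kjoint_snd//.
by rewrite mulrAC.
Qed.

Lemma aux_extension_kjoint : is_pmf (kjoint x P k) /\
  forall l, law (kjoint x P k) snd l = P l.
Proof.
split=> [|l]; first exact: kjoint_pmf.
rewrite -[snd]/(id \o @snd U L) law_kjoint_snd// /law.
by rewrite (eq_bigl (pred1 l))// big_pred1_eq.
Qed.

End Markov.

Section Erasure.
Context {R : realType} {L X U : finType}.
Variables (x : L -> X) (P : L -> R) (k : X -> U -> R) (tau : R).
Hypotheses (hP : is_pmf P) (hk : is_kernel k) (htau : 0 <= tau <= 1).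

Definition coin (e : bool) : R := if e then tau else 1 - tau.

(** The coin is independent of auxiliary and letter and stays in the new auxiliary; an erasure is
    then a function of coin and old auxiliary. *)
Definition mixed_kernel (a : X) (eu : bool * U) : R := coin eu.1 * k a eu.2.

Lemma coin_pmf : is_pmf coin.
Proof.
case/andP: htau => t0 t1; split; first by case; rewrite /coin ?subr_ge0.
by rewrite big_bool/= /coin addrCA subrr addr0.
Qed.

Lemma mixed_kernelP : is_kernel mixed_kernel.
Proof.
move=> a; have [k0 k1] := hk a; have [c0 c1] := coin_pmf.
split=> [u|]; first by rewrite mulr_ge0.
rewrite sum_pair /mixed_kernel/= -c1; apply: eq_bigr => e _.
by rewrite -mulr_sumr k1 mulr1.
Qed.

Lemma mi_diff_mixed_kernel (V A B : finType) (F : bool -> U -> V) (f : L -> A) (g : L -> B) :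
  mi_diff (kjoint x P mixed_kernel) ((fun eu => (eu.1, F eu.1 eu.2)) \o fst) (f \o snd) (g \o snd) =
  tau * mi_diff (kjoint x P k) (F true \o fst) (f \o snd) (g \o snd) +
  (1 - tau) * mi_diff (kjoint x P k) (F false \o fst) (f \o snd) (g \o snd).
Proof.
have q0 w : 0 <= kjoint x P k w by exact: kjoint_ge0.
pose p2 (ew : bool * (U * L)) := coin ew.1 * kjoint x P k ew.2.
pose h (ew : bool * (U * L)) : (bool * U) * L := ((ew.1, ew.2.1), ew.2.2).
have -> : kjoint x P mixed_kernel = law p2 h.
  apply/funext => -[[e u] l]; rewrite -[(e, u, l)]/(h (e, (u, l))).
  rewrite -[h in RHS]/(h \o id) law_inj; last by move=> [? [? ?]] [? [? ?]] [-> -> ->].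
  rewrite /law (eq_bigl (pred1 (e, (u, l))))// big_pred1_eq.
  by rewrite /kjoint /p2 /mixed_kernel/= mulrCA.
rewrite mi_diff_law.
rewrite -[LHS]/(mi_diff p2 (fun w => (w.1, F w.1 w.2.1)) (fun w => f w.2.2) (fun w => g w.2.2)).
have e (C : finType) (j : L -> C) : entropy (kjoint x P k) (fun w => j w.2) =
    entropy p2 (fun w => j w.2.2).
  rewrite /entropy; apply: eq_bigr => c _; congr xlog.
  by rewrite -(law_snd (kjoint x P k) (fun w => j w.2) (proj2 coin_pmf)).
rewrite (@mi_diff_mixture _ _ _ _ _ _ coin (kjoint x P k) (fun e w => F e w.1)
   (fun _ w => f w.2) (fun _ w => g w.2) coin_pmf q0 (fun=> e _ f) (fun=> e _ g)).
by rewrite big_bool.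
Qed.

(** The value [None] reveals the outcome of the coin, so the information is an average over the
    coin, in which the constant contributes nothing. *)
Lemma mi_diff_erasure (V A B : finType) (h : U -> V) (f : L -> A) (g : L -> B) :
  mi_diff (kjoint x P mixed_kernel) ((fun eu => if eu.1 then Some (h eu.2) else None) \o fst)
    (f \o snd) (g \o snd) = tau * mi_diff (kjoint x P k) (h \o fst) (f \o snd) (g \o snd).
Proof.
have q0 w : 0 <= kjoint x P k w by exact: kjoint_ge0.
have q1 w : 0 <= kjoint x P mixed_kernel w by apply: kjoint_ge0 => //; exact: mixed_kernelP.
pose F (e : bool) u := if e then Some (h u) else None.
transitivity (mi_diff (kjoint x P mixed_kernel) ((fun eu => (eu.1, F eu.1 eu.2)) \o fst) (f \o snd) (g \o snd)).
  apply: eq_mi_diff => // -[[e u] l] [[e' u'] l'] _ _ /=; last by case.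
  by rewrite /F; case: e; case: e' => //= ->.
rewrite mi_diff_mixed_kernel (_ : F false \o fst = (fun=> None))// mi_diff_cst// mulr0 addr0.
by congr (_ * _); apply: eq_mi_diff => // w w' _ _ /=; [case|move=> ->].
Qed.

End Erasure.

(** * The converse inclusion *)

Section InnerRegion.
Local Open Scope classical_set_scope.
Local Open Scope ring_scope.
Context {R : realType} {X Y1 Y2 Z1 Z2 : finType}.
Local Notation L := (letter X Y1 Y2 Z1 Z2).
Variable P : L -> R.
Hypotheses (hP : is_pmf P) (hZ2 : constant_Z2 P).
Variable R0 : R.
Hypothesis hR0 : 0 <= R0.

(** [kernel_bounded] comes first, applied to the four differences that occur in the bounds, so that
    all kernels share one alphabet before the limit is taken. *)
Lemma single_letter_bounds_limit (t : R * R) :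
  (forall e, 0 < e -> exists (VT WT : finType) (k : X -> VT * WT -> R),
    single_letter_bounds P R0 t e k) ->
  exists (VT WT : finType) (k : X -> VT * WT -> R), single_letter_bounds P R0 t 0 k.
Proof.
move=> H.
have H' n : exists k : X -> 'I_(#|X| + 4).+1 * 'I_(#|X| + 2).+1 -> R,
    single_letter_bounds P R0 t (harmonic n) k.
  have [|VT [WT [k [hk b1 b2 b3]]]] := H (harmonic n); first exact: harmonic_gt0.
  have [k' [hk' e1 e2 e3 e4]] := kernel_bounded rvX hP (pairRV rvY1 rvZ1) rvZ1
    (pairRV rvX rvZ1) rvZ1 rvY2 (fun=> tt) rvZ1 rvY2 hk.
  by exists k'; split; rewrite ?e1 ?e2 ?e3 ?e4.
have [k hk] := choice H'.
have hk0 n : is_kernel (k n) by case: (hk n).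
have [G [k' [GF oG cv]]] := kernel_cluster hk0.
have h0 : (@harmonic R) n @[n --> G] --> (0 : R).
  by move=> A hA; apply: oG; exact: (cvg_harmonic hA).
exists _, _, k'; split; first exact: is_kernel_cvg cv hk0.
- apply: (@cvgr_to_ge _ G _ _ (fun n => mi_diff (kjoint rvX P (k n)) fst
    (pairRV rvY1 rvZ1 \o snd) (rvZ1 \o snd) + harmonic n)).
    by apply: cvgD => //; exact: cvg_mi_diff_kjoint.
  by apply: nearW => n; case: (hk n).
- apply: (@cvgr_to_ge _ G _ _ (fun n => mi_diff (kjoint rvX P (k n)) (fst \o fst)
    (rvY2 \o snd) ((fun=> tt) \o snd) + harmonic n)).
    by apply: cvgD => //; exact: cvg_mi_diff_kjoint.
  by apply: nearW => n; case: (hk n).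
- apply: (@ler_cvg_to _ G _ _ (fun n => t.2 +
      mi_diff (kjoint rvX P (k n)) (fst \o fst) (rvZ1 \o snd) (rvY2 \o snd) +
      mi_diff (kjoint rvX P (k n)) fst (pairRV rvX rvZ1 \o snd) (rvZ1 \o snd))
     (fun n => R0 + harmonic n)).
  + apply: cvgD; last exact: cvg_mi_diff_kjoint.
    by apply: cvgD; [exact: cvg_cst|exact: cvg_mi_diff_kjoint].
  + by apply: cvgD => //; exact: cvg_cst.
  + by apply: nearW => n; case: (hk n).
Qed.

End InnerRegion.

Section InnerRegion.
Local Open Scope classical_set_scope.
Local Open Scope ring_scope.
Context {R : realType} {X Y1 Y2 Z1 Z2 : finType}.
Local Notation L := (letter X Y1 Y2 Z1 Z2).
Variable P : L -> R.
Hypotheses (hP : is_pmf P) (hZ2 : constant_Z2 P) (hless : less_noisy_Z1_Y2 P).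
Variable R0 : R.
Hypothesis hR0 : 0 <= R0.

(** The hypothesis speaks of a single auxiliary, hence the passage to the marginal kernel of [V]. *)
Lemma less_noisy_kernel (V W : finType) (k : X -> V * W -> R) : is_kernel k ->
  mi_diff (kjoint rvX P k) (fst \o fst) (rvY2 \o snd) ((fun=> tt) \o snd) <=
  mi_diff (kjoint rvX P k) (fst \o fst) (rvZ1 \o snd) ((fun=> tt) \o snd).
Proof.
move=> hk; pose k1 a := law (k a) fst.
have hk1 : is_kernel k1 by exact: law_kernel.
have := hless (aux_extension_kjoint rvX hP hk1)
  (markov_kjoint rvX P hk1 id (pairRV (pairRV rvY1 rvY2) rvZ1)).
have pmf1 := kjoint_pmf rvX hP hk1.
rewrite !mutual_info_mi_diff//.
by rewrite kjoint_law !mi_diff_law.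
Qed.

Lemma cond_mutual_info_self (W A B C : finType) (p : W -> R) (f : W -> A) (g : W -> B) (h : W -> C) :
  (forall w, 0 <= p w) -> cond_mutual_info p f g (pairRV f h) = 0.
Proof.
move=> p0; rewrite cond_mutual_infoE//.
have -> : entropy p (pairRV f (pairRV f h)) = entropy p (pairRV f h) by same_info.
rewrite (@entropy_determines _ _ _ _ p (pairRV (pairRV f g) (pairRV f h)) (pairRV g (pairRV f h)))//.
- by ring.
- by move=> w w' _ _; rewrite /pairRV => -[_ -> -> ->].
- by move=> w w' _ _; rewrite /pairRV => -[-> -> ->].
Qed.

Lemma cond_mutual_info_mi_diff2 (W A B C D : finType) (p : W -> R) (f : W -> A) (g : W -> B) (u : W -> C) (h : W -> D) :
  (forall w, 0 <= p w) ->
  cond_mutual_info p f g (pairRV u h) =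
  mi_diff p (pairRV u f) (pairRV g h) h - mi_diff p u (pairRV g h) h.
Proof.
move=> p0; rewrite cond_mutual_infoE// /mi_diff.
have -> : entropy p (pairRV f (pairRV u h)) = entropy p (pairRV (pairRV u f) h).
  same_info.
have -> : entropy p (pairRV g (pairRV u h)) = entropy p (pairRV u (pairRV g h)).
  same_info.
have -> : entropy p (pairRV (pairRV f g) (pairRV u h)) = entropy p (pairRV (pairRV u f) (pairRV g h)).
  same_info.
by ring.
Qed.

(* Erasing [V] with probability [1 - tau] brings [I(V; Y2)] down to [t.2] and
   [I(V; Z1)] down by at least as much, because [I(V; Y2) <= I(V; Z1)]. *)
Lemma single_letter_inner (t : R * R) (V W : finType) (k : X -> V * W -> R) :
  0 <= t.1 -> 0 <= t.2 -> single_letter_bounds P R0 t 0 k -> inner_region P R0 0 0 t.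
Proof.
move=> t10 t20 [hk]; set q := kjoint rvX P k; rewrite !addr0 => b1 b2 b3.
have ln := less_noisy_kernel hk; rewrite -/q in ln.
set a := mi_diff q (fst \o fst) (rvY2 \o snd) ((fun=> tt) \o snd) in b2 ln.
set b := mi_diff q (fst \o fst) (rvZ1 \o snd) ((fun=> tt) \o snd) in ln.
(* If [I(V; Y2) = 0] then [t.2 = 0], and erasing always, [tau = 0], will do. *)
have [tau [tau0 tau1 taua]] : exists tau, [/\ 0 <= tau, tau <= 1 & tau * a = t.2].
  have [a0|a0] := eqVneq a 0.
    exists 0; rewrite mul0r ler01 lexx; split=> //; apply/eqP; rewrite eq_le t20.
    by rewrite -a0 b2.
  have a1 : 0 < a by rewrite lt_neqAle eq_sym a0 (le_trans t20).
  by exists (t.2 / a); rewrite divr_ge0 ?ler_pdivrMr ?mul1r ?divfK ?(ltW a1).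
have htau : 0 <= tau <= 1 by rewrite tau0.
pose k2 := mixed_kernel k tau.
have hk2 : is_kernel k2 by exact: mixed_kernelP.
pose V' (e : bool) (u : V * W) := if e then Some u.1 else None.
(* [U0] and [U2] are the erased [V]. [U1] keeps the coin beside the unerased [(V, W)]: the coin adds
   no information about the letters, and with it [U1] determines [U0]. *)
pose r (eu : bool * (V * W)) := ((V' eu.1 eu.2, eu), V' eu.1 eu.2).
pose k3 x0 := law (k2 x0) r.
have hk3 : is_kernel k3 by exact: law_kernel.
pose p := kjoint rvX P k3.
have hp : is_pmf p by exact: kjoint_pmf.
have [p0 p1] := hp.
have q0 w : 0 <= q w by exact: kjoint_ge0.
have q20 w : 0 <= kjoint rvX P k2 w by exact: kjoint_ge0.
have JV (A B : finType) (f : L -> A) (g : L -> B) :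
    mi_diff p (fun w => w.1.1.1) (f \o snd) (g \o snd)
    = tau * mi_diff q (fst \o fst) (f \o snd) (g \o snd).
  by rewrite /p kjoint_law mi_diff_law; exact: (mi_diff_erasure rvX hP hk htau fst).
have JW (A B : finType) (f : L -> A) (g : L -> B) :
    mi_diff p (fun w => w.1.1.2) (f \o snd) (g \o snd)
    = mi_diff q fst (f \o snd) (g \o snd).
  rewrite /p kjoint_law mi_diff_law.
  transitivity (mi_diff (kjoint rvX P k2) ((fun eu => (eu.1, eu.2)) \o fst) (f \o snd) (g \o snd)).
    apply: eq_mi_diff => // w w' _ _ /=; last by rewrite -!surjective_pairing.
    by move=> ->.
  rewrite (mi_diff_mixed_kernel rvX hP hk htau (fun=> id)).
  by rewrite -mulrDl addrCA subrr addr0 mul1r.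
have dWV : determines p (fun w => w.1.1.2) (fun w => w.1.1.1).
  have H w : p w != 0 -> w.1.1.1 = V' w.1.1.2.1 w.1.1.2.2.
    rewrite /p kjoint_law => /law_eq0P => /(_ q20)[[eu l] _ <-].
    by rewrite /r.
  by move=> w w' /H -> /H -> ->.
have dV2 : determines p (fun w => w.1.1.1) (fun w => w.1.2) /\
           determines p (fun w => w.1.2) (fun w => w.1.1.1).
  have H w : p w != 0 -> w.1.2 = w.1.1.1.
    by rewrite /p kjoint_law => /law_eq0P => /(_ q20)[[eu l] _ <-].
  by split=> w w' /H -> /H ->.
have dZ2 w w' : p w != 0 -> p w' != 0 -> rvZ2 w.2 = rvZ2 w'.2.
  rewrite /p /kjoint !mulf_eq0 !negb_or => /andP[Pw _] /andP[Pw' _].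
  exact: constant_Z2_support Pw'.
split=> //.
exists (option V), (bool * (V * W))%type, (option V), p => U0 U1 U2 x y1 y2 z1 z2.
have eV (A : finType) (f : L -> A) (U : (option V * (bool * (V * W)) * option V) * L -> option V) :
    determines p U0 U -> determines p U U0 ->
    cond_mutual_info p U (f \o snd) z2
     = mi_diff p U0 (f \o snd) ((fun=> tt) \o snd).
  move=> UU0 U0U; rewrite cond_mutual_info_mi_diff//.
  apply: eq_mi_diff => // w w' pw pw' e.
  - by case: e.
  - by rewrite /pairRV e [z2 w](dZ2 w w').
  - exact: dZ2.
have J3 := JV _ _ (pairRV rvX rvZ1) ((fun=> tt) : L -> unit).
have xz0 : 0 <= mi_diff p U0 (rvZ1 \o snd) ((fun=> tt) \o snd) by apply: mi_diff_ge0.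
have xzx : mi_diff p U0 (rvX \o snd) ((fun=> tt) \o snd) <=
    mi_diff p U0 (pairRV rvX rvZ1 \o snd) ((fun=> tt) \o snd).
  rewrite [leRHS](mi_diffD _ _ _ (rvX \o snd)) lerDr.
  by apply: mi_diff_ge0 => // w w' _ _ [].
have WV : mi_diff p U0 (pairRV rvX rvZ1 \o snd) (rvZ1 \o snd) <=
    mi_diff p U1 (pairRV rvX rvZ1 \o snd) (rvZ1 \o snd).
  apply: mi_diff_monoU => //.
  by move=> w w' _ _ [].
have D1 : mi_diff p U0 (pairRV rvX rvZ1 \o snd) ((fun=> tt) \o snd) =
    mi_diff p U0 (pairRV rvX rvZ1 \o snd) (rvZ1 \o snd) +
    mi_diff p U0 (rvZ1 \o snd) ((fun=> tt) \o snd) by rewrite -mi_diffD.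
have D2 : mi_diff q (fst \o fst) (rvZ1 \o snd) (rvY2 \o snd) = b - a.
  by rewrite /b /a -mi_diffN -mi_diffD.
have main : mi_diff p U0 (rvZ1 \o snd) ((fun=> tt) \o snd) +
    mi_diff p U1 (pairRV rvX rvZ1 \o snd) (rvZ1 \o snd) <= R0.
  rewrite JV JW; apply: le_trans b3; rewrite D2 -taua -/b lerD2r.
  have : 0 <= (1 - tau) * (b - a) by rewrite mulr_ge0 ?subr_ge0.
  by lra.
split.
- exact: aux_extension_kjoint.
- exact: (markov_kjoint rvX P hk3 id (pairRV (pairRV (pairRV rvY1 rvY2) rvZ1) rvZ2)).
- rewrite !addr0; split.
  + rewrite cond_mutual_info_mi_diff//.
    have -> : mi_diff p (pairRV U0 U1) (pairRV x z1) z1 =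
      mi_diff p U1 (pairRV rvX rvZ1 \o snd) (rvZ1 \o snd).
      apply: eq_mi_diff => // w w' pw pw' e; first by case: e.
      by rewrite /pairRV; congr (_, _); [exact: (dWV _ _ pw pw' e)|exact: e].
    by apply: le_trans main; rewrite lerDr.
  + rewrite (_ : cond_mutual_info p (pairRV U0 U2) x z2 =
       mi_diff p U0 (rvX \o snd) ((fun=> tt) \o snd)).
      apply: le_trans xzx _; rewrite D1; apply: le_trans main; lra.
    rewrite cond_mutual_info_mi_diff//; apply: eq_mi_diff => // w w' pw pw' e.
    - by case: e.
    - by rewrite /pairRV; congr (_, _); [exact: e|exact: (proj1 dV2 _ _ pw pw' e)].
    - by case: e.
    - by rewrite /pairRV; congr (_, _); [exact: e|exact: dZ2].
    - exact: dZ2.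
  (* [U2] equals [U0] almost surely, so the last term of the sum rate vanishes. *)
  + rewrite [cond_mutual_info p U2 x _](_ : _ = 0); last first.
      rewrite -(@cond_mutual_info_self _ _ _ _ p U2 x z2 p0).
      have d02 : determines p (pairRV U0 z2) (pairRV U2 z2).
        by apply: determines_pair => //; case: dV2.
      have d20 : determines p (pairRV U2 z2) (pairRV U0 z2).
        by apply: determines_pair => //; case: dV2.
      rewrite !cond_mutual_infoE//.
      by congr (_ + _ - _ - _); apply: entropy_determines => //; apply: determines_pair.
    rewrite addr0 (@cond_mutual_info_mi_diff2 _ _ _ _ _ p U1 x U0 z1 p0).
    have -> : mi_diff p (pairRV U0 U1) (pairRV x z1) z1 =
      mi_diff p U1 (pairRV rvX rvZ1 \o snd) (rvZ1 \o snd).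
      apply: eq_mi_diff => // w w' pw pw' e; first by case: e.
      by rewrite /pairRV; congr (_, _); [exact: (dWV _ _ pw pw' e)|exact: e].
    rewrite (_ : mi_diff p U0 (pairRV x z1) z1 =
       mi_diff p U0 (pairRV rvX rvZ1 \o snd) (rvZ1 \o snd))//.
    have m1 : cond_mutual_info p U0 x z1 <= mi_diff p U0 (pairRV rvX rvZ1 \o snd) (rvZ1 \o snd).
      by rewrite cond_mutual_info_mi_diff.
    have m2 : cond_mutual_info p U0 x z2 <= mi_diff p U0 (pairRV rvX rvZ1 \o snd) ((fun=> tt) \o snd).
      by apply: le_trans xzx; rewrite -(@eV _ rvX U0).
    have : Num.max (cond_mutual_info p U0 x z1) (cond_mutual_info p U0 x z2) <=
        mi_diff p U0 (pairRV rvX rvZ1 \o snd) ((fun=> tt) \o snd).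
      by rewrite ge_max m2 andbT; lra.
    by lra.
- apply: le_trans b1 _; rewrite -JW cond_mutual_info_mi_diff//.
- have -> : cond_mutual_info p U2 y2 z2 = _ := @eV _ rvY2 U2 (proj1 dV2) (proj2 dV2).
  by rewrite JV -/a taua.
Qed.

Lemma region_sub_inner : exponents_region P R0 0 0 `<=` inner_region P R0 0 0.
Proof.
move=> t ht; have [t10 t20] := region_ge0 ht.
have [V [W [k hk]]] := single_letter_bounds_limit hP
  (fun e e0 => region_single_letter hP hZ2 hR0 e0 ht).
exact: single_letter_inner hk.
Qed.

End InnerRegion.

(** * Superposition codes with a likelihood encoder *)

Lemma sumr_cst {R : pzSemiRingType} (T : finType) (c : R) : \sum_(t : T) c = #|T|%:R * c.
Proof. by rewrite sumr_const mulr_natl. Qed.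

Section Codebook.
Context {R : realType} {TX TV TW I J : finType}.
Variable q : TV -> TW -> TX -> R.
Hypothesis q0 : forall v w x, 0 <= q v w x.
Hypothesis q1 : \sum_v \sum_w \sum_x q v w x = 1.
Hypotheses (I0 : (0 < #|I|)%N) (J0 : (0 < #|J|)%N).

Definition qX x := \sum_v \sum_w q v w x.
Definition qVW v w := \sum_x q v w x.
Definition qV v := \sum_w qVW v w.
Definition qVX v x := \sum_w q v w x.
(* conditional laws, [0] when the condition has probability zero *)
Definition qW_V v w := qVW v w / qV v.
Definition qX_VW v w x := q v w x / qVW v w.

Lemma qVW_ge0 v w : 0 <= qVW v w. Proof. exact: sumr_ge0. Qed.
Lemma qV_ge0 v : 0 <= qV v. Proof. by apply: sumr_ge0 => w _; exact: qVW_ge0. Qed.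
Lemma qX_ge0 x : 0 <= qX x. Proof. by apply: sumr_ge0 => v _; exact: sumr_ge0. Qed.
Lemma qW_V_ge0 v w : 0 <= qW_V v w.
Proof. by rewrite divr_ge0 ?qVW_ge0 ?qV_ge0. Qed.
Lemma qX_VW_ge0 v w x : 0 <= qX_VW v w x.
Proof. by rewrite divr_ge0 ?qVW_ge0. Qed.

Lemma sum_qX : \sum_x qX x = 1.
Proof.
rewrite -q1 /qX exchange_big/=; apply: eq_bigr => v _; exact: exchange_big.
Qed.

Lemma sum_ge0_eq0 (T : finType) (f : T -> R) : (forall t, 0 <= f t) ->
  \sum_t f t = 0 -> forall t, f t = 0.
Proof.
move=> f0 /eqP; rewrite psumr_eq0// => /allP H t.
by apply/eqP; have := H t (mem_index_enum _).
Qed.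

Lemma qVW_qX_VW v w x : qVW v w * qX_VW v w x = q v w x.
Proof.
have [e|e] := eqVneq (qVW v w) 0; last by rewrite /qX_VW mulrC divfK.
by rewrite e mul0r (sum_ge0_eq0 (q0 v w) e).
Qed.

Lemma qV_qW_V v w : qV v * qW_V v w = qVW v w.
Proof.
have [e|e] := eqVneq (qV v) 0; last by rewrite /qW_V mulrC divfK.
by rewrite e mul0r (sum_ge0_eq0 (qVW_ge0 v) e).
Qed.

Lemma sum_qW_V v : qV v != 0 -> \sum_w qW_V v w = 1.
Proof. by move=> v0; rewrite -mulr_suml divff. Qed.

Lemma sum_qV : \sum_v qV v = 1. Proof. exact: q1. Qed.

(** A row of the codebook is a centre [v] with [#|J|] satellites drawn independently given [v]. *)
Definition row_law (r : TV * {ffun J -> TW}) : R := qV r.1 * prodm (qW_V r.1) r.2.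

Lemma row_law_ge0 r : 0 <= row_law r.
Proof. by rewrite mulr_ge0 ?qV_ge0// prodm_ge0//; exact: qW_V_ge0. Qed.

Lemma sum_row_law (phi : TV -> {ffun J -> TW} -> R) (psi : TV -> R) :
  (forall v, qV v != 0 -> \sum_f prodm (qW_V v) f * phi v f = psi v) ->
  \sum_r row_law r * phi r.1 r.2 = \sum_v qV v * psi v.
Proof.
move=> H; rewrite sum_pair; apply: eq_bigr => v _.
rewrite /row_law/=; under eq_bigr do rewrite -mulrA.
rewrite -mulr_sumr; have [->|v0] := eqVneq (qV v) 0; first by rewrite !mul0r.
by rewrite H.
Qed.

Lemma row_law_pmf : is_pmf row_law.
Proof.
split=> [r|]; first exact: row_law_ge0.
transitivity (\sum_r row_law r * 1); first by apply: eq_bigr => r _; rewrite mulr1.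
rewrite (@sum_row_law (fun _ _ => 1) (fun=> 1)).
  by under eq_bigr do rewrite mulr1; exact: sum_qV.
by move=> v v0; under eq_bigr do rewrite mulr1; rewrite sum_prodm// sum_qW_V.
Qed.

Lemma sum_row_law1 j (phi : TV -> TW -> R) :
  \sum_r row_law r * phi r.1 (r.2 j) = \sum_v \sum_w qVW v w * phi v w.
Proof.
rewrite (@sum_row_law (fun v f => phi v (f j)) (fun v => \sum_w qW_V v w * phi v w)).
  apply: eq_bigr => v _; rewrite mulr_sumr; apply: eq_bigr => w _.
  by rewrite mulrA qV_qW_V.
by move=> v v0; rewrite (sum_prodm1 j (phi v))// sum_qW_V.
Qed.

Lemma sum_row_law2 j j' (phi : TV -> TW -> TW -> R) : j != j' ->
  \sum_r row_law r * phi r.1 (r.2 j) (r.2 j') =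
  \sum_v \sum_w \sum_w' qV v * (qW_V v w * qW_V v w') * phi v w w'.
Proof.
move=> jj'.
rewrite (@sum_row_law (fun v f => phi v (f j) (f j'))
  (fun v => \sum_w \sum_w' qW_V v w * qW_V v w' * phi v w w')).
  apply: eq_bigr => v _; rewrite mulr_sumr; apply: eq_bigr => w _.
  by rewrite mulr_sumr; apply: eq_bigr => w' _; rewrite mulrA.
by move=> v v0; rewrite (sum_prodm2 (phi v))// sum_qW_V.
Qed.

Notation codebook := {ffun I -> TV * {ffun J -> TW}}.

Definition book_law (C : codebook) : R := prodm row_law C.

Lemma book_law_pmf : is_pmf book_law.
Proof. exact/prodm_pmf/row_law_pmf. Qed.

Definition ncodes : R := #|I|%:R * #|J|%:R.

Lemma ncodes_gt0 : 0 < ncodes.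
Proof. by rewrite mulr_gt0 ?ltr0n. Qed.

Lemma sum_book_row (i : I) (phi : TV * {ffun J -> TW} -> R) :
  \sum_C book_law C * phi (C i) = \sum_r row_law r * phi r.
Proof. by rewrite sum_prodm1//; case: row_law_pmf. Qed.

Lemma average_code (psi : TV -> TW -> R) :
  \sum_C book_law C * (ncodes^-1 * \sum_i \sum_j psi (C i).1 ((C i).2 j)) =
  \sum_v \sum_w qVW v w * psi v w.
Proof.
under eq_bigr do rewrite mulrCA mulr_sumr.
rewrite -mulr_sumr exchange_big/=.
rewrite (eq_bigr (fun=> #|J|%:R * \sum_v \sum_w qVW v w * psi v w)).
  by rewrite sumr_cst [X in _ * X]mulrA mulKf// gt_eqF// ncodes_gt0.
move=> i _; under eq_bigr do rewrite mulr_sumr.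
rewrite exchange_big/= (eq_bigr (fun=> \sum_v \sum_w qVW v w * psi v w)).
  by rewrite sumr_cst.
move=> j _; rewrite (sum_book_row i (fun r => psi r.1 (r.2 j))).
exact: sum_row_law1.
Qed.

Lemma average_pair (rel : J -> J -> bool) (K : R) (psi : TV -> TW -> TW -> R) :
  (forall v w w', 0 <= psi v w w') ->
  (forall j, #|[pred j' | rel j j' && (j' != j)]|%:R <= K) ->
  \sum_C book_law C * (ncodes^-1 * \sum_i \sum_j
     \sum_(j' | rel j j' && (j' != j)) psi (C i).1 ((C i).2 j) ((C i).2 j')) <=
  K * \sum_v \sum_w \sum_w' qV v * (qW_V v w * qW_V v w') * psi v w w'.
Proof.
move=> psi0 hK; set S := \sum_v _.
have S0 : 0 <= S.
  apply: sumr_ge0 => v _; apply: sumr_ge0 => w _; apply: sumr_ge0 => w' _.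
  by rewrite mulr_ge0 ?psi0// mulr_ge0 ?qV_ge0// mulr_ge0 ?qW_V_ge0.
under eq_bigr do rewrite mulrCA mulr_sumr.
rewrite -mulr_sumr exchange_big/= ler_pdivrMl ?ncodes_gt0//.
apply: (@le_trans _ _ (\sum_(i : I) #|J|%:R * (K * S))); last first.
  by rewrite sumr_cst mulrA.
apply: ler_sum => i _; under eq_bigr do rewrite mulr_sumr.
rewrite exchange_big/=.
apply: (@le_trans _ _ (\sum_(j : J) K * S)); last by rewrite sumr_cst.
apply: ler_sum => j _; under eq_bigr do rewrite mulr_sumr.
rewrite exchange_big/= (eq_bigr (fun=> S)); last first.
  move=> j' /andP[_ jj'].
  rewrite (sum_book_row i (fun r => psi r.1 (r.2 j) (r.2 j'))).
  by rewrite (sum_row_law2 psi)// eq_sym.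
by rewrite sumr_const -[S *+ _]mulr_natl; apply: ler_wpM2r => //; exact: hK.
Qed.

(** The law of the source that a uniformly chosen codeword would produce through the test
    channel. *)
Definition mixture_at (C : codebook) x : R :=
  ncodes^-1 * \sum_i \sum_j qX_VW (C i).1 ((C i).2 j) x.

Lemma mixture_ge0 C x : 0 <= mixture_at C x.
Proof.
rewrite mulr_ge0 ?invr_ge0 ?(ltW ncodes_gt0)//.
by apply: sumr_ge0 => i _; apply: sumr_ge0 => j _; exact: qX_VW_ge0.
Qed.

(** Where the mixture reaches half of the true law, the posterior of the codeword can be used at
    bounded cost, see [encode_le]. Positivity keeps the normalisation of [encode] meaningful when
    [qX x] is zero. *)
Definition covered C x : bool := (0 < mixture_at C x) && (qX x <= 2 * mixture_at C x).

(* Likelihood encoder; [None] declares an error. *)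
Definition encode C x (m : option (I * J)) : R :=
  match m with
  | Some (i, j) => if covered C x then
      ncodes^-1 * qX_VW (C i).1 ((C i).2 j) x / mixture_at C x else 0
  | None => if covered C x then 0 else 1
  end.

Lemma sum_option (T : finType) (f : option T -> R) :
  \sum_o f o = f None + \sum_t f (Some t).
Proof.
rewrite (bigD1 None)//=; congr (_ + _).
rewrite (reindex_omap Some id) => [|[t|]//].
by apply: eq_bigl => t; rewrite eqxx.
Qed.

Lemma encode_pmf C x : is_pmf (encode C x).
Proof.
split=> [[[i j]|]|].
- rewrite /encode; case: ifP => // _.
  by rewrite divr_ge0 ?mixture_ge0// mulr_ge0 ?qX_VW_ge0// invr_ge0 ltW// ncodes_gt0.
- by rewrite /encode; case: ifP.
- rewrite sum_option /encode; have [/andP[g _]|_] := boolP (covered C x); last first.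
    by rewrite sum_pair big1 ?addr0// => i _; rewrite big1.
  rewrite add0r sum_pair.
  under eq_bigr do rewrite -mulr_suml -mulr_sumr.
  by rewrite -mulr_suml -mulr_sumr divff// gt_eqF.
Qed.

(** On covered sequences the true joint law of source and indices is at most twice the ideal one,
    with uniform indices and the source drawn from the test channel. Error events can thus be
    computed under the ideal law at the price of this factor 2. *)
Lemma encode_le C x i j :
  qX x * encode C x (Some (i, j)) <= 2 * (ncodes^-1 * qX_VW (C i).1 ((C i).2 j) x).
Proof.
rewrite /encode; set a := ncodes^-1 * _.
have a0 : 0 <= a by rewrite mulr_ge0 ?qX_VW_ge0// invr_ge0 ltW// ncodes_gt0.
case: ifP => [/andP[g h]|_]; last by rewrite mulr0 mulr_ge0.
by rewrite mulrA ler_pdivrMr// mulrAC ler_wpM2r.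
Qed.

(** * Soft covering by the second moment method *)

Section Covering.
Variables (A : TV -> TW -> TX -> bool) (eta : R).
Hypothesis eta0 : 0 <= eta.
Hypothesis hA1 : forall v w x, A v w x -> qVX v x <= qV v * qX x * (#|I|%:R * eta).
Hypothesis hA2 : forall v w x, A v w x -> q v w x <= qVW v w * qX x * (ncodes * eta).

(** The likelihood is truncated to the typical set [A], so that its second moment is controlled. *)
Let a x v w := (A v w x)%:R * qX_VW v w x.
Let s x := \sum_v \sum_w (A v w x)%:R * q v w x.

Let a_ge0 x v w : 0 <= a x v w. Proof. by rewrite mulr_ge0 ?qX_VW_ge0. Qed.

Let sE x : \sum_v \sum_w qVW v w * a x v w = s x.
Proof.
by apply: eq_bigr => v _; apply: eq_bigr => w _; rewrite mulrCA qVW_qX_VW.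
Qed.

Let s_le x : s x <= qX x.
Proof.
apply: ler_sum => v _; apply: ler_sum => w _.
by case: (A v w x); rewrite ?mul1r ?mul0r.
Qed.

Let s_ge0 x : 0 <= s x.
Proof. by apply: sumr_ge0 => v _; apply: sumr_ge0 => w _; rewrite mulr_ge0. Qed.

Let G x (r : TV * {ffun J -> TW}) := ncodes^-1 * \sum_j a x r.1 (r.2 j).

Let a_le x v w : qVW v w != 0 -> a x v w <= qX x * (ncodes * eta).
Proof.
move=> vw0; have vw : 0 < qVW v w by rewrite lt_neqAle eq_sym vw0 qVW_ge0.
rewrite /a; case: (boolP (A v w x)) => [Ax|_]; last first.
  by rewrite mul0r !mulr_ge0 ?qX_ge0 ?(ltW ncodes_gt0).
by rewrite mul1r ler_pdivrMr// [leRHS]mulrC (mulrA (qVW v w)); exact: hA2 Ax.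
Qed.

(** Diagonal terms, one codeword taken twice: [hA2] bounds one of the two factors. *)
Let same x : \sum_v \sum_w qVW v w * a x v w ^+ 2 <= qX x * (ncodes * eta) * s x.
Proof.
rewrite -sE mulr_sumr; apply: ler_sum => v _; rewrite mulr_sumr; apply: ler_sum => w _.
have [->|vw] := eqVneq (qVW v w) 0; first by rewrite !mul0r mulr0.
have -> : qVW v w * a x v w ^+ 2 = a x v w * (qVW v w * a x v w) by ring.
by apply: ler_wpM2r; [rewrite mulr_ge0 ?qVW_ge0|exact: a_le].
Qed.

Let inner_le x v : qV v != 0 -> \sum_w qW_V v w * a x v w <= qX x * (#|I|%:R * eta).
Proof.
move=> v0; have vgt : 0 < qV v by rewrite lt_neqAle eq_sym v0 qV_ge0.
have E w : qW_V v w * a x v w = (A v w x)%:R * q v w x / qV v.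
  by rewrite /a mulrCA -mulrA; congr (_ * _); rewrite /qW_V mulrAC qVW_qX_VW.
under eq_bigr do rewrite E.
have [/existsP[w Aw]|/existsPn H] := boolP [exists w, A v w x].
  apply: (@le_trans _ _ (qVX v x / qV v)).
    rewrite -mulr_suml ler_wpM2r ?invr_ge0 ?qV_ge0//; apply: ler_sum => w' _.
    by case: (A v w' x); rewrite ?mul1r ?mul0r.
  by rewrite ler_pdivrMr// [leRHS]mulrC (mulrA (qV v)); exact: hA1 Aw.
rewrite big1; first by rewrite !mulr_ge0 ?qX_ge0.
by move=> w _; rewrite (negbTE (H w)) !mul0r.
Qed.

(** Two satellites of one centre are independent given [v]; the average over one of them is bounded
    by means of [hA1]. *)
Let diff x : \sum_v \sum_w \sum_w' qV v * (qW_V v w * qW_V v w') * (a x v w * a x v w') <=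
  qX x * (#|I|%:R * eta) * s x.
Proof.
rewrite -sE mulr_sumr; apply: ler_sum => v _.
have [v0|v0] := eqVneq (qV v) 0.
  rewrite big1 => [|w _]; last by rewrite big1// => w' _; rewrite v0 !mul0r.
  by rewrite big1 ?mulr0// => w _; rewrite -qV_qW_V v0 !mul0r.
have -> : \sum_w \sum_w' qV v * (qW_V v w * qW_V v w') * (a x v w * a x v w') =
   (\sum_w qW_V v w * a x v w) * \sum_w qVW v w * a x v w.
  rewrite mulr_suml; apply: eq_bigr => w _; rewrite mulr_sumr; apply: eq_bigr => w' _.
  by rewrite -qV_qW_V; ring.
rewrite ler_wpM2r ?inner_le//; apply: sumr_ge0 => w _.
by rewrite mulr_ge0 ?qVW_ge0.
Qed.

Let G2 x : \sum_r row_law r * G x r ^+ 2 <= 2 * (qX x * eta * s x) / #|I|%:R.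
Proof.
have IR : 0 < #|I|%:R :> R by rewrite ltr0n.
have JR : 0 < #|J|%:R :> R by rewrite ltr0n.
have E : \sum_r row_law r * G x r ^+ 2 = ncodes^-1 ^+ 2 *
    \sum_j \sum_j' \sum_r row_law r * (a x r.1 (r.2 j) * a x r.1 (r.2 j')).
  rewrite mulr_sumr.
  under [RHS]eq_bigr do rewrite exchange_big/=.
  rewrite -mulr_sumr exchange_big/= mulr_sumr; apply: eq_bigr => r _.
  rewrite /G exprMn mulrCA; congr (_ * _).
  rewrite expr2 mulr_suml mulr_sumr; apply: eq_bigr => j _.
  by rewrite mulr_sumr mulr_sumr.
rewrite E.
have B : \sum_j \sum_j' \sum_r row_law r * (a x r.1 (r.2 j) * a x r.1 (r.2 j')) <=
    #|J|%:R * (qX x * (ncodes * eta) * s x + #|J|%:R * (qX x * (#|I|%:R * eta) * s x)).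
  rewrite -sumr_cst; apply: ler_sum => j _.
  rewrite (bigD1 j)//= lerD//.
    by rewrite (sum_row_law1 j (fun v w => a x v w * a x v w)); exact: same.
  apply: (@le_trans _ _ (\sum_(j' | j' != j) qX x * (#|I|%:R * eta) * s x)).
    apply: ler_sum => j' jj'.
    by rewrite (sum_row_law2 (fun v w w' => a x v w * a x v w')) 1?eq_sym// diff.
  set c := qX x * _ * _; rewrite sumr_const -[c *+ _]mulr_natl; apply: ler_wpM2r.
    by rewrite !mulr_ge0 ?qX_ge0.
  by rewrite ler_nat max_card.
apply: (le_trans (ler_wpM2l _ B)); first by rewrite sqr_ge0.
rewrite le_eqVlt; apply/orP; left; apply/eqP; rewrite /ncodes; field.
by rewrite !gt_eqF.
Qed.

(** Either [s x] is at most three quarters of [qX x] and the second term is at least 1, or the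
    truncated mixture, at most half of [qX x], misses its mean [s x] by more than a quarter of
    [qX x] and the first term is at least 1. *)
Let uncovered_le C x : 0 < qX x ->
  (~~ covered C x)%:R <= 16 * (\sum_i G x (C i) - s x) ^+ 2 / qX x ^+ 2
     + 4 * (1 - s x / qX x).
Proof.
move=> x0.
have t0 : 0 <= 1 - s x / qX x by rewrite subr_ge0 ler_pdivrMr// mul1r.
have u0 : 0 <= 16 * (\sum_i G x (C i) - s x) ^+ 2 / qX x ^+ 2.
  by apply: divr_ge0; rewrite ?sqr_ge0// mulr_ge0// sqr_ge0.
case: (boolP (covered C x)) => [_|nc]; first by rewrite addr_ge0// mulr_ge0.
have g_le : \sum_i G x (C i) <= mixture_at C x.
  rewrite -mulr_sumr ler_wpM2l ?invr_ge0 ?(ltW ncodes_gt0)//.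
  apply: ler_sum => i _; apply: ler_sum => j _; rewrite /a.
  by case: (A _ _ _); rewrite ?mul1r ?mul0r// qX_VW_ge0.
have m_le : mixture_at C x <= qX x / 2.
  move: nc; rewrite /covered negb_and -leNgt -ltNge => /orP[h|/ltW h]; last by lra.
  by apply: le_trans h _; rewrite divr_ge0// ltW.
have [sl|sg] := leP (s x / qX x) (3/4).
  by apply: (@le_trans _ _ (4 * (1 - s x / qX x))); [rewrite /=; lra|rewrite lerDr].
move: sg; rewrite ltr_pdivlMr// => sg.
have : 1 <= 16 * (\sum_i G x (C i) - s x) ^+ 2 / qX x ^+ 2.
  rewrite ler_pdivlMr ?exprn_gt0// mul1r; set g := \sum_i _ in g_le *.
  nra.
by rewrite /=; lra.
Qed.

(** Rows are independent, so the variance of the truncated mixture is at most the sum of the second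
    moments of its rows; [uncovered_le] turns it into a probability. The constant 32 is 16 times the
    2 of [G2]. *)
Lemma expected_uncovered :
  \sum_C book_law C * \sum_x qX x * (~~ covered C x)%:R <=
  32 * eta + 4 * \sum_v \sum_w \sum_x (~~ A v w x)%:R * q v w x.
Proof.
have [b0 b1] := book_law_pmf.
under eq_bigr do rewrite mulr_sumr.
rewrite exchange_big/=.
have -> : \sum_v \sum_w \sum_x (~~ A v w x)%:R * q v w x = \sum_x (qX x - s x).
  under eq_bigr do rewrite exchange_big/=.
  rewrite exchange_big/=; apply: eq_bigr => x _.
  rewrite /qX /s -sumrB; apply: eq_bigr => v _; rewrite -sumrB; apply: eq_bigr => w _.
  by case: (A v w x); rewrite ?mul1r ?mul0r ?subrr ?subr0.
have -> : 32 * eta = \sum_x 32 * eta * qX x by rewrite -mulr_sumr sum_qX mulr1.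
rewrite mulr_sumr -big_split/=; apply: ler_sum => x _.
have [x0|x0] := eqVneq (qX x) 0.
  rewrite big1 => [|C _]; last by rewrite x0 mul0r mulr0.
  by rewrite addr_ge0// !mulr_ge0 ?qX_ge0 ?subr_ge0.
have xgt : 0 < qX x by rewrite lt_neqAle eq_sym x0 qX_ge0.
apply: (@le_trans _ _ (\sum_C book_law C * (qX x *
   (16 * (\sum_i G x (C i) - s x) ^+ 2 / qX x ^+ 2 + 4 * (1 - s x / qX x))))).
  by apply: ler_sum => C _; rewrite ler_wpM2l// ler_wpM2l ?qX_ge0 ?uncovered_le.
have -> : \sum_C book_law C * (qX x * (16 * (\sum_i G x (C i) - s x) ^+ 2 / qX x ^+ 2 + 4 * (1 - s x / qX x)))
  = 16 / qX x * (\sum_C book_law C * (\sum_i G x (C i) - s x) ^+ 2) + 4 * (qX x - s x).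
  rewrite mulr_sumr -[4 * (qX x - s x)]mulr1 -[X in 4 * _ * X]b1 mulr_sumr -big_split/=.
  by apply: eq_bigr => C _; field.
rewrite lerD2r.
have V : \sum_C book_law C * (\sum_i G x (C i) - s x) ^+ 2 <= 2 * (qX x * eta * s x).
  have IR : 0 < #|I|%:R :> R by rewrite ltr0n.
  have := @variance_prodm_le R I _ _ (G x) row_law_pmf.
  have -> : \sum_r row_law r * G x r = s x / #|I|%:R.
    rewrite /G; under eq_bigr do rewrite mulrCA mulr_sumr.
    rewrite -mulr_sumr exchange_big/= (eq_bigr (fun=> s x)).
      rewrite sumr_cst /ncodes; field.
      by rewrite !pnatr_eq0 -!lt0n I0 J0.
    by move=> j _; rewrite (sum_row_law1 j (a x)) sE.
  rewrite mulrCA divff ?gt_eqF// mulr1 => h; apply: le_trans h _.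
  by rewrite -ler_pdivlMl// mulrC; exact: G2.
apply: (@le_trans _ _ (16 / qX x * (2 * (qX x * eta * s x)))).
  by rewrite ler_wpM2l// divr_ge0// ltW.
have -> : 16 / qX x * (2 * (qX x * eta * s x)) = 32 * eta * s x by field.
by rewrite ler_wpM2l ?s_le// mulr_ge0.
Qed.

End Covering.
End Codebook.

Lemma exists_injective (T T' : finType) : (#|T| <= #|T'|)%N -> exists f : T -> T', injective f.
Proof.
move=> h; exists (fun t => enum_val (widen_ord h (enum_rank t))) => t t'.
by move/enum_val_inj => /(congr1 val)/= /val_inj /enum_rank_inj.
Qed.

Lemma exists_le_average {R : realType} (T : finType) (p f : T -> R) (c : R) :
  is_pmf p -> \sum_t p t * f t <= c -> exists t, f t <= c.
Proof.
move=> [p0 p1] h; apply: contrapT => /forallNP H.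
have H' t : c < f t by rewrite ltNge; apply/negP/H.
have pf t : 0 <= p t * (f t - c) by rewrite mulr_ge0// subr_ge0 ltW.
have S0 : \sum_t p t * (f t - c) = 0.
  apply/eqP; rewrite eq_le sumr_ge0// andbT.
  by under eq_bigr do rewrite mulrBr; rewrite sumrB -mulr_suml p1 mul1r subr_le0.
have : \sum_t p t = 0.
  apply: big1 => t _; have /eqP := sum_ge0_eq0 pf S0 t.
  by rewrite mulf_eq0 subr_eq0 [f t == c]gt_eqF ?orbF// => /eqP.
by rewrite p1 => /eqP; rewrite oner_eq0.
Qed.

Section Code.
Context {R : realType} {X Y1 Y2 Z1 Z2 : finType}.
Local Notation L := (letter X Y1 Y2 Z1 Z2).
Variables (P : L -> R) (n : nat) (R0 : R).
Hypothesis hP : is_pmf P.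
Context {TV TW I B Lam : finType}.
Local Notation J := (B * Lam)%type.
Local Notation TX := {ffun 'I_n -> X}.
Local Notation TS := {ffun 'I_n -> L}.
Local Notation xs := (@fcomp _ _ _ (@rvX X Y1 Y2 Z1 Z2)).
Variable q : TV -> TW -> TX -> R.
Hypothesis q0 : forall v w x, 0 <= q v w x.
Hypothesis q1 : \sum_v \sum_w \sum_x q v w x = 1.
Hypothesis hqX : forall x, qX q x = law (prodm P) (fcomp rvX) x.
Hypotheses (I0 : (0 < #|I|)%N) (J0 : (0 < #|{: J}|)%N).
Variables (D1 : TV -> TW -> {ffun 'I_n -> Y1} -> {ffun 'I_n -> Z1} -> bool)
  (D2 : TV -> {ffun 'I_n -> Y2} -> {ffun 'I_n -> Z2} -> bool)
  (Uz : TV -> TW -> {ffun 'I_n -> Z1} -> bool).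

Section Fixed.
Variable iota : I * B -> message n R0.
Hypothesis iota_inj : injective iota.
Variable C : {ffun I -> TV * {ffun J -> TW}}.

(* A nonzero message to either receiver individually signals an encoding error. *)
Definition embed (o : option (I * J)) : message n R0 * message n (0 : R) * message n (0 : R) :=
  match o with
  | Some (i, j) => (iota (i, j.1), ord0, ord0)
  | None => (ord0, ord_max, ord_max)
  end.

(** [iota] is injective, so [m0] fixes the row and the bin; the quantifier over [j] then lists the
    words of the bin. *)
Definition accept1 (m0 : message n R0) y z : bool :=
  [exists i, exists j, (iota (i, j.1) == m0) && D1 (C i).1 ((C i).2 j) y z].

Definition accept2 (m0 : message n R0) y z : bool :=
  [exists i, exists b, (iota (i, b) == m0) && D2 (C i).1 y z].

Lemma code_enc_pmf x : is_pmf (law (encode q C x) embed).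
Proof.
have [e0 e1] := encode_pmf q0 I0 J0 C x.
by split=> [m|]; [exact: law_ge0|rewrite sum_law1].
Qed.

Definition code_of_book : Defs.code n R0 0 0 := Defs.Code code_enc_pmf
  (fun y z m0 (m1 : message n (0 : R)) => ~~ ((m1 == ord0) && accept1 m0 y z))
  (fun y z m0 (m2 : message n (0 : R)) => ~~ ((m2 == ord0) && accept2 m0 y z)).

(** At rate zero a message still has two values, and the second is free to flag an error. *)
Lemma ord_max_neq0 : (ord_max == ord0 :> message n (0 : R)) = false.
Proof. by apply/eqP => /(congr1 val)/=; rewrite mulr0 powRr0 truncn1. Qed.

Lemma accept1_embed i (j : J) y z : accept1 (iota (i, j.1)) y z ->
  exists2 j', j.1 == j'.1 & D1 (C i).1 ((C i).2 j') y z.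
Proof.
by move=> /existsP[i' /existsP[j' /andP[/eqP/iota_inj[-> e] d]]]; exists j' => //; rewrite e.
Qed.

Lemma accept2_embed i (j : J) y z : accept2 (iota (i, j.1)) y z = D2 (C i).1 y z.
Proof.
apply/existsP/idP => [[i' /existsP[b /andP[/eqP/iota_inj e d]]]|d].
  by case: e d => ->.
by exists i; apply/existsP; exists j.1; rewrite eqxx.
Qed.

Lemma prob_dec1_code (Q : L -> R) b : prob_dec1 code_of_book Q b =
  \sum_s prodm Q s * \sum_o encode q C (xs s) o *
    (dec1 code_of_book (fcomp rvY1 s) (fcomp rvZ1 s) (embed o).1.1 (embed o).1.2 == b)%:R.
Proof.
apply: eq_bigr => s _; rewrite -mulr_sumr; congr (_ * _).
rewrite (sum_law _ embed (fun m => (dec1 code_of_book (fcomp rvY1 s) (fcomp rvZ1 s) m.1.1 m.1.2 == b)%:R)).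
rewrite big_mkcond/=; apply: eq_bigr => m _.
by case: (dec1 code_of_book _ _ _ _ == b); rewrite ?mulr1 ?mulr0.
Qed.

Lemma prob_dec2_code (Q : L -> R) b : prob_dec2 code_of_book Q b =
  \sum_s prodm Q s * \sum_o encode q C (xs s) o *
    (dec2 code_of_book (fcomp rvY2 s) (fcomp rvZ2 s) (embed o).1.1 (embed o).2 == b)%:R.
Proof.
apply: eq_bigr => s _; rewrite -mulr_sumr; congr (_ * _).
rewrite (sum_law _ embed (fun m => (dec2 code_of_book (fcomp rvY2 s) (fcomp rvZ2 s) m.1.1 m.2 == b)%:R)).
rewrite big_mkcond/=; apply: eq_bigr => m _.
by case: (dec2 code_of_book _ _ _ _ == b); rewrite ?mulr1 ?mulr0.
Qed.

Definition uncovered_prob := \sum_x qX q x * (~~ covered (J := J) q C x)%:R.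

(* conditional law of the letters given [X], times the codeword likelihood *)
Definition cond_score (v : TV) (w : TW) (s : TS) : R :=
  prodm P s / qX q (xs s) * qX_VW q v w (xs s).

Definition code_average (psi : TV -> TW -> R) : R :=
  (@ncodes R I {: B * Lam})^-1 * \sum_i \sum_j psi (C i).1 ((C i).2 j).

Let PS0 (s : TS) : 0 <= prodm P s. Proof. by apply: prodm_ge0; case: hP. Qed.

Lemma qX_gt0 (s : TS) : prodm P s != 0 -> 0 < qX q (xs s).
Proof.
move=> s0; rewrite hqX /law (bigD1 s)//= ltr_wpDr ?sumr_ge0// lt_neqAle eq_sym s0.
exact: PS0.
Qed.

Lemma prodm_encode_le (s : TS) i (j : J) :
  prodm P s * encode q C (xs s) (Some (i, j)) <=
  2 * ((@ncodes R I {: B * Lam})^-1 * cond_score (C i).1 ((C i).2 j) s).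
Proof.
have [s0|s0] := eqVneq (prodm P s) 0.
  by rewrite /cond_score s0 !mul0r !mulr0.
have x0 := qX_gt0 s0.
have := encode_le q0 I0 J0 C (xs s) i j.
rewrite -(ler_pM2l (x := prodm P s / qX q (xs s))); last first.
  by rewrite divr_gt0// lt_neqAle eq_sym s0 PS0.
have -> : prodm P s / qX q (xs s) * (qX q (xs s) * encode q C (xs s) (Some (i, j)))
  = prodm P s * encode q C (xs s) (Some (i, j)) by rewrite mulrA divfK// gt_eqF.
by move=> h; apply: le_trans h _; rewrite /cond_score; lra.
Qed.

Lemma sum_encode_le (phi : I -> J -> TS -> R) : (forall i j s, 0 <= phi i j s) ->
  \sum_s prodm P s * \sum_ij encode q C (xs s) (Some ij) * phi ij.1 ij.2 s <=
  2 * ((@ncodes R I {: B * Lam})^-1 * \sum_i \sum_j \sum_s cond_score (C i).1 ((C i).2 j) s * phi i j s).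
Proof.
move=> phi0.
have -> : \sum_i \sum_j \sum_s cond_score (C i).1 ((C i).2 j) s * phi i j s =
   \sum_s \sum_ij cond_score (C ij.1).1 ((C ij.1).2 ij.2) s * phi ij.1 ij.2 s.
  by rewrite [RHS]exchange_big/= sum_pair.
rewrite mulrA mulr_sumr; apply: ler_sum => s _.
rewrite !mulr_sumr; apply: ler_sum => -[i j] _ /=.
rewrite [leLHS]mulrA [leRHS]mulrA; apply: ler_wpM2r => //; rewrite -[leRHS]mulrA; exact: prodm_encode_le.
Qed.

Lemma sum_encode_None :
  \sum_s prodm P s * encode q C (xs s) None = uncovered_prob.
Proof.
rewrite (sum_law (prodm P) (fcomp rvX) (fun x => encode q C x None)).
apply: eq_bigr => x _; rewrite hqX; congr (_ * _).
by rewrite /encode; case: covered.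
Qed.

(** Either no codeword is chosen or the chosen one fails its test, the latter computed under the
    ideal law at the price of 2. *)
Lemma type1_code1 : prob_dec1 code_of_book P true <= uncovered_prob +
  2 * code_average (fun v w => \sum_s cond_score v w s * (~~ D1 v w (fcomp rvY1 s) (fcomp rvZ1 s))%:R).
Proof.
rewrite prob_dec1_code -sum_encode_None.
have h := @sum_encode_le (fun i j s =>
  (~~ D1 (C i).1 ((C i).2 j) (fcomp rvY1 s) (fcomp rvZ1 s))%:R) (fun _ _ _ => ler0n _ _).
apply: le_trans (lerD (lexx _) h).
rewrite -big_split/=; apply: ler_sum => s _; rewrite -mulrDr ler_wpM2l// sum_option.
have [e0 _] := encode_pmf q0 I0 J0 C (xs s).
apply: lerD; first by rewrite ler_piMr// lern1 leq_b1.
apply: ler_sum => -[i j] _; rewrite ler_wpM2l// ler_nat /= ?eqxx/= ?eqb_id.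
case: (boolP (D1 _ _ _ _)) => // d; last by case: (~~ _).
suff -> : accept1 (iota (i, j.1)) (fcomp rvY1 s) (fcomp rvZ1 s) by [].
by apply/existsP; exists i; apply/existsP; exists j; rewrite eqxx.
Qed.

Lemma type1_code2 : prob_dec2 code_of_book P true <= uncovered_prob +
  2 * code_average (fun v w => \sum_s cond_score v w s * (~~ D2 v (fcomp rvY2 s) (fcomp rvZ2 s))%:R).
Proof.
rewrite prob_dec2_code -sum_encode_None.
have h := @sum_encode_le (fun i j s =>
  (~~ D2 (C i).1 (fcomp rvY2 s) (fcomp rvZ2 s))%:R) (fun _ _ _ => ler0n _ _).
apply: le_trans (lerD (lexx _) h).
rewrite -big_split/=; apply: ler_sum => s _; rewrite -mulrDr ler_wpM2l// sum_option.
have [e0 _] := encode_pmf q0 I0 J0 C (xs s).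
apply: lerD; first by rewrite ler_piMr// lern1 leq_b1.
apply: ler_sum => -[i j] _; rewrite ler_wpM2l// ler_nat /= ?eqxx/= ?eqb_id.
by rewrite accept2_embed.
Qed.

Let K1 (y : {ffun 'I_n -> Y1}) (z : {ffun 'I_n -> Z1}) : R :=
  \prod_j (law P (pairRV rvY1 rvZ1) (y j, z j) / law P rvZ1 (z j)).
Let K2 (y : {ffun 'I_n -> Y2}) (z : {ffun 'I_n -> Z2}) : R :=
  \prod_j (law P (pairRV rvY2 rvZ2) (y j, z j) / law P rvZ2 (z j)).

Let P0 l : 0 <= P l. Proof. by case: hP. Qed.

Let K1_ge0 y z : 0 <= K1 y z.
Proof. by apply: prodr_ge0 => j _; rewrite divr_ge0 ?law_ge0. Qed.

Let K2_ge0 y z : 0 <= K2 y z.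
Proof. by apply: prodr_ge0 => j _; rewrite divr_ge0 ?law_ge0. Qed.

Lemma type2_code1 (kap : R) : 0 <= kap ->
  (forall v w z, \sum_y K1 y z * (D1 v w y z)%:R <= kap * (Uz v w z)%:R) ->
  prob_dec1 code_of_book (alt_law P) false <= kap * (1 + 2 * ((@ncodes R I {: B * Lam})^-1 * \sum_i \sum_j
     \sum_(j' | (j.1 == j'.1) && (j' != j)) \sum_s cond_score (C i).1 ((C i).2 j) s *
         (Uz (C i).1 ((C i).2 j') (fcomp rvZ1 s))%:R)).
Proof.
move=> kap0 hK; rewrite prob_dec1_code.
rewrite (sum_alt (law_alt_law1 hP) (fun x y z => \sum_o encode q C x o *
    (dec1 code_of_book y z (embed o).1.1 (embed o).1.2 == false)%:R)).
apply: (@le_trans _ _ (\sum_s prodm P s * \sum_ij encode q C (xs s) (Some ij) *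
    (kap * (1 + \sum_(j' | (ij.2.1 == j'.1) && (j' != ij.2))
      (Uz (C ij.1).1 ((C ij.1).2 j') (fcomp rvZ1 s))%:R)))).
  apply: ler_sum => s _; rewrite ler_wpM2l//.
  have [e0 _] := encode_pmf q0 I0 J0 C (xs s).
  under eq_bigr do rewrite mulr_sumr.
  rewrite exchange_big/= sum_option big1 ?add0r; last first.
    by move=> y _; rewrite /= ord_max_neq0/= !mulr0.
  apply: ler_sum => -[i j] _ /=; rewrite ?eqxx/=.
  rewrite (eq_bigr (fun y => encode q C (xs s) (Some (i, j)) *
     (K1 y (fcomp rvZ1 s) * (accept1 (iota (i, j.1)) y (fcomp rvZ1 s))%:R))); last first.
    move=> y _; rewrite mulrCA eqbF_neg negbK; congr (_ * (_ * _)).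
    by apply: eq_bigr => k _; rewrite !ffunE.
  rewrite -mulr_sumr ler_wpM2l//.
  apply: (@le_trans _ _ (\sum_y K1 y (fcomp rvZ1 s) * \sum_(j' | j.1 == j'.1)
       (D1 (C i).1 ((C i).2 j') y (fcomp rvZ1 s))%:R)).
    apply: ler_sum => y _; rewrite ler_wpM2l//.
    case: (boolP (accept1 _ _ _)) => [/accept1_embed[j' jj' d]|_]; last exact: sumr_ge0.
    by rewrite (bigD1 j')//= d lerDl sumr_ge0.
  under [leLHS]eq_bigr do rewrite mulr_sumr.
  rewrite exchange_big/=.
  apply: (@le_trans _ _ (\sum_(j' | j.1 == j'.1) kap * (Uz (C i).1 ((C i).2 j') (fcomp rvZ1 s))%:R)).
    by apply: ler_sum => j' _; exact: hK.
  rewrite -mulr_sumr ler_wpM2l// (bigD1 j)//= lerD2r lern1 leq_b1//.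
under eq_bigr do under eq_bigr do rewrite mulrCA mulrDr mulr1.
under eq_bigr do rewrite -mulr_sumr big_split/= mulrCA mulrDr.
rewrite -mulr_sumr ler_wpM2l// big_split/= lerD//.
  rewrite -[leRHS](@sum_prodm R 'I_n _ P); last by case: hP.
  apply: ler_sum => s _; rewrite ler_piMr//.
  have [e0 <-] := encode_pmf q0 I0 J0 C (xs s).
  by rewrite sum_option lerDr.
apply: le_trans (sum_encode_le (phi := fun i j s => \sum_(j' | (j.1 == j'.1) && (j' != j))
      (Uz (C i).1 ((C i).2 j') (fcomp rvZ1 s))%:R) _) _.
  by move=> i j s; exact: sumr_ge0.
rewrite !ler_wpM2l ?invr_ge0 ?(ltW (ncodes_gt0 I0 J0))//.
apply: ler_sum => i _; apply: ler_sum => j _.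
by under [leLHS]eq_bigr do rewrite mulr_sumr; rewrite exchange_big.
Qed.

Lemma type2_code2 (kap : R) : 0 <= kap ->
  (forall v z, \sum_y K2 y z * (D2 v y z)%:R <= kap) ->
  prob_dec2 code_of_book (alt_law P) false <= kap.
Proof.
move=> kap0 hK; rewrite prob_dec2_code.
rewrite (sum_alt (law_alt_law2 hP) (fun x y z => \sum_o encode q C x o *
    (dec2 code_of_book y z (embed o).1.1 (embed o).2 == false)%:R)).
have P1 : \sum_l P l = 1 by case: hP.
rewrite [leRHS](_ : kap = \sum_(s : TS) prodm P s * kap); last first.
  by rewrite -mulr_suml sum_prodm// mul1r.
apply: ler_sum => s _; rewrite ler_wpM2l//.
have [e0 e1] := encode_pmf q0 I0 J0 C (xs s).
under eq_bigr do rewrite mulr_sumr.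
rewrite exchange_big/= sum_option big1 ?add0r; last first.
  by move=> y _; rewrite /= ord_max_neq0/= !mulr0.
apply: (@le_trans _ _ (\sum_ij encode q C (xs s) (Some ij) * kap)).
  apply: ler_sum => -[i j] _ /=; rewrite ?eqxx/=.
  rewrite (eq_bigr (fun y => encode q C (xs s) (Some (i, j)) *
     (K2 y (fcomp rvZ2 s) * (D2 (C i).1 y (fcomp rvZ2 s))%:R))); last first.
    move=> y _; rewrite accept2_embed mulrCA eqbF_neg negbK; congr (_ * (_ * _)).
    by apply: eq_bigr => k _; rewrite !ffunE.
  by rewrite -mulr_sumr ler_wpM2l//.
rewrite -mulr_suml ler_piMl//.
by rewrite -e1 sum_option lerDr.
Qed.

End Fixed.
End Code.

Section OneShot.
Context {R : realType} {X Y1 Y2 Z1 Z2 : finType}.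
Local Notation L := (letter X Y1 Y2 Z1 Z2).
Variables (P : L -> R) (n : nat) (R0 : R).
Hypothesis hP : is_pmf P.
Context {TV TW I B Lam : finType}.
Local Notation J := (B * Lam)%type.
Local Notation TX := {ffun 'I_n -> X}.
Local Notation TS := {ffun 'I_n -> L}.
Local Notation xs := (@fcomp _ _ _ (@rvX X Y1 Y2 Z1 Z2)).
Variable q : TV -> TW -> TX -> R.
Hypothesis q0 : forall v w x, 0 <= q v w x.
Hypothesis q1 : \sum_v \sum_w \sum_x q v w x = 1.
Hypothesis hqX : forall x, qX q x = law (prodm P) (fcomp rvX) x.
Hypotheses (I0 : (0 < #|I|)%N) (J0 : (0 < #|{: J}|)%N).
Hypothesis hcard : (#|{: I * B}| <= #|message n R0|)%N.
Variables (D1 : TV -> TW -> {ffun 'I_n -> Y1} -> {ffun 'I_n -> Z1} -> bool)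
  (D2 : TV -> {ffun 'I_n -> Y2} -> {ffun 'I_n -> Z2} -> bool)
  (Uz : TV -> TW -> {ffun 'I_n -> Z1} -> bool).
Variables (A : TV -> TW -> TX -> bool) (eta : R).
Hypothesis eta0 : 0 <= eta.
Hypothesis hA1 : forall v w x, A v w x -> qVX q v x <= qV q v * qX q x * (#|I|%:R * eta).
Hypothesis hA2 : forall v w x, A v w x ->
  q v w x <= qVW q v w * qX q x * (#|I|%:R * #|{: J}|%:R * eta).
Variable j : TV -> TW -> TS -> R.
Hypothesis hj : forall v w s, prodm P s / qX q (xs s) * q v w (xs s) = j v w s.
Variables (kap1 kap2 eps : R).
Hypotheses (kap10 : 0 <= kap1) (kap20 : 0 <= kap2) (eps0 : 0 < eps).
Hypothesis hK1 : forall v w (z : {ffun 'I_n -> Z1}), \sum_(y : {ffun 'I_n -> Y1})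
  (\prod_i (law P (pairRV rvY1 rvZ1) (y i, z i) / law P rvZ1 (z i))) * (D1 v w y z)%:R
  <= kap1 * (Uz v w z)%:R.
Hypothesis hK2 : forall v (z : {ffun 'I_n -> Z2}), \sum_(y : {ffun 'I_n -> Y2})
  (\prod_i (law P (pairRV rvY2 rvZ2) (y i, z i) / law P rvZ2 (z i))) * (D2 v y z)%:R <= kap2.
Hypothesis herr : 32 * eta + 4 * \sum_v \sum_w \sum_x (~~ A v w x)%:R * q v w x
  + 2 * \sum_v \sum_w \sum_s j v w s * (~~ D1 v w (fcomp rvY1 s) (fcomp rvZ1 s))%:R
  + 2 * \sum_v \sum_w \sum_s j v w s * (~~ D2 v (fcomp rvY2 s) (fcomp rvZ2 s))%:R <= eps / 2.
Hypothesis hlist : #|Lam|.-1%:R * \sum_v \sum_w' \sum_s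
  qW_V q v w' * (\sum_w j v w s) * (Uz v w' (fcomp rvZ1 s))%:R <= 1.

Let qVW_cond_score v w s : qVW q v w * cond_score P q v w s = j v w s.
Proof. by rewrite /cond_score mulrCA qVW_qX_VW// hj. Qed.

Let average_score (D : TV -> TW -> TS -> bool) :
  \sum_C @book_law _ _ _ _ I {: J} q C * @code_average _ _ _ _ _ _ C
     (fun v w => \sum_s cond_score P q v w s * (D v w s)%:R)
  = \sum_v \sum_w \sum_s j v w s * (D v w s)%:R.
Proof.
apply: etrans (average_code q0 q1 I0 J0 (fun v w => \sum_s cond_score P q v w s * (D v w s)%:R)) _.
apply: eq_bigr => v _; apply: eq_bigr => w _.
by rewrite mulr_sumr; apply: eq_bigr => s _; rewrite mulrA qVW_cond_score.
Qed.

Lemma card_same_bin (k : J) :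
  (#|[pred k' : J | (k.1 == k'.1) && (k' != k)]| <= #|Lam|.-1)%N.
Proof.
rewrite -(cardC1 k.2); apply: leq_trans (leq_imset_card (fun l => (k.1, l)) _).
apply/subset_leq_card/fintype.subsetP => -[b l]; rewrite !inE/= => /andP[/eqP <- h].
apply/imsetP; exists l => //; rewrite !inE; apply: contraNN h => /eqP ->.
by rewrite -surjective_pairing.
Qed.

(** The codebook is fixed by averaging one functional [F], which weighs errors by [1 / eps] and the
    list length by [1 / 4]. Its mean is at most 1, so some book has total error at most [eps] and a
    mean list of length at most 4; the constant 9 is 1 plus twice 4. *)
Lemma one_shot_code : exists c : Defs.code n R0 0 0,
  [/\ prob_dec1 c P true <= eps, prob_dec2 c P true <= eps,
      prob_dec1 c (alt_law P) false <= 9 * kap1 &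
      prob_dec2 c (alt_law P) false <= kap2].
Proof.
have [iota iota_inj] := exists_injective hcard.
pose psi v w w' := \sum_s cond_score P q v w s * (Uz v w' (fcomp rvZ1 s))%:R.
pose lst (C : {ffun I -> TV * {ffun J -> TW}}) := (@ncodes R I {: J})^-1 * \sum_i \sum_k
     \sum_(k' | (k.1 == k'.1) && (k' != k)) psi (C i).1 ((C i).2 k) ((C i).2 k').
pose avg1 (C : {ffun I -> TV * {ffun J -> TW}}) := code_average C (fun v w => \sum_s cond_score P q v w s
   * (~~ D1 v w (fcomp rvY1 s) (fcomp rvZ1 s))%:R).
pose avg2 (C : {ffun I -> TV * {ffun J -> TW}}) := code_average C (fun v w => \sum_s cond_score P q v w s
   * (~~ D2 v (fcomp rvY2 s) (fcomp rvZ2 s))%:R).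
pose err (C : {ffun I -> TV * {ffun J -> TW}}) := uncovered_prob q C.
have cs0 v w s : 0 <= cond_score P q v w s.
  rewrite /cond_score mulr_ge0 ?qX_VW_ge0// divr_ge0 ?qX_ge0// prodm_ge0//.
  by case: hP.
have psi0 v w w' : 0 <= psi v w w' by apply: sumr_ge0 => s _; rewrite mulr_ge0.
have nc0 : 0 <= (@ncodes R I {: J})^-1 by rewrite invr_ge0 ltW// ncodes_gt0.
have lst0 C : 0 <= lst C.
  by rewrite mulr_ge0//; do 3! (apply: sumr_ge0 => ? _).
have avg10 C : 0 <= avg1 C.
  by rewrite mulr_ge0//; do 3! (apply: sumr_ge0 => ? _); rewrite mulr_ge0.
have avg20 C : 0 <= avg2 C.
  by rewrite mulr_ge0//; do 3! (apply: sumr_ge0 => ? _); rewrite mulr_ge0.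
have err0 C : 0 <= err C.
  by apply: sumr_ge0 => x _; rewrite mulr_ge0 ?qX_ge0.
pose F C := (err C + 2 * avg1 C + 2 * avg2 C) / eps + lst C / 4.
have bpmf := @book_law_pmf _ _ _ _ I {: J} q q0 q1.
have EF : \sum_C book_law q C * F C <= 1.
  have -> : \sum_C book_law q C * F C =
     ((\sum_C book_law q C * err C) + 2 * (\sum_C book_law q C * avg1 C)
       + 2 * (\sum_C book_law q C * avg2 C)) / eps + (\sum_C book_law q C * lst C) / 4.
    rewrite !mulrDl !mulr_sumr !mulr_suml -!big_split/=; apply: eq_bigr => C _.
    by rewrite /F; ring.
  have h1 := expected_uncovered q0 q1 I0 J0 eta0 hA1 hA2.
  have h2 := average_score (fun v w s => ~~ D1 v w (fcomp rvY1 s) (fcomp rvZ1 s)).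
  have h3 := average_score (fun v w s => ~~ D2 v (fcomp rvY2 s) (fcomp rvZ2 s)).
  (* Given the centre, another word of the bin is independent of the letters, which explains the
     weight in [hlist]. *)
  have h4 : \sum_C book_law q C * lst C <= 1.
    apply: le_trans (average_pair (K := #|Lam|.-1%:R) q0 q1 I0 J0 (rel := fun k k' => k.1 == k'.1) psi0 _) _.
      by move=> k; rewrite ler_nat; exact: card_same_bin.
    apply: le_trans hlist; rewrite ler_wpM2l//; apply: ler_sum => v _.
    rewrite exchange_big/=; apply: ler_sum => w' _.
    rewrite le_eqVlt; apply/orP; left; apply/eqP.
    under eq_bigr do rewrite /psi mulr_sumr.
    rewrite exchange_big/=; apply: eq_bigr => s _.
    rewrite -mulrA mulr_suml mulr_sumr; apply: eq_bigr => w _.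
    by rewrite -qVW_cond_score -qV_qW_V//; ring.
  have : ((\sum_C book_law q C * err C) + 2 * (\sum_C book_law q C * avg1 C)
       + 2 * (\sum_C book_law q C * avg2 C)) / eps <= 1 / 2.
    rewrite ler_pdivrMr// /avg1 /avg2 h2 h3; move: herr h1; rewrite /err; lra.
  by lra.
have [C FC] := exists_le_average bpmf EF.
have lC : lst C <= 4.
  have : 0 <= (err C + 2 * avg1 C + 2 * avg2 C) / eps.
    by rewrite divr_ge0 ?(ltW eps0)// !addr_ge0// mulr_ge0.
  by move: FC; rewrite /F; lra.
have eC : err C + 2 * avg1 C + 2 * avg2 C <= eps.
  have : (err C + 2 * avg1 C + 2 * avg2 C) / eps <= 1.
    by move: FC (lst0 C); rewrite /F; lra.
  by rewrite ler_pdivrMr// mul1r.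
exists (code_of_book q0 I0 J0 D1 D2 iota C); split.
- apply: le_trans (type1_code1 hP q0 hqX I0 J0 D1 D2 iota C) _.
  by move: eC (avg20 C); rewrite /err /avg1; lra.
- apply: le_trans (type1_code2 hP q0 hqX I0 J0 D1 D2 iota_inj C) _.
  by move: eC (avg10 C); rewrite /err /avg2; lra.
- apply: le_trans (type2_code1 hP q0 hqX I0 J0 D2 iota_inj C kap10 hK1) _.
  rewrite mulrC ler_wpM2r//; move: lC; rewrite /lst /psi; lra.
- exact: (type2_code2 hP q0 I0 J0 D1 iota_inj C kap20 hK2).
Qed.

End OneShot.

(** * n-letter codes *)

(** The coefficients 2 of the type I errors are rounded up to 4 so that the five variances share one
    factor. *)
Lemma union_bound {R : realDomainType} (e a s t b1 b2 b3 b4 u1 u2 u3 u4 u5 : R) :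
  a <= b1 + b2 -> s <= b4 + b3 -> b1 <= u1 -> b2 <= u2 -> b3 <= u3 -> b4 <= u4 -> t <= u5 ->
  0 <= u3 -> 0 <= u4 -> 0 <= u5 ->
  e + 4 * a + 2 * s + 2 * t <= e + 4 * (u1 + u2 + u3 + u4 + u5).
Proof. lra. Qed.

Section Tracking.
Context {R : realType} {T : finType} {n : nat}.
Variable p : T -> R.
Hypothesis hp : is_pmf p.
Local Notation O := {ffun 'I_n -> T}.
Local Notation pn := (@prodm R 'I_n T p).

Let p0 t : 0 <= p t. Proof. by case: hp. Qed.

Definition self_log (A : finType) (F : T -> A) (t : T) : R := log2 (law p F (F t)).

(* [Fn] is, up to relabelling, the sequence of the values of [F]. *)
Definition tracks (An A : finType) (Fn : O -> An) (F : T -> A) : Prop :=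
  forall w w', Fn w = Fn w' <-> forall i, F (w i) = F (w' i).

Lemma tracks_fcomp (A : finType) (F : T -> A) : tracks (fcomp F) F.
Proof.
move=> w w'; split=> [/ffunP e i|e]; first by have := e i; rewrite !ffunE.
by apply/ffunP => i; rewrite !ffunE.
Qed.

Lemma tracks_pair (An A Bn B : finType) (Fn : O -> An) (F : T -> A) (Gn : O -> Bn) (G : T -> B) :
  tracks Fn F -> tracks Gn G -> tracks (pairRV Fn Gn) (pairRV F G).
Proof.
move=> FF GG w w'; rewrite /pairRV; split=> [[/FF e /GG e'] i|e]; first by rewrite e e'.
by congr (_, _); [apply/FF|apply/GG] => i; have [] := e i.
Qed.

Lemma tracks_law (An A : finType) (Fn : O -> An) (F : T -> A) w : tracks Fn F ->
  law pn Fn (Fn w) = law pn (fcomp F) (fcomp F w).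
Proof.
move=> FF; apply: eq_bigl => w'; apply/eqP/eqP.
  by move=> /FF e; apply/ffunP => i; rewrite !ffunE.
by move=> /ffunP e; apply/FF => i; have := e i; rewrite !ffunE.
Qed.

Lemma law_prodm_gt0 (An : finType) (Fn : O -> An) w :
  pn w != 0 -> 0 < law pn Fn (Fn w).
Proof.
move=> w0; rewrite /law (bigD1 w)//= ltr_wpDr ?sumr_ge0//.
  by move=> w' _; exact: prodm_ge0.
by rewrite lt_neqAle eq_sym w0 prodm_ge0.
Qed.

Lemma tracks_log (An A : finType) (Fn : O -> An) (F : T -> A) w : tracks Fn F ->
  pn w != 0 -> log2 (law pn Fn (Fn w)) = \sum_i self_log F (w i).
Proof. by move=> FF w0; rewrite (tracks_law _ FF) log2_law_prodm. Qed.

Lemma mean_self_log (A : finType) (F : T -> A) : \sum_t p t * self_log F t = - entropy p F.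
Proof. by rewrite entropyE opprK. Qed.

Definition fvariance (g : T -> R) : R := \sum_t p t * (g t - \sum_t p t * g t) ^+ 2.

Lemma fvariance_ge0 g : 0 <= fvariance g.
Proof. by apply: sumr_ge0 => t _; rewrite mulr_ge0// sqr_ge0. Qed.

Lemma tail_bound (g : T -> R) (d : R) (E : pred O) : 0 < d -> (0 < n)%N ->
  (forall w, pn w != 0 -> E w -> \sum_i g (w i) < n%:R * (\sum_t p t * g t - d)) ->
  \sum_w pn w * (E w)%:R <= fvariance g / d ^+ 2 / n%:R.
Proof.
move=> d0 n0 H.
have := @chebyshev_prodm R 'I_n T p g d hp d0; rewrite card_ord => /(_ n0).
apply: le_trans; rewrite [leRHS]big_mkcond/=; apply: ler_sum => w _.
have [->|w0] := eqVneq (pn w) 0; first by rewrite mul0r; case: ifP.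
case: (boolP (E w)) => [/(H w w0) ->|_]; first by rewrite mulr1.
by rewrite mulr0; case: ifP => // _; exact: prodm_ge0.
Qed.

Lemma log2_lt_of_nle (a b c r : R) : 0 < a -> 0 < b -> 2 `^ r <= c -> ~~ (a <= b * c) ->
  log2 b - log2 a < - r.
Proof.
move=> a0 b0 rc; rewrite -ltNge => h.
have r0 : 0 < 2 `^ r :> R by rewrite powR_gt0.
have : b * 2 `^ r < a by apply: le_lt_trans h; rewrite ler_pM2l.
have l2 := @ln2_gt0 R.
have b2 : 0 < b * 2 `^ r by rewrite mulr_gt0.
rewrite -ltr_ln ?posrE// -(ltr_pM2r (x := (ln 2)^-1)) ?invr_gt0//.
by rewrite -/(log2 _) -/(log2 _) log2M// log2_powR; lra.
Qed.

End Tracking.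

(* Likelihood-ratio test of [(U, Y, Z)] against [Y] and [U] independent given [Z]. *)
Definition ratio_test {R : realType} {W A B C : finType} (p : W -> R)
    (U : W -> A) (Y : W -> B) (Z : W -> C) (c : R) (u : A) (y : B) (z : C) : bool :=
  (0 < law p (pairRV (pairRV U Y) Z) (u, y, z)) &&
  (2 `^ c * (law p (pairRV U Z) (u, z) * law p (pairRV Y Z) (y, z)) <=
    law p (pairRV (pairRV U Y) Z) (u, y, z) * law p Z z).

(** Where the test passes, the law of [y] given [z] is at most [2^(-c)] times its law given [u] and
    [z], and the latter sums to at most 1. *)
Lemma ratio_test_le {R : realType} {W A B C : finType} (p : W -> R)
    (U : W -> A) (Y : W -> B) (Z : W -> C) (c : R) (u : A) (z : C) :
  (forall w, 0 <= p w) ->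
  \sum_y law p (pairRV Y Z) (y, z) / law p Z z * (ratio_test p U Y Z c u y z)%:R <= 2 `^ (- c).
Proof.
move=> p0; have c0 : 0 < 2 `^ c :> R by rewrite powR_gt0.
set l := law p (pairRV U Z) (u, z).
have l0 : 0 <= l by exact: law_ge0.
have e : \sum_y law p (pairRV (pairRV U Y) Z) (u, y, z) = l.
  rewrite /l (law_sumr p (pairRV U Z) Y); apply: eq_bigr => y _.
  by apply: eq_bigl => w; rewrite /pairRV !xpair_eqE andbAC.
apply: (@le_trans _ _ (\sum_y 2 `^ (- c) * (law p (pairRV (pairRV U Y) Z) (u, y, z) / l))).
  apply: ler_sum => y _; rewrite /ratio_test.
  case: (boolP (_ && _)) => [/andP[k h]|_]; last first.
    by rewrite mulr0 mulr_ge0 ?powR_ge0// divr_ge0// law_ge0.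
  have hz := law_gt0_comp (fun x => x.2) p0 k; rewrite /= in hz.
  have hl : 0 < l by have := law_gt0_comp (fun x => (x.1.1, x.2)) p0 k.
  rewrite mulr1 ler_pdivrMr// powRN.
  have -> : (2 `^ c)^-1 * (law p (pairRV (pairRV U Y) Z) (u, y, z) / l) * law p Z z =
     (law p (pairRV (pairRV U Y) Z) (u, y, z) * law p Z z) / (2 `^ c * l).
    by field; rewrite !gt_eqF.
  rewrite -/l in h; rewrite ler_pdivlMr ?mulr_gt0//; apply: le_trans h.
  by rewrite le_eqVlt; apply/orP; left; apply/eqP; ring.
rewrite -mulr_sumr -mulr_suml e ler_piMr ?powR_ge0//.
have [->|ln0] := eqVneq l 0; first by rewrite mul0r.
by rewrite divff.
Qed.

Section NLetter.
Context {R : realType} {X Y1 Y2 Z1 Z2 A B : finType}.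
Local Notation L := (letter X Y1 Y2 Z1 Z2).
Variables (P : L -> R) (k : X -> A * B -> R) (n : nat) (R0 : R).
Hypotheses (hP : is_pmf P) (hk : is_kernel k) (n0 : (0 < n)%N).
Local Notation p := (kjoint rvX P k).
Local Notation T := (A * B * L)%type.

Let hp : is_pmf p. Proof. exact: kjoint_pmf. Qed.
Let p0 t : 0 <= p t. Proof. by case: hp. Qed.

Definition v1 (t : T) := t.1.1.
Definition w1 (t : T) := t.1.2.
Definition x1 (t : T) := rvX t.2.
Definition y1 (t : T) := rvY1 t.2.
Definition y2 (t : T) := rvY2 t.2.
Definition z1 (t : T) := rvZ1 t.2.
Definition z2 (t : T) := rvZ2 t.2.

Local Notation pn := (@prodm R 'I_n T p).
Local Notation V := (@fcomp 'I_n T A v1).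
Local Notation W := (@fcomp 'I_n T B w1).
Local Notation Xn := (@fcomp 'I_n T X x1).
Local Notation Y1n := (@fcomp 'I_n T Y1 y1).
Local Notation Y2n := (@fcomp 'I_n T Y2 y2).
Local Notation Z1n := (@fcomp 'I_n T Z1 z1).
Local Notation Z2n := (@fcomp 'I_n T Z2 z2).
Local Notation Sn := (@fcomp 'I_n T L snd).

Let pn0 w : 0 <= pn w. Proof. exact: prodm_ge0. Qed.

Let q v w x := law pn (pairRV (pairRV V W) Xn) (v, w, x).
Let j v w s := law pn (pairRV (pairRV V W) Sn) (v, w, s).

Let q0 v w x : 0 <= q v w x. Proof. exact: law_ge0. Qed.

Lemma qVWE v w : qVW q v w = law pn (pairRV V W) (v, w).
Proof. by rewrite (law_sumr _ (pairRV V W) Xn). Qed.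

Lemma qVE v : qV q v = law pn V v.
Proof. by rewrite (law_sumr _ V W); apply: eq_bigr => w _; exact: qVWE. Qed.

Lemma qVXE v x : qVX q v x = law pn (pairRV V Xn) (v, x).
Proof.
rewrite (law_sumr _ (pairRV V Xn) W); apply: eq_bigr => w _.
by apply: eq_bigl => o; rewrite /pairRV !xpair_eqE andbAC.
Qed.

Lemma qXE x : qX q x = law pn Xn x.
Proof. by rewrite (law_suml _ (pairRV V W) Xn) sum_pair. Qed.

Lemma q_total : \sum_v \sum_w \sum_x q v w x = 1.
Proof.
rewrite -(sum_prodm (I := 'I_n) (proj2 hp)) -(sum_law1 _ V).
by apply: eq_bigr => v _; exact: qVE.
Qed.

Lemma law_pn_letter (C : finType) (f : L -> C) u :
  law pn (fcomp (f \o snd)) u = law (@prodm R 'I_n L P) (fcomp f) u.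
Proof. by rewrite !law_prodm; apply: eq_bigr => i _; rewrite law_kjoint_snd. Qed.

Lemma q_source x : qX q x = law (prodm P) (fcomp rvX) x.
Proof. by rewrite qXE -law_pn_letter. Qed.

Lemma law_pn_pair (C : finType) (f : L -> C) v w (u : {ffun 'I_n -> C}) :
  law pn (pairRV (pairRV V W) (fcomp (f \o snd))) (v, w, u) =
  \prod_i law p (pairRV fst (f \o snd)) ((v i, w i), u i).
Proof.
transitivity (law pn (fcomp (pairRV fst (f \o snd))) [ffun i => ((v i, w i), u i)]).
  apply: eq_bigl => o; apply/eqP/eqP.
    by case=> <- <- <-; apply/ffunP => i; rewrite !ffunE /pairRV/=; case: (o i) => [[]].
  move=> /ffunP e; congr (_, _, _); apply/ffunP => i; have := e i; rewrite !ffunE /pairRV /v1 /w1/=.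
  - by case=> ->.
  - by case=> ->.
  - by case.
by rewrite law_prodm; apply: eq_bigr => i _; rewrite ffunE.
Qed.

(** Given [X^n] the letters are independent of the codewords, so [q] extends from [X^n] to whole
    letters by the conditional law of the source. *)
Lemma q_jE v w s : prodm P s / qX q (fcomp rvX s) * q v w (fcomp rvX s) = j v w s.
Proof.
have -> : q v w (fcomp rvX s) = _ := law_pn_pair rvX v w (fcomp rvX s).
have -> : j v w s = _ := law_pn_pair id v w s.
rewrite q_source law_prodm.
rewrite /prodm -prodf_div -big_split/=; apply: eq_bigr => i _.
rewrite !ffunE -[fst]/(id \o @fst (A * B) L).
have -> : law p (pairRV (id \o fst) (rvX \o snd)) (v i, w i, rvX (s i)) =
    k (rvX (s i)) (v i, w i) * law P rvX (rvX (s i)).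
  by rewrite law_kjoint2; congr (_ * _); rewrite /law big_pred1_eq.
have -> : law p (pairRV (id \o fst) (id \o snd)) (v i, w i, s i) =
    P (s i) * k (rvX (s i)) (v i, w i).
  by rewrite /law (big_pred1 ((v i, w i), s i))//.
have [Ps|Ps] := eqVneq (P (s i)) 0; first by rewrite Ps !mul0r.
have P0 l : 0 <= P l by case: hP.
have h : law P rvX (rvX (s i)) != 0.
  apply: lt0r_neq0; apply: lt_le_trans (_ : P (s i) <= _).
    by rewrite lt_neqAle eq_sym Ps P0.
  by rewrite /law (bigD1 (s i))//= lerDl sumr_ge0.
by rewrite mulrACA mulVf// mulr1.
Qed.

Lemma sum_j (phi : {ffun 'I_n -> A} -> {ffun 'I_n -> B} -> {ffun 'I_n -> L} -> R) :
  \sum_v \sum_w \sum_s j v w s * phi v w s = \sum_o pn o * phi (V o) (W o) (Sn o).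
Proof.
rewrite (sum_law pn (pairRV (pairRV V W) Sn) (fun u => phi u.1.1 u.1.2 u.2)).
by rewrite !sum_pair.
Qed.

Lemma sum_q (phi : {ffun 'I_n -> A} -> {ffun 'I_n -> B} -> {ffun 'I_n -> X} -> R) :
  \sum_v \sum_w \sum_x phi v w x * q v w x = \sum_o pn o * phi (V o) (W o) (Xn o).
Proof.
rewrite (sum_law pn (pairRV (pairRV V W) Xn) (fun u => phi u.1.1 u.1.2 u.2)).
by rewrite !sum_pair; do 3! (apply: eq_bigr => ? _); rewrite mulrC.
Qed.

Local Notation VW := (pairRV V W).

(** Threshold on the information density of [W] and [Z1] given [V]; only words that pass it enter
    the list. *)
Definition list_test (d : R) (v : {ffun 'I_n -> A}) (w : {ffun 'I_n -> B})
    (z : {ffun 'I_n -> Z1}) : bool :=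
  2 `^ d * (law pn VW (v, w) * law pn (pairRV V Z1n) (v, z)) <=
    law pn (pairRV VW Z1n) (v, w, z) * law pn V v.

(** The two conditions are the hypotheses [hA1] and [hA2] of the covering lemma. *)
Definition cover_test (cI cN : R) v w x : bool :=
  (qVX q v x <= qV q v * qX q x * cI) && (q v w x <= qVW q v w * qX q x * cN).

Lemma letter_ratio (C D : finType) (f : L -> C) (g : L -> D) (y : {ffun 'I_n -> C}) (z : {ffun 'I_n -> D}) :
  \prod_i (law P (pairRV f g) (y i, z i) / law P g (z i)) =
  law pn (pairRV (fcomp (f \o snd)) (fcomp (g \o snd))) (y, z) / law pn (fcomp (g \o snd)) z.
Proof.
rewrite law_pn_letter law_prodm prodf_div; congr (_ / _).
transitivity (law pn (fcomp (pairRV f g \o snd)) [ffun i => (y i, z i)]).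
  by rewrite law_pn_letter law_prodm; apply: eq_bigr => i _; rewrite ffunE.
apply: eq_bigl => o; apply/eqP/eqP.
  move=> /ffunP e; congr (_, _); apply/ffunP => i; have := e i;
    by rewrite !ffunE => -[].
by case=> <- <-; apply/ffunP => i; rewrite !ffunE.
Qed.

(** A word drawn from the centre independently of [Z1^n] passes with probability at most [2^(-d)],
    by a change of measure from the joint law. *)
Lemma list_test_le d : \sum_v \sum_w' \sum_s
  qW_V q v w' * (\sum_w j v w s) * (list_test d v w' (fcomp rvZ1 s))%:R <= 2 `^ (- d).
Proof.
have d0 : 0 < 2 `^ d :> R by rewrite powR_gt0.
pose psi v z := \sum_w' qW_V q v w' * (list_test d v w' z)%:R.
have -> : \sum_v \sum_w' \sum_s
  qW_V q v w' * (\sum_w j v w s) * (list_test d v w' (fcomp rvZ1 s))%:R =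
  \sum_v \sum_w \sum_s j v w s * psi v (fcomp rvZ1 s).
  apply: eq_bigr => v _; rewrite exchange_big/= [RHS]exchange_big/=.
  apply: eq_bigr => s _; rewrite -mulr_suml /psi mulr_sumr.
  by apply: eq_bigr => w' _; ring.
rewrite (sum_j (fun v w s => psi v (fcomp rvZ1 s))).
have -> : \sum_o pn o * psi (V o) (fcomp rvZ1 (Sn o)) = \sum_v \sum_z law pn (pairRV V Z1n) (v, z) * psi v z.
  rewrite sum_law_cond; apply: eq_bigr => o _; congr (_ * psi _ _).
  by apply/ffunP => i; rewrite !ffunE.
apply: (@le_trans _ _ (\sum_v \sum_z \sum_w' 2 `^ (- d) * law pn (pairRV VW Z1n) (v, w', z))).
  apply: ler_sum => v _; apply: ler_sum => z _; rewrite mulr_sumr; apply: ler_sum => w' _.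
  rewrite /list_test; case: (boolP (2 `^ d * _ <= _)) => h; last first.
    by rewrite !mulr0 mulr_ge0 ?powR_ge0// law_ge0.
  rewrite mulr1 /qW_V qVWE qVE powRN ler_pdivlMl//.
  have [->|v0] := eqVneq (law pn V v) 0; first by rewrite invr0 !mulr0 law_ge0.
  have vgt : 0 < law pn V v by rewrite lt_neqAle eq_sym v0 law_ge0.
  rewrite !mulrA ler_pdivrMr//; apply: le_trans h.
  by rewrite le_eqVlt; apply/orP; left; apply/eqP; ring.
have -> : \sum_v \sum_z \sum_w' 2 `^ (- d) * law pn (pairRV VW Z1n) (v, w', z) =
    2 `^ (- d) * \sum_v \sum_w' \sum_z law pn (pairRV VW Z1n) (v, w', z).
  rewrite mulr_sumr; apply: eq_bigr => v _; rewrite exchange_big mulr_sumr.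
  by apply: eq_bigr => w' _; rewrite mulr_sumr.
have -> : \sum_v \sum_w' \sum_z law pn (pairRV VW Z1n) (v, w', z) = 1.
  rewrite -[RHS](sum_prodm (I := 'I_n) (proj2 hp)) -(sum_law1 _ (pairRV VW Z1n)).
  by rewrite !sum_pair.
by rewrite mulr1.
Qed.

Let sl (C : finType) (F : T -> C) := self_log p F.
Let tV : tracks V v1. Proof. exact: tracks_fcomp. Qed.
Let tVW : tracks VW (pairRV v1 w1). Proof. by apply: tracks_pair; exact: tracks_fcomp. Qed.
Let tX : tracks Xn x1. Proof. exact: tracks_fcomp. Qed.

(* [I(V; X)], [I(V, W; X)], [I(W; Z1 | V)], [I(V, W; Y1 | Z1)] and [I(V; Y2 | Z2)] *)
Definition rate_VX : R := entropy p v1 + entropy p x1 - entropy p (pairRV v1 x1).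
Definition rate_VWX : R := entropy p (pairRV v1 w1) + entropy p x1 - entropy p (pairRV (pairRV v1 w1) x1).
Definition rate_WZ : R := entropy p (pairRV v1 w1) + entropy p (pairRV v1 z1)
   - entropy p (pairRV (pairRV v1 w1) z1) - entropy p v1.
Definition exponent1 : R := entropy p (pairRV (pairRV v1 w1) z1) + entropy p (pairRV y1 z1)
   - entropy p (pairRV (pairRV (pairRV v1 w1) y1) z1) - entropy p z1.
Definition exponent2 : R := entropy p (pairRV v1 z2) + entropy p (pairRV y2 z2)
   - entropy p (pairRV (pairRV v1 y2) z2) - entropy p z2.

Local Notation fvar F G H K := (fvariance p (fun t => sl F t + sl G t - sl H t - sl K t)).

(** Per-letter variances of the five information densities, for the Chebyshev bounds. *)
Definition spread : R :=
  fvar v1 x1 (pairRV v1 x1) (fun=> tt) +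
  fvar (pairRV v1 w1) x1 (pairRV (pairRV v1 w1) x1) (fun=> tt) +
  fvar (pairRV (pairRV v1 w1) z1) v1 (pairRV v1 w1) (pairRV v1 z1) +
  fvar (pairRV (pairRV (pairRV v1 w1) y1) z1) z1 (pairRV (pairRV v1 w1) z1) (pairRV y1 z1) +
  fvar (pairRV (pairRV v1 y2) z2) z2 (pairRV v1 z2) (pairRV y2 z2).

Let mean2 (f g : T -> R) : \sum_t p t * (f t + g t) = \sum_t p t * f t + \sum_t p t * g t.
Proof. by rewrite -big_split/=; apply: eq_bigr => t _; rewrite mulrDr. Qed.
Let meanN (f : T -> R) : \sum_t p t * - f t = - \sum_t p t * f t.
Proof. by rewrite -sumrN; apply: eq_bigr => t _; rewrite mulrN. Qed.

(** Every error event is the failure of an inequality between products of two probabilities. In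
    logarithms, a sum of [n] independent terms then falls short of its mean by more than [n d], and
    Chebyshev's inequality applies. A missing factor is supplied by the constant variable [tt]. *)
Let bad4 (An Bn Cn Dn A' B' C' D' : finType)
  (Fn : {ffun 'I_n -> T} -> An) (F : T -> A') (Gn : {ffun 'I_n -> T} -> Bn) (G : T -> B')
  (Hn : {ffun 'I_n -> T} -> Cn) (H : T -> C') (Kn : {ffun 'I_n -> T} -> Dn) (K : T -> D') (c d : R)
  (E : pred {ffun 'I_n -> T}) :
  tracks Fn F -> tracks Gn G -> tracks Hn H -> tracks Kn K -> 0 < d ->
  2 `^ (n%:R * (entropy p F + entropy p G - entropy p H - entropy p K + d)) <= c ->
  (forall o, pn o != 0 -> E o -> ~~ (law pn Hn (Hn o) * law pn Kn (Kn o) <=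
       law pn Fn (Fn o) * law pn Gn (Gn o) * c)) ->
  \sum_o pn o * (E o)%:R <= fvar F G H K / d ^+ 2 / n%:R.
Proof.
move=> tF tG tH tK d0 hc hE; apply: (tail_bound hp d0 n0) => o o0 /(hE _ o0) h.
have Fgt := law_prodm_gt0 hp Fn o0; have Ggt := law_prodm_gt0 hp Gn o0.
have Hgt := law_prodm_gt0 hp Hn o0; have Kgt := law_prodm_gt0 hp Kn o0.
have := log2_lt_of_nle (mulr_gt0 Hgt Kgt) (mulr_gt0 Fgt Ggt) hc h.
rewrite !log2M// (tracks_log hp tF o0) (tracks_log hp tG o0) (tracks_log hp tH o0) (tracks_log hp tK o0).
rewrite !mean2 !meanN !mean_self_log => hh.
rewrite !sumrB !big_split/=; move: hh; rewrite /sl; lra.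
Qed.

Let ttracks : tracks (fun _ : {ffun 'I_n -> T} => tt) (fun _ : T => tt).
Proof. by move=> w w'; split. Qed.

Let entropy_tt : entropy p (fun=> tt) = 0. Proof. by apply: entropy_cst; case: hp. Qed.

Let law_tt : law pn (fun=> tt) tt = 1.
Proof.
by rewrite /law (eq_bigl xpredT)// sum_prodm// (proj2 hp).
Qed.

Let ratio_bad (An Bn Cn : finType) (A' B' C' : finType)
  (Un : {ffun 'I_n -> T} -> An) (U : T -> A') (Yn : {ffun 'I_n -> T} -> Bn) (Y : T -> B')
  (Zn : {ffun 'I_n -> T} -> Cn) (Z : T -> C') (d : R) :
  tracks Un U -> tracks Yn Y -> tracks Zn Z -> 0 < d ->
  \sum_o pn o * (~~ ratio_test pn Un Yn Zn (n%:R * (entropy p (pairRV U Z) + entropy p (pairRV Y Z)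
      - entropy p (pairRV (pairRV U Y) Z) - entropy p Z - d)) (Un o) (Yn o) (Zn o))%:R <=
  fvar (pairRV (pairRV U Y) Z) Z (pairRV U Z) (pairRV Y Z)
    / d ^+ 2 / n%:R.
Proof.
move=> tU tY tZ d0; set r := n%:R * _.
apply: (bad4 (c := 2 `^ (- r)) (tracks_pair (tracks_pair tU tY) tZ) tZ (tracks_pair tU tZ)
   (tracks_pair tY tZ) d0 _ _).
  by rewrite ler_powR ?ler1n// /r; lra.
move=> o o0; rewrite /ratio_test negb_and (law_prodm_gt0 hp (pairRV (pairRV Un Yn) Zn) o0)/=.
by apply: contraNN => h; rewrite -ler_pdivlMl ?powR_gt0// -powRN [leRHS]mulrC.
Qed.

(** [I] indexes the centres, [B'] the bins and [Lam] the words of a bin. The exponential conditions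
    are, in order, covering by centres, covering by all codewords, and a list of mean length at most
    one. *)
Lemma n_letter_code (I B' Lam : finType) (d eta eps : R) :
  (0 < #|I|)%N -> (0 < #|{: B' * Lam}|)%N -> (#|{: I * B'}| <= #|message n R0|)%N ->
  0 < d -> 0 <= eta -> 0 < eps ->
  2 `^ (n%:R * (rate_VX + d)) <= #|I|%:R * eta ->
  2 `^ (n%:R * (rate_VWX + d)) <= #|I|%:R * #|{: B' * Lam}|%:R * eta ->
  #|Lam|.-1%:R <= 2 `^ (n%:R * (rate_WZ - d)) ->
  32 * eta + 4 * (spread / d ^+ 2 / n%:R) <= eps / 2 ->
  exists c : Defs.code n R0 0 0,
  [/\ prob_dec1 c P true <= eps, prob_dec2 c P true <= eps,
      prob_dec1 c (alt_law P) false <= 9 * 2 `^ (- (n%:R * (exponent1 - d))) &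
      prob_dec2 c (alt_law P) false <= 2 `^ (- (n%:R * (exponent2 - d)))].
Proof.
move=> I0 J0 hcard d0 eta0 eps0 hI hN hL herr.
pose D1 v w y z := ratio_test pn VW Y1n Z1n (n%:R * (exponent1 - d)) (v, w) y z &&
   list_test (n%:R * (rate_WZ - d)) v w z.
pose D2 v y z := ratio_test pn V Y2n Z2n (n%:R * (exponent2 - d)) v y z.
pose cA := cover_test (#|I|%:R * eta) (#|I|%:R * #|{: B' * Lam}|%:R * eta).
have nR : 0 < n%:R :> R by rewrite ltr0n.
have yE (C : finType) (f : L -> C) o : fcomp f (Sn o) = fcomp (f \o snd) o.
  by apply/ffunP => i; rewrite !ffunE.
have b1 : \sum_o pn o * (~~ (qVX q (V o) (Xn o) <= qV q (V o) * qX q (Xn o) * (#|I|%:R * eta)))%:R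
   <= fvar v1 x1 (pairRV v1 x1) (fun=> tt) / d ^+ 2 / n%:R.
  apply: (bad4 (c := #|I|%:R * eta) tV tX (tracks_pair tV tX) ttracks d0).
    by rewrite entropy_tt subr0.
  by move=> o _; rewrite qVXE qVE qXE law_tt mulr1.
have b2 : \sum_o pn o * (~~ (q (V o) (W o) (Xn o) <= qVW q (V o) (W o) * qX q (Xn o) * (#|I|%:R * #|{: B' * Lam}|%:R * eta)))%:R
   <= fvar (pairRV v1 w1) x1 (pairRV (pairRV v1 w1) x1) (fun=> tt) / d ^+ 2 / n%:R.
  apply: (bad4 (c := #|I|%:R * #|{: B' * Lam}|%:R * eta) tVW tX (tracks_pair tVW tX) ttracks d0).
    by rewrite entropy_tt subr0.
  by move=> o _; rewrite qVWE qXE law_tt mulr1.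
have b3 : \sum_o pn o * (~~ list_test (n%:R * (rate_WZ - d)) (V o) (W o) (Z1n o))%:R <=
  fvar (pairRV (pairRV v1 w1) z1) v1 (pairRV v1 w1) (pairRV v1 z1)
     / d ^+ 2 / n%:R.
  have tZ : tracks Z1n z1 by exact: tracks_fcomp.
  apply: (bad4 (c := 2 `^ (- (n%:R * (rate_WZ - d)))) (tracks_pair tVW tZ) tV tVW (tracks_pair tV tZ) d0).
    by rewrite ler_powR ?ler1n// /rate_WZ; lra.
  by move=> o o0; apply: contraNN => h; rewrite /list_test -ler_pdivlMl ?powR_gt0// -powRN [leRHS]mulrC.
have b4 := ratio_bad tVW (tracks_fcomp y1) (tracks_fcomp z1) d0.
have b5 := ratio_bad tV (tracks_fcomp y2) (tracks_fcomp z2) d0.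
rewrite -/exponent1 -/D1 in b4; rewrite -/exponent2 in b5.
have or_le (a b : bool) : (~~ (a && b))%:R <= (~~ a)%:R + (~~ b)%:R :> R.
  by case: a; case: b; rewrite /= ?addr0 ?add0r ?lexx ?ler0n// lerDl.
have sumA : \sum_v \sum_w \sum_x (~~ cA v w x)%:R * q v w x <=
   \sum_o pn o * (~~ (qVX q (V o) (Xn o) <= qV q (V o) * qX q (Xn o) * (#|I|%:R * eta)))%:R +
   \sum_o pn o * (~~ (q (V o) (W o) (Xn o) <= qVW q (V o) (W o) * qX q (Xn o) * (#|I|%:R * #|{: B' * Lam}|%:R * eta)))%:R.
  rewrite (sum_q (fun v w x => (~~ cA v w x)%:R)) -big_split/=; apply: ler_sum => o _.
  by rewrite -mulrDr; apply: ler_wpM2l => //; exact: or_le.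
have sum1 : \sum_v \sum_w \sum_s j v w s * (~~ D1 v w (fcomp rvY1 s) (fcomp rvZ1 s))%:R <=
   \sum_o pn o * (~~ ratio_test pn VW Y1n Z1n (n%:R * (exponent1 - d)) (V o, W o) (Y1n o) (Z1n o))%:R +
   \sum_o pn o * (~~ list_test (n%:R * (rate_WZ - d)) (V o) (W o) (Z1n o))%:R.
  rewrite (sum_j (fun v w s => (~~ D1 v w (fcomp rvY1 s) (fcomp rvZ1 s))%:R)) -big_split/=.
  by apply: ler_sum => o _; rewrite -mulrDr !yE; apply: ler_wpM2l => //; exact: or_le.
have sum2 : \sum_v \sum_w \sum_s j v w s * (~~ D2 v (fcomp rvY2 s) (fcomp rvZ2 s))%:R =
   \sum_o pn o * (~~ D2 (V o) (Y2n o) (Z2n o))%:R.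
  rewrite (sum_j (fun v w s => (~~ D2 v (fcomp rvY2 s) (fcomp rvZ2 s))%:R)).
  by apply: eq_bigr => o _; rewrite !yE.
have herr' : 32 * eta + 4 * \sum_v \sum_w \sum_x (~~ cA v w x)%:R * q v w x
  + 2 * \sum_v \sum_w \sum_s j v w s * (~~ D1 v w (fcomp rvY1 s) (fcomp rvZ1 s))%:R
  + 2 * \sum_v \sum_w \sum_s j v w s * (~~ D2 v (fcomp rvY2 s) (fcomp rvZ2 s))%:R <= eps / 2.
  apply: le_trans herr; rewrite sum2.
  have v0 g : 0 <= fvariance p g / d ^+ 2 / n%:R.
    by apply: divr_ge0 => //; apply: divr_ge0; [exact: fvariance_ge0|exact: sqr_ge0].
  have split5 (u1 u2 u3 u4 u5 f g : R) : (u1 + u2 + u3 + u4 + u5) / f / g =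
    u1 / f / g + u2 / f / g + u3 / f / g + u4 / f / g + u5 / f / g by ring.
  rewrite /spread split5.
  have e4 := v0 (fun t => sl (pairRV (pairRV (pairRV v1 w1) y1) z1) t + sl z1 t
      - sl (pairRV (pairRV v1 w1) z1) t - sl (pairRV y1 z1) t).
  have e5 := v0 (fun t => sl (pairRV (pairRV v1 y2) z2) t + sl z2 t
      - sl (pairRV v1 z2) t - sl (pairRV y2 z2) t).
  have e3 := v0 (fun t => sl (pairRV (pairRV v1 w1) z1) t + sl v1 t - sl (pairRV v1 w1) t - sl (pairRV v1 z1) t).
  apply: union_bound; [exact: sumA|exact: sum1|exact: b1|exact: b2|exact: b3|exact: b4|exact: b5|exact: e3|exact: e4|exact: e5].
have hA1 v w x : cA v w x -> qVX q v x <= qV q v * qX q x * (#|I|%:R * eta) by case/andP.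
have hA2 v w x : cA v w x -> q v w x <= qVW q v w * qX q x * (#|I|%:R * #|{: B' * Lam}|%:R * eta) by case/andP.
have hK1 v w (z : {ffun 'I_n -> Z1}) : \sum_(y : {ffun 'I_n -> Y1})
  (\prod_i (law P (pairRV rvY1 rvZ1) (y i, z i) / law P rvZ1 (z i))) * (D1 v w y z)%:R
  <= 2 `^ (- (n%:R * (exponent1 - d))) * (list_test (n%:R * (rate_WZ - d)) v w z)%:R.
  rewrite /D1; case: list_test; last first.
    by rewrite mulr0 big1// => y _; rewrite andbF mulr0.
  rewrite mulr1; apply: le_trans (ratio_test_le VW Y1n Z1n _ (v, w) z pn0).
  by apply: ler_sum => y _; rewrite andbT letter_ratio.
have hK2 v (z : {ffun 'I_n -> Z2}) : \sum_(y : {ffun 'I_n -> Y2})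
  (\prod_i (law P (pairRV rvY2 rvZ2) (y i, z i) / law P rvZ2 (z i))) * (D2 v y z)%:R
  <= 2 `^ (- (n%:R * (exponent2 - d))).
  apply: le_trans (ratio_test_le V Y2n Z2n _ v z pn0).
  by apply: ler_sum => y _; rewrite letter_ratio.
have hl : #|Lam|.-1%:R * \sum_v \sum_w' \sum_s
  qW_V q v w' * (\sum_w j v w s) * (list_test (n%:R * (rate_WZ - d)) v w' (fcomp rvZ1 s))%:R <= 1.
  apply: le_trans (ler_wpM2l _ (list_test_le _)) _ => //.
  by rewrite powRN ler_pdivrMr ?powR_gt0// mul1r.
exact: (one_shot_code hP q0 q_total q_source I0 J0 hcard eta0 hA1 hA2 q_jE
  (powR_ge0 _ _) (powR_ge0 _ _) eps0 hK1 hK2 herr' hl).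
Qed.

End NLetter.

(** * Codes of all block lengths under a strict rate inequality *)

Section Achievability.
Context {R : realType} {X Y1 Y2 Z1 Z2 A B : finType}.
Local Notation L := (letter X Y1 Y2 Z1 Z2).
Variables (P : L -> R) (k : X -> A * B -> R) (R0 : R).
Hypotheses (hP : is_pmf P) (hk : is_kernel k).

(** Always deciding 0 makes no type I error. This fills the finitely many lengths that are too short
    for the random code, and attains the zero exponents. *)
Lemma trivial_code (n : nat) (eps : R) : 0 < eps -> exists c : Defs.code n R0 0 0,
  prob_dec1 c P true <= eps /\ prob_dec2 c P true <= eps.
Proof.
move=> e0.
have hE (x : {ffun 'I_n -> X}) : is_pmf
   (fun m : (message n R0 * message n (0 : R) * message n (0 : R))%type =>
     (m == (ord0, ord0, ord0))%:R : R).
  split=> [m|]; first exact: ler0n.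
  by rewrite (bigD1 (ord0, ord0, ord0))//= ?eqxx big1 ?addr0// => m /negbTE ->.
exists (Defs.Code hE (fun _ _ _ _ => false) (fun _ _ _ _ => false)).
rewrite /prob_dec1 /prob_dec2 /=; split; rewrite big1 ?(ltW e0)// => s _;
  by rewrite big_pred0.
Qed.

Lemma ler_powR2 (r s : R) : r <= s -> 2 `^ r <= 2 `^ s.
Proof. by move=> h; rewrite ler_powR// ler1n. Qed.

Lemma powR2D (r s : R) : 2 `^ (r + s) = 2 `^ r * 2 `^ s.
Proof. by rewrite powRD// pnatr_eq0 implybT. Qed.

(** A crude decay of order [1/n], from [1 + x <= exp x], matches that of the Chebyshev terms. *)
Lemma powR2N_le (r : R) : 0 < r -> 2 `^ (- r) <= (r * ln 2)^-1.
Proof.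
move=> r0; have rl : 0 < r * ln 2 by rewrite mulr_gt0// ln2_gt0.
rewrite powRN lef_pV2 ?posrE ?powR_gt0//.
rewrite /powR pnatr_eq0/=; apply: le_trans (expR_ge1Dx _).
by rewrite lerDr.
Qed.

Lemma card_ord_powR (r : R) : 2 `^ r <= #|'I_(Num.truncn (2 `^ r)).+1|%:R.
Proof. by rewrite card_ord ltW// truncnS_gt. Qed.

Lemma card_ord_powR_le (r : R) : 0 <= r ->
  #|'I_(Num.truncn (2 `^ r)).+1|%:R <= 2 * 2 `^ r :> R.
Proof.
move=> r0; rewrite card_ord -natr1 [2 * _]mulr_natl mulr2n lerD//.
  by rewrite truncn_le// powR_ge0.
by rewrite -[leLHS](powRr0 2) ler_powR2.
Qed.

Lemma achievable_kernel (t1 t2 ib eps : R) :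
  0 <= rate_VX P k -> 0 <= ib -> rate_VWX P k <= rate_VX P k + ib + rate_WZ P k ->
  rate_VX P k + ib < R0 -> t1 < exponent1 P k -> t2 < exponent2 P k ->
  0 < eps < 1 -> achievable P eps t1 t2 R0 0 0.
Proof.
move=> a0 ib0 hrate hR0 ht1 ht2 /andP[eps0 _].
have [d [d0 dR d1 d2]] : exists d : R, [/\ 0 < d, rate_VX P k + ib + 8 * d <= R0,
    t1 + 2 * d <= exponent1 P k & t2 + 2 * d <= exponent2 P k].
  exists (Num.min ((R0 - (rate_VX P k + ib)) / 8)
     (Num.min ((exponent1 P k - t1) / 2) ((exponent2 P k - t2) / 2))).
  set d := Num.min _ _.
  have h1 : d <= (R0 - (rate_VX P k + ib)) / 8 by rewrite ge_min lexx.
  have h2 : d <= (exponent1 P k - t1) / 2 by rewrite /d !ge_min lexx/= orbT.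
  have h3 : d <= (exponent2 P k - t2) / 2 by rewrite /d !ge_min lexx !orbT.
  split; try lra.
  by rewrite !lt_min !divr_gt0 ?subr_gt0.
have l2 := @ln2_gt0 R.
have sp0 : 0 <= spread P k by rewrite !addr_ge0// fvariance_ge0//; exact: kjoint_pmf.
(* [M / n] bounds the covering and Chebyshev terms, [2^(-nd)] being at most [1 / (n d ln 2)]. *)
pose M := 32 / (d * ln 2) + 4 * (spread P k / d ^+ 2).
have M0 : 0 <= M.
  rewrite addr_ge0//; first by rewrite divr_ge0// mulr_ge0// ltW.
  by rewrite mulr_ge0// divr_ge0// exprn_ge0// ltW.
pose N := (Num.truncn (4 / d + M * 2 / eps)).+1.
have main n : (0 < n)%N -> (N <= n)%N -> exists c : Defs.code n R0 0 0,
  [/\ prob_dec1 c P true <= eps, prob_dec2 c P true <= eps,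
      prob_dec1 c (alt_law P) false <= 2 `^ (- (n%:R * t1)) &
      prob_dec2 c (alt_law P) false <= 2 `^ (- (n%:R * t2))].
  move=> n0 Nn; have nR : 0 < n%:R :> R by rewrite ltr0n.
  have nN : 4 / d + M * 2 / eps <= n%:R.
    by apply: (@le_trans _ _ N%:R); [rewrite ltW// truncnS_gt|rewrite ler_nat].
  have M1 : 0 <= M * 2 / eps by rewrite divr_ge0 ?mulr_ge0// ltW.
  have nd : 4 <= n%:R * d.
    by rewrite -ler_pdivrMr//; apply: le_trans nN; rewrite lerDl.
  have nM : M / n%:R <= eps / 2.
    have : M * 2 / eps <= n%:R.
      by apply: le_trans nN; rewrite lerDr divr_ge0// ltW.
    by rewrite !ler_pdivrMr//; lra.
  have nd0 : 0 < n%:R * d by rewrite mulr_gt0.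
  (* Centres get [2d] above their rate, bins [2d] above [ib], lists [d] below [I(W; Z1 | V)]. After
     the loss of [d] to [eta] both covering conditions keep a margin of at least [d]; the [4d] spent
     and the roundings fit into the [8d] reserved, as [n d >= 4]. *)
  have := @n_letter_code R X Y1 Y2 Z1 Z2 A B P k n R0 hP hk n0
    'I_(Num.truncn (2 `^ (n%:R * (rate_VX P k + 2 * d)))).+1
    'I_(Num.truncn (2 `^ (n%:R * (ib + 2 * d)))).+1
    'I_(Num.truncn (2 `^ (n%:R * (rate_WZ P k - d)))).+1 d (2 `^ (- (n%:R * d))) eps.
  case.
  - by rewrite card_ord.
  - by rewrite card_prod !card_ord.
  - rewrite -(ler_nat R) card_prod natrM.
    apply: (@le_trans _ _ (2 `^ (n%:R * R0))); last first.
      by rewrite card_ord ltW// truncnS_gt.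
    have r1 : 0 <= n%:R * (rate_VX P k + 2 * d) by rewrite mulr_ge0//; lra.
    have r2 : 0 <= n%:R * (ib + 2 * d) by rewrite mulr_ge0//; lra.
    apply: (le_trans (ler_pM (ler0n _ _) (ler0n _ _) (card_ord_powR_le r1) (card_ord_powR_le r2))).
    have e4 : 2 * 2 = 2 `^ 2 :> R by rewrite (powR_mulrn 2)// expr2.
    rewrite mulrACA -powR2D e4 -powR2D.
    apply: ler_powR2.
    have : n%:R * (rate_VX P k + ib + 8 * d) <= n%:R * R0 by rewrite ler_wpM2l// ltW.
    by move: nd; lra.
  - exact: d0.
  - exact: powR_ge0.
  - exact: eps0.
  - apply: le_trans (ler_wpM2r _ (card_ord_powR _)); last exact: powR_ge0.
    by rewrite -powR2D; apply: ler_powR2; lra.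
  - rewrite card_prod natrM.
    have h : 2 `^ (n%:R * (rate_VX P k + 2 * d)) * (2 `^ (n%:R * (ib + 2 * d)) * 2 `^ (n%:R * (rate_WZ P k - d)))
       * 2 `^ (- (n%:R * d)) <= 
      #|'I_(Num.truncn (2 `^ (n%:R * (rate_VX P k + 2 * d)))).+1|%:R *
      (#|'I_(Num.truncn (2 `^ (n%:R * (ib + 2 * d)))).+1|%:R *
       #|'I_(Num.truncn (2 `^ (n%:R * (rate_WZ P k - d)))).+1|%:R) * 2 `^ (- (n%:R * d)).
      apply: ler_wpM2r; first exact: powR_ge0.
      apply: ler_pM; rewrite ?mulr_ge0 ?powR_ge0 ?card_ord_powR//.
      by apply: ler_pM; rewrite ?powR_ge0 ?card_ord_powR.
    apply: le_trans h; rewrite -!powR2D; apply: ler_powR2.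
    have : n%:R * rate_VWX P k <= n%:R * (rate_VX P k + ib + rate_WZ P k) by rewrite ler_wpM2l// ltW.
    by move: nd0; lra.
  - by rewrite card_ord/= truncn_le// powR_ge0.
  - apply: le_trans nM.
    have h := powR2N_le nd0.
    apply: (@le_trans _ _ (32 * (n%:R * d * ln 2)^-1 + 4 * (spread P k / d ^+ 2 / n%:R))).
      by rewrite lerD2r ler_wpM2l.
    rewrite le_eqVlt; apply/orP; left; apply/eqP; rewrite /M; field.
    by rewrite !gt_eqF.
  move=> c [c1 c2 c3 c4]; exists c; split=> //.
    apply: le_trans c3 _.
    (* The factor 9 is absorbed by one of the two [d] kept in reserve: [n d >= 4] gives
       [2^(nd) >= 16]. *)
    have h16 : 9 <= 2 `^ (n%:R * d) :> R.
      apply: le_trans (ler_powR2 nd).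
      by rewrite (powR_mulrn 4)//; rewrite -natrX ler_nat.
    apply: le_trans (ler_wpM2r _ h16) _; first exact: powR_ge0.
    rewrite -powR2D; apply: ler_powR2.
    have : n%:R * (t1 + 2 * d) <= n%:R * exponent1 P k by rewrite ler_wpM2l// ltW.
    by lra.
  apply: le_trans c4 _; apply: ler_powR2.
  have : n%:R * (t2 + 2 * d) <= n%:R * exponent2 P k by rewrite ler_wpM2l// ltW.
  by move: nd0; lra.
have all n : exists c : Defs.code n R0 0 0,
  [/\ prob_dec1 c P true <= eps, prob_dec2 c P true <= eps,
      (N <= n)%N -> (0 < n)%N -> prob_dec1 c (alt_law P) false <= 2 `^ (- (n%:R * t1)) &
      (N <= n)%N -> (0 < n)%N -> prob_dec2 c (alt_law P) false <= 2 `^ (- (n%:R * t2))].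
  have [Nn|nN] := leqP N n; last first.
    have [c [c1 c2]] := trivial_code n eps0.
    by exists c; split=> // Nn; move: nN; rewrite ltnNge Nn.
  have n0 : (0 < n)%N by exact: leq_trans Nn.
  by have [c [c1 c2 c3 c4]] := main n n0 Nn; exists c; split.
exists (fun n => sval (cid (all n))); split=> [n n0|n n0||].
- by have [] := svalP (cid (all n)).
- by have [] := svalP (cid (all n)).
- apply: (@error_exponent_ge _ _ _ N) => n Nn n0.
  by have [_ _ h _] := svalP (cid (all n)); exact: h.
- apply: (@error_exponent_ge _ _ _ N) => n Nn n0.
  by have [_ _ _ h] := svalP (cid (all n)); exact: h.
Qed.

End Achievability.

Ltac same_info_cases := apply: entropy_determines => //;
  first [move=> [[[? ?] ?] ?] [[[? ?] ?] ?] _ _ | move=> [[? ?] ?] [[? ?] ?] _ _];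
  rewrite /pairRV /v1 /w1 /x1 /y1 /y2 /z1 /z2 /=; intros; congruence.

(** * Rates and exponents of a kernel *)

Section Rates.
Context {R : realType} {X Y1 Y2 Z1 Z2 : finType}.
Local Notation L := (letter X Y1 Y2 Z1 Z2).
Variable P : L -> R.
Hypothesis hP : is_pmf P.

(** Entropies inherit a factorisation of the laws that holds on the support; in the applications it
    expresses conditional independence. *)
Lemma entropy_balance (W A B C D : finType) (p : W -> R)
    (f : W -> A) (g : W -> B) (h : W -> C) (k : W -> D) : (forall w, 0 <= p w) ->
  (forall w, p w != 0 -> law p f (f w) * law p g (g w) = law p h (h w) * law p k (k w)) ->
  entropy p f + entropy p g = entropy p h + entropy p k.
Proof.
move=> p0 H; rewrite !entropyE -!opprD -!big_split/=; congr (- _).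
apply: eq_bigr => w _; have [->|w0] := eqVneq (p w) 0; first by rewrite !mul0r.
have pos (E : finType) (F : W -> E) : 0 < law p F (F w).
  rewrite /law (bigD1 w)//= ltr_wpDr ?sumr_ge0//.
  by rewrite lt_neqAle eq_sym w0 p0.
by rewrite -!mulrDr -!log2M// H.
Qed.

(** This is [I(U; L | X) = 0], from the product form of [kjoint]. *)
Lemma mi_diff_source (U : finType) (k : X -> U -> R) : is_kernel k ->
  mi_diff (kjoint rvX P k) fst snd (rvX \o snd) = 0.
Proof.
move=> hk; have p0 : forall w, 0 <= kjoint rvX P k w by exact: kjoint_ge0.
have := @entropy_balance _ _ _ _ _ (kjoint rvX P k) snd (pairRV fst (rvX \o snd))
   (rvX \o snd) (pairRV fst snd) p0.
rewrite /mi_diff => H; suff /H : forall w, kjoint rvX P k w != 0 ->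
  law (kjoint rvX P k) snd w.2 * law (kjoint rvX P k) (pairRV fst (rvX \o snd)) (w.1, rvX w.2)
  = law (kjoint rvX P k) (rvX \o snd) (rvX w.2) * law (kjoint rvX P k) (pairRV fst snd) (w.1, w.2).
  by lra.
move=> [u l] _ /=.
have -> := law_kjoint_snd rvX P hk rvX.
have -> : law (kjoint rvX P k) snd l = P l by have [] := aux_extension_kjoint rvX hP hk.
have -> : law (kjoint rvX P k) (pairRV fst (rvX \o snd)) (u, rvX l) = k (rvX l) u * law P rvX (rvX l).
  by rewrite (law_kjoint2 _ _ _ id); congr (_ * _); rewrite /law big_pred1_eq.
have -> : law (kjoint rvX P k) (pairRV fst snd) (u, l) = P l * k (rvX l) u.
  by rewrite /law (big_pred1 (u, l))// => -[].
by ring.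
Qed.

Section Kernel.
Context {A B : finType}.
Variable k : X -> A * B -> R.
Hypothesis hk : is_kernel k.
Local Notation p := (kjoint rvX P k).
Local Notation T := (A * B * L)%type.

Let hp : is_pmf p. Proof. exact: kjoint_pmf. Qed.
Let p0 t : 0 <= p t. Proof. by case: hp. Qed.

(* [I(W; X | V, Z1)] *)
Definition bin_rate : R := mi_diff p fst (pairRV rvX rvZ1 \o snd) (rvZ1 \o snd)
  - mi_diff p (fst \o fst) (pairRV rvX rvZ1 \o snd) (rvZ1 \o snd).

Lemma rate_VXE : rate_VX P k = mi_diff p (fst \o fst) (rvX \o snd) ((fun=> tt) \o snd).
Proof.
rewrite /rate_VX /mi_diff [entropy p ((fun=> tt) \o snd)](entropy_cst (proj2 hp)).
have -> : entropy p (pairRV (fst \o fst) ((fun=> tt) \o snd)) = entropy p (@v1 X Y1 Y2 Z1 Z2 A B).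
  by apply: entropy_determines => // w w' _ _; [case|rewrite /pairRV /v1/= => ->].
by rewrite -[pairRV v1 x1]/(pairRV (fst \o fst) (rvX \o snd)) -[x1]/(rvX \o snd); ring.
Qed.

Lemma exponent1E : exponent1 P k = mi_diff p fst (pairRV rvY1 rvZ1 \o snd) (rvZ1 \o snd).
Proof.
rewrite /exponent1 /mi_diff.
have -> : entropy p (pairRV (pairRV v1 w1) z1) = entropy p (pairRV fst (rvZ1 \o snd)).
  by same_info_cases.
have -> : entropy p (pairRV (pairRV (pairRV v1 w1) y1) z1) = entropy p (pairRV fst (pairRV rvY1 rvZ1 \o snd)).
  by same_info_cases.
by rewrite -[pairRV y1 z1]/(pairRV rvY1 rvZ1 \o snd) -[z1]/(rvZ1 \o snd); ring.
Qed.

Lemma exponent2E : exponent2 P k = mi_diff p (fst \o fst) (pairRV rvY2 rvZ2 \o snd) (rvZ2 \o snd).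
Proof.
rewrite /exponent2 /mi_diff.
have -> : entropy p (pairRV (pairRV v1 y2) z2) = entropy p (pairRV (fst \o fst) (pairRV rvY2 rvZ2 \o snd)).
  by same_info_cases.
by rewrite -[pairRV v1 z2]/(pairRV (fst \o fst) (rvZ2 \o snd))
 -[pairRV y2 z2]/(pairRV rvY2 rvZ2 \o snd) -[z2]/(rvZ2 \o snd); ring.
Qed.

(** [I(W; X | V)] is at most [I(W; X, Z1 | V)], which the chain rule splits into [I(W; Z1 | V)],
    supplied by the side information of Receiver 1, and the bin rate. *)
Lemma rate_VWX_le : rate_VWX P k <= rate_VX P k + bin_rate + rate_WZ P k.
Proof.
rewrite /rate_VWX /rate_VX /bin_rate /rate_WZ /mi_diff.
have -> : entropy p (pairRV fst (rvZ1 \o snd)) = entropy p (pairRV (pairRV v1 w1) z1).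
  by same_info_cases.
rewrite -[pairRV (fst \o fst) (rvZ1 \o snd)]/(pairRV v1 z1).
have := entropy_submod z1 w1 (pairRV v1 x1) p0.
have -> : entropy p (pairRV (pairRV z1 w1) (pairRV v1 x1)) = entropy p (pairRV fst (pairRV rvX rvZ1 \o snd)).
  by same_info_cases.
have -> : entropy p (pairRV z1 (pairRV v1 x1)) = entropy p (pairRV (fst \o fst) (pairRV rvX rvZ1 \o snd)).
  by same_info_cases.
have -> : entropy p (pairRV w1 (pairRV v1 x1)) = entropy p (pairRV (pairRV v1 w1) x1).
  by same_info_cases.
by lra.
Qed.

Lemma bin_rate_ge0 : 0 <= bin_rate.
Proof.
rewrite /bin_rate subr_ge0; apply: mi_diff_monoU => //.
- by move=> w w' _ _ [].
- by move=> w w' _ _ /= ->.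
Qed.

Lemma rate_VX_ge0 : 0 <= rate_VX P k.
Proof. by rewrite rate_VXE; apply: mi_diff_ge0. Qed.

Let source_V : mi_diff p (fst \o fst) snd (rvX \o snd) = 0.
Proof.
apply/eqP; rewrite eq_le -{1}(mi_diff_source hk); apply/andP; split.
  apply: mi_diff_monoU => //; first by move=> w w' _ _ /= ->.
  by move=> w w' _ _ /= ->.
by apply: mi_diff_ge0 => // w w' _ _ /= ->.
Qed.

Let mono_f (U C D E : finType) (u : T -> U) (f : T -> C) (f' : T -> D) (g : T -> E) :
  determines p f' f -> mi_diff p u f g <= mi_diff p u f' g.
Proof. by move=> ff; rewrite [leRHS](mi_diffD _ _ _ f) lerDr mi_diff_ge0. Qed.

(** Data processing. Together with [exponent1_le] it forces both exponents to vanish when the rate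
    is zero. *)
Lemma exponent2_le : exponent2 P k <= rate_VX P k.
Proof.
rewrite exponent2E rate_VXE.
have dS (C : finType) (f : L -> C) : determines p snd (f \o snd) by move=> w w' _ _ /= ->.
apply: le_trans (mono_f (fst \o fst) (rvZ2 \o snd) (dS _ (pairRV rvY2 rvZ2))) _.
rewrite (mi_diffD _ _ snd (rvX \o snd)) source_V add0r.
rewrite [leRHS](mi_diffD _ _ _ (rvZ2 \o snd)) lerDl.
exact: mi_diff_ge0.
Qed.

Lemma exponent1_le : exponent1 P k <= rate_VX P k + bin_rate.
Proof.
rewrite exponent1E rate_VXE /bin_rate.
have dS (C : finType) (f : L -> C) : determines p snd (f \o snd) by move=> w w' _ _ /= ->.
have h1 : mi_diff p fst (pairRV rvY1 rvZ1 \o snd) (rvZ1 \o snd) <=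
    mi_diff p fst (pairRV rvX rvZ1 \o snd) (rvZ1 \o snd).
  apply: le_trans (mono_f fst (rvZ1 \o snd) (dS _ (pairRV rvY1 rvZ1))) _.
  rewrite (mi_diffD _ _ snd (rvX \o snd)) mi_diff_source// add0r.
  by apply: mono_f => w w' _ _ [].
have h2 : mi_diff p (fst \o fst) (pairRV rvX rvZ1 \o snd) (rvZ1 \o snd) <=
    mi_diff p (fst \o fst) (rvX \o snd) ((fun=> tt) \o snd).
  apply: (@le_trans _ _ (mi_diff p (fst \o fst) (pairRV rvX rvZ1 \o snd) ((fun=> tt) \o snd))).
    rewrite [leRHS](mi_diffD _ _ _ (rvZ1 \o snd)) lerDl; exact: mi_diff_ge0.
  apply: le_trans (mono_f (fst \o fst) ((fun=> tt) \o snd) (dS _ (pairRV rvX rvZ1))) _.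
  by rewrite (mi_diffD _ _ snd (rvX \o snd)) source_V add0r.
by lra.
Qed.

End Kernel.

Section ErasedKernel.
Context {A B : finType}.
Variables (k : X -> A * B -> R) (tau : R).
Hypotheses (hk : is_kernel k) (htau : 0 <= tau <= 1).

(** One coin erases [V] and [W] together, so that [rate_VX], [bin_rate] and both exponents are
    multiplied by the same [tau]. *)
Definition erase (eu : bool * (A * B)) : option A * option B :=
  if eu.1 then (Some eu.2.1, Some eu.2.2) else (None, None).

Definition erased_kernel (x : X) : option A * option B -> R :=
  law (mixed_kernel k tau x) erase.

Lemma erased_kernelP : is_kernel erased_kernel.
Proof. by apply: law_kernel; exact: mixed_kernelP. Qed.

Let q0 w : 0 <= kjoint rvX P (mixed_kernel k tau) w.
Proof. by apply: kjoint_ge0 => //; exact: mixed_kernelP. Qed.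
Let p0 w : 0 <= kjoint rvX P k w. Proof. exact: kjoint_ge0. Qed.

Lemma mi_diff_erasedV (C D : finType) (f : L -> C) (g : L -> D) :
  mi_diff (kjoint rvX P erased_kernel) (fst \o fst) (f \o snd) (g \o snd) =
  tau * mi_diff (kjoint rvX P k) (fst \o fst) (f \o snd) (g \o snd).
Proof.
rewrite kjoint_law mi_diff_law -(mi_diff_erasure rvX hP hk htau fst).
apply: eq_mi_diff => // -[[e u] l] [[e' u'] l'] _ _; rewrite /erase/=;
  by case: e; case: e' => //= -[->].
Qed.

Lemma mi_diff_erasedVW (C D : finType) (f : L -> C) (g : L -> D) :
  mi_diff (kjoint rvX P erased_kernel) fst (f \o snd) (g \o snd) =
  tau * mi_diff (kjoint rvX P k) fst (f \o snd) (g \o snd).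
Proof.
rewrite kjoint_law mi_diff_law -(mi_diff_erasure rvX hP hk htau id).
apply: eq_mi_diff => // -[[e [a b]] l] [[e' [a' b']] l'] _ _; rewrite /erase/=;
  by case: e; case: e' => //= -[-> ->].
Qed.

Lemma achievable_erased (R0 t1 t2 eps : R) :
  tau * (rate_VX P k + bin_rate k) < R0 -> t1 < tau * exponent1 P k ->
  t2 < tau * exponent2 P k -> 0 < eps < 1 -> achievable P eps t1 t2 R0 0 0.
Proof.
move=> hR h1 h2 he.
have hk' := erased_kernelP.
apply: (@achievable_kernel R X Y1 Y2 Z1 Z2 _ _ P erased_kernel R0 hP hk' t1 t2 (bin_rate erased_kernel) eps) => //.
- exact: rate_VX_ge0.
- exact: bin_rate_ge0.
- exact: rate_VWX_le.
- rewrite rate_VXE// /bin_rate !mi_diff_erasedV mi_diff_erasedVW.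
  by move: hR; rewrite rate_VXE// /bin_rate; lra.
- by rewrite exponent1E// mi_diff_erasedVW -exponent1E.
- by rewrite exponent2E// mi_diff_erasedV -exponent2E.
Qed.

End ErasedKernel.
End Rates.

(** * From the inner region to codes *)

Section MarkovKernel.
Context {R : realType} {L X U D : finType}.
Variables (x : L -> X) (y : L -> D) (P : L -> R) (p : U * L -> R).
Hypotheses (hP : is_pmf P) (hp : is_pmf p) (hpP : forall l, law p snd l = P l).

(** [x] and [y] together identify the letter, so the Markov chain factorises the law of auxiliary
    and letter itself. *)
Lemma markov_kernel : (forall l l', x l = x l' -> y l = y l' -> l = l') ->
  markov_chain p fst (x \o snd) (y \o snd) ->
  exists2 k : X -> U -> R, is_kernel k & p = kjoint x P k.
Proof.
move=> xy mk; have [p0 p1] := hp; have [P0 P1] := hP.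
have lawsnd (A : finType) (f : L -> A) : law p (f \o snd) = law P f.
  by rewrite -law_comp; congr law; exact/funext.
(* Symbols of probability zero get the marginal law of the auxiliary, so that the kernel is a pmf at
   every symbol. *)
pose k a u := if law P x a == 0 then law p fst u else law p (pairRV fst (x \o snd)) (u, a) / law P x a.
exists k.
  move=> a; split=> [u|]; rewrite /k; first by case: ifP => _; rewrite ?divr_ge0 ?law_ge0.
  have [_|a0] := eqVneq (law P x a) 0; first by rewrite sum_law1.
  by rewrite -mulr_suml -(law_suml p fst) lawsnd divff.
apply/funext => -[u l]; rewrite /kjoint/= /k.
have single (A : finType) (f : U * L -> A) : injective f -> law p f (f (u, l)) = p (u, l).
  by move=> fi; rewrite /law (eq_bigl (pred1 (u, l))) ?big_pred1_eq// => w; rewrite (inj_eq fi).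
have pP : p (u, l) <= P l.
  by rewrite -hpP /law (bigD1 (u, l))//= lerDl sumr_ge0.
have Px : P l <= law P x (x l) by rewrite /law (bigD1 l)//= lerDl sumr_ge0.
case: ifPn => [/eqP x0|x0].
  have Pl : P l = 0 by apply/eqP; rewrite eq_le P0 -x0 Px.
  by rewrite Pl mul0r; apply/eqP; rewrite eq_le p0 -[leRHS]Pl pP.
have := mk u (x l) (y l).
rewrite -[(u, x l, y l)]/(pairRV (pairRV fst (x \o snd)) (y \o snd) (u, l)) single; last first.
  by move=> [u1 l1] [u2 l2] [-> /xy h /h ->].
rewrite -[pairRV (x \o snd) (y \o snd)]/(pairRV x y \o snd) !lawsnd.
have -> : law P (pairRV x y) (x l, y l) = P l.
  rewrite /law (eq_bigl (pred1 l)) ?big_pred1_eq// => l'; apply/eqP/eqP => [[e1 e2]|->//].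
  exact: xy.
by move=> e; rewrite mulrA [P l * _]mulrC -e mulfK.
Qed.

End MarkovKernel.

(* Only the laws of [(U0, U1, X)] and [(U0, U2, X)] enter the inner region, so
   that [U1] and [U2] may be taken independent given [(U0, X)]. *)
Section Decoupling.
Context {R : realType} {X Y1 Y2 Z1 Z2 A0 A1 A2 : finType}.
Local Notation L := (letter X Y1 Y2 Z1 Z2).
Variables (P : L -> R) (k : X -> A0 * A1 * A2 -> R).
Hypotheses (hP : is_pmf P) (hk : is_kernel k).

Let u02 (u : A0 * A1 * A2) := (u.1.1, u.2).
Let r01 (u : A0 * A2 * A1) := (u.1.1, u.2).

Definition decoupled_kernel (a : X) (u : A0 * A2 * A1) : R :=
  law (k a) fst (r01 u) * law (k a) u02 u.1 / law (k a) (fst \o fst) u.1.1.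

Let k0 a u : 0 <= k a u. Proof. by case: (hk a). Qed.

Let sum1 a u0 : \sum_u1 law (k a) fst (u0, u1) = law (k a) (fst \o fst) u0.
Proof.
rewrite (law_sumr _ (fst \o fst) (snd \o fst)); apply: eq_bigr => u1 _.
by apply: eq_bigl => -[[? ?] ?].
Qed.

Let sum2 a u0 : \sum_u2 law (k a) u02 (u0, u2) = law (k a) (fst \o fst) u0.
Proof. by rewrite (law_sumr _ (fst \o fst) snd). Qed.

Let zero1 a u0 u1 : law (k a) (fst \o fst) u0 = 0 -> law (k a) fst (u0, u1) = 0.
Proof.
rewrite -sum1 => /eqP; rewrite psumr_eq0; last by move=> *; exact: law_ge0.
by move=> /allP/(_ u1); rewrite mem_index_enum => /(_ isT)/eqP.
Qed.

Let zero2 a u0 u2 : law (k a) (fst \o fst) u0 = 0 -> law (k a) u02 (u0, u2) = 0.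
Proof.
rewrite -sum2 => /eqP; rewrite psumr_eq0; last by move=> *; exact: law_ge0.
by move=> /allP/(_ u2); rewrite mem_index_enum => /(_ isT)/eqP.
Qed.

Lemma law_decoupled02 a : law (decoupled_kernel a) fst = law (k a) u02.
Proof.
apply/funext => -[u0 u2]; rewrite (law_sumr _ fst snd).
rewrite (eq_bigr (fun u1 => law (k a) fst (u0, u1) * (law (k a) u02 (u0, u2) / law (k a) (fst \o fst) u0))).
  rewrite -mulr_suml sum1.
  have [z|z] := eqVneq (law (k a) (fst \o fst) u0) 0; first by rewrite z mul0r zero2.
  by rewrite mulrC divfK.
move=> u1 _; rewrite /law (big_pred1 ((u0, u2), u1)); last by move=> [].
by rewrite /decoupled_kernel/= mulrA.
Qed.

Lemma law_decoupled01 a : law (decoupled_kernel a) r01 = law (k a) fst.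
Proof.
apply/funext => -[u0 u1]; rewrite (law_sumr _ r01 (snd \o fst)).
rewrite (eq_bigr (fun u2 => law (k a) u02 (u0, u2) * (law (k a) fst (u0, u1) / law (k a) (fst \o fst) u0))).
  rewrite -mulr_suml sum2.
  have [z|z] := eqVneq (law (k a) (fst \o fst) u0) 0; first by rewrite z mul0r zero1.
  by rewrite mulrC divfK.
move=> u2 _; rewrite /law (big_pred1 ((u0, u2), u1)).
  by rewrite /decoupled_kernel/= mulrA [_ * law (k a) u02 _]mulrC.
by move=> [[v0 v2] v1]; rewrite /pairRV /r01/= !xpair_eqE/= andbAC.
Qed.

Lemma law_decoupled0 a : law (decoupled_kernel a) (fst \o fst) = law (k a) (fst \o fst).
Proof. by rewrite -law_comp law_decoupled02 law_comp. Qed.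

Lemma decoupled_kernelP : is_kernel decoupled_kernel.
Proof.
move=> a; split=> [u|]; first by rewrite /decoupled_kernel divr_ge0 ?mulr_ge0 ?law_ge0.
by rewrite -(sum_law1 _ fst) law_decoupled02 sum_law1; case: (hk a).
Qed.

Local Notation q := (kjoint rvX P decoupled_kernel).
Local Notation p := (kjoint rvX P k).

Let q0 w : 0 <= q w. Proof. by apply: kjoint_ge0 => //; exact: decoupled_kernelP. Qed.

Let transfer (U : finType) (r : A0 * A2 * A1 -> U) (r' : A0 * A1 * A2 -> U) :
  (forall a, law (decoupled_kernel a) r = law (k a) r') ->
  forall (C D : finType) (f : L -> C) (g : L -> D),
  mi_diff q (r \o fst) (f \o snd) (g \o snd) = mi_diff p (r' \o fst) (f \o snd) (g \o snd).
Proof.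
move=> e C D f g.
have h : law q (fun w => (r w.1, w.2)) = law p (fun w => (r' w.1, w.2)).
  by rewrite -!kjoint_law; congr kjoint; apply/funext.
rewrite -[LHS](mi_diff_law q (fun w => (r w.1, w.2)) fst (f \o snd) (g \o snd)).
by rewrite h mi_diff_law.
Qed.

Lemma mi_diff_decoupled01 (C D : finType) (f : L -> C) (g : L -> D) :
  mi_diff q (r01 \o fst) (f \o snd) (g \o snd) = mi_diff p (fst \o fst) (f \o snd) (g \o snd).
Proof. exact: transfer law_decoupled01 _ _ _ _. Qed.

Lemma mi_diff_decoupled02 (C D : finType) (f : L -> C) (g : L -> D) :
  mi_diff q (fst \o fst) (f \o snd) (g \o snd) = mi_diff p (u02 \o fst) (f \o snd) (g \o snd).
Proof. exact: transfer law_decoupled02 _ _ _ _. Qed.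

Lemma mi_diff_decoupled0 (C D : finType) (f : L -> C) (g : L -> D) :
  mi_diff q (fst \o fst \o fst) (f \o snd) (g \o snd) = mi_diff p (fst \o fst \o fst) (f \o snd) (g \o snd).
Proof. exact: transfer law_decoupled0 _ _ _ _. Qed.

(** Here [V = (U0, U2)] and [W = U1]. Given [(U0, X, Z1)] the decoupled [U1] is independent of [U2],
    so further conditioning on [U2] leaves the entropy of [U1] given [(U0, X, Z1)] unchanged and can
    only lower the one given [(U0, Z1)]. *)
Lemma bin_rate_decoupled : bin_rate P decoupled_kernel <=
  mi_diff p (fst \o fst) (pairRV rvX rvZ1 \o snd) (rvZ1 \o snd) -
  mi_diff p (fst \o fst \o fst) (pairRV rvX rvZ1 \o snd) (rvZ1 \o snd).
Proof.
rewrite -mi_diff_decoupled01 -mi_diff_decoupled0 /bin_rate.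
have bal : entropy q (pairRV fst (pairRV rvX rvZ1 \o snd)) +
    entropy q (pairRV (fst \o fst \o fst) (pairRV rvX rvZ1 \o snd)) =
    entropy q (pairRV (r01 \o fst) (pairRV rvX rvZ1 \o snd)) +
    entropy q (pairRV (fst \o fst) (pairRV rvX rvZ1 \o snd)).
  have asc (V : finType) (g : A0 * A2 * A1 -> V) v a z :
    law q (pairRV (g \o fst) (pairRV rvX rvZ1 \o snd)) (v, (a, z)) =
    law (decoupled_kernel a) g v * law P (pairRV rvX rvZ1) (a, z).
    rewrite -law_kjoint; apply: eq_bigl => w.
    by rewrite /pairRV !xpair_eqE/= andbA.
  apply: entropy_balance => // -[[[a0 a2] a1] l] _.
  rewrite -[pairRV fst _]/(pairRV (id \o fst) (pairRV rvX rvZ1 \o snd)).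
  rewrite -[pairRV (fst \o fst \o fst) _]/(pairRV ((fst \o fst) \o fst) (pairRV rvX rvZ1 \o snd)).
  rewrite [LHS](_ : _ = law (decoupled_kernel (rvX l)) id ((a0, a2), a1) * law P (pairRV rvX rvZ1) (rvX l, rvZ1 l) *
     (law (decoupled_kernel (rvX l)) (fst \o fst) a0 * law P (pairRV rvX rvZ1) (rvX l, rvZ1 l))); last first.
    by rewrite -!asc.
  rewrite [RHS](_ : _ = law (decoupled_kernel (rvX l)) r01 (a0, a1) * law P (pairRV rvX rvZ1) (rvX l, rvZ1 l) *
     (law (decoupled_kernel (rvX l)) fst (a0, a2) * law P (pairRV rvX rvZ1) (rvX l, rvZ1 l))); last first.
    by rewrite -!asc.
  rewrite mulrACA [RHS]mulrACA; congr (_ * _).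
  rewrite law_decoupled0 law_decoupled01 law_decoupled02 /law (big_pred1 ((a0, a2), a1))//.
  rewrite -!/(law _ _ _) /decoupled_kernel/= /r01/=.
  have [z|z] := eqVneq (law (k (rvX l)) (fst \o fst) a0) 0; first by rewrite z zero1// !mul0r.
  by rewrite divfK.
have := entropy_submod (snd \o fst) (fst \o fst) (pairRV (fst \o fst \o fst) (rvZ1 \o snd)) q0.
have -> : entropy q (pairRV (pairRV (snd \o fst) (fst \o fst)) (pairRV (fst \o fst \o fst) (rvZ1 \o snd)))
    = entropy q (pairRV fst (rvZ1 \o snd)).
  by same_info_cases.
have -> : entropy q (pairRV (snd \o fst) (pairRV (fst \o fst \o fst) (rvZ1 \o snd)))
    = entropy q (pairRV (r01 \o fst) (rvZ1 \o snd)).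
  by rewrite /r01; same_info_cases.
have -> : entropy q (pairRV (fst \o fst) (pairRV (fst \o fst \o fst) (rvZ1 \o snd)))
    = entropy q (pairRV (fst \o fst) (rvZ1 \o snd)).
  by same_info_cases.
by rewrite /mi_diff; lra.
Qed.

End Decoupling.

Section InnerKernel.
Context {R : realType} {X Y1 Y2 Z1 Z2 : finType}.
Local Notation L := (letter X Y1 Y2 Z1 Z2).
Variable P : L -> R.
Hypotheses (hP : is_pmf P) (hZ2 : constant_Z2 P).

(** With [V = (U0, U2)] and [W = U1], the branch [I(U0; X | Z2)] of the maximum combines with
    [I(U2; X | U0, Z2)] to [I(V; X)] because [Z2] is constant, and [I(U1; X | U0, Z1)] dominates the
    bin rate. The exponents can only grow when [V] and [(V, W)] replace [U2] and [U1]. *)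
Lemma inner_region_kernel (R0 : R) (t : R * R) : inner_region P R0 0 0 t ->
  exists (A B : finType) (k : X -> A * B -> R),
    [/\ is_kernel k, rate_VX P k + bin_rate P k <= R0,
        t.1 <= exponent1 P k & t.2 <= exponent2 P k].
Proof.
move=> [_ _ [A0 [A1 [A2 [p0 [[hp hpP] mk [_ _ c3] e1 e2]]]]]].
have [||k hk ep] := @markov_kernel _ _ _ _ _ rvX (pairRV (pairRV (pairRV rvY1 rvY2) rvZ1) rvZ2) _ _ hP hp hpP.
- by move=> [[[[? ?] ?] ?] ?] [[[[? ?] ?] ?] ?]; rewrite /pairRV /rvX /rvY1 /rvY2 /rvZ1 /rvZ2/= => -> [] -> -> -> ->.
- have -> : fst = pairRV (pairRV (fun w : A0 * A1 * A2 * L => w.1.1.1) (fun w => w.1.1.2)) (fun w => w.1.2).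
    by apply/funext => -[[[? ?] ?] ?].
  exact: mk.
subst p0; have q0 w : 0 <= kjoint rvX P k w by exact: kjoint_ge0.
have hk' := decoupled_kernelP hk.
exists _, _, (decoupled_kernel k); split=> //.
- apply: le_trans (lerD (lexx _) (bin_rate_decoupled hP hk)) _.
  rewrite rate_VXE// mi_diff_decoupled02//.
  rewrite !addr0 in c3; apply: le_trans c3; rewrite !cond_mutual_info_mi_diff2// !cond_mutual_info_mi_diff//.
  have <- : mi_diff (kjoint rvX P k) (fun w => (w.1.1.1, w.1.2)) (fun w => (rvX w.2, rvZ2 w.2)) (fun w => rvZ2 w.2) =
      mi_diff (kjoint rvX P k) ((fun u => (u.1.1, u.2)) \o fst) (rvX \o snd) ((fun=> tt) \o snd).
    have zz w w' : kjoint rvX P k w != 0 -> kjoint rvX P k w' != 0 -> rvZ2 w.2 = rvZ2 w'.2.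
      rewrite /kjoint !mulf_eq0 !negb_or => /andP[Pw _] /andP[Pw' _].
      exact: (constant_Z2_support hP hZ2 Pw Pw').
    apply: eq_mi_diff => //.
    - by move=> w w' _ _ [].
    - by move=> w w' kw kw' /= ->; rewrite (zz w w').
    - by move=> w w' kw kw' _; exact: zz.
  set m := Num.max _ _.
  have : mi_diff (kjoint rvX P k) (fun w => w.1.1.1) (fun w => (rvX w.2, rvZ2 w.2)) (fun w => rvZ2 w.2) <= m.
    by rewrite /m le_max lexx orbT.
  rewrite /pairRV /comp; clear; lra.
- rewrite exponent1E//; apply: le_trans e1 _.
  rewrite cond_mutual_info_mi_diff//.
  apply: (@le_trans _ _ (mi_diff (kjoint rvX P k) (fst \o fst) (pairRV rvY1 rvZ1 \o snd) (rvZ1 \o snd))).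
    apply: mi_diff_monoU => //; first by move=> w w' _ _ [].
    by move=> w w' _ _ /= ->.
  rewrite -mi_diff_decoupled01//.
  apply: mi_diff_monoU; first by apply: kjoint_ge0.
    by move=> w w' _ _ [].
  by move=> w w' _ _ /= ->.
- rewrite exponent2E//; apply: le_trans e2 _.
  rewrite cond_mutual_info_mi_diff// mi_diff_decoupled02//.
  apply: mi_diff_monoU => //; first by move=> w w' _ _ [].
  by move=> w w' _ _ [].
Qed.

End InnerKernel.

Section Achievable.
Context {R : realType} {X Y1 Y2 Z1 Z2 : finType}.
Local Notation L := (letter X Y1 Y2 Z1 Z2).
Variable P : L -> R.
Hypothesis hP : is_pmf P.
Variable R0 : R.

Lemma alt_law_pmf : is_pmf (alt_law P).
Proof.
have [P0 P1] := hP; split=> [l|].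
  by rewrite /alt_law !mulr_ge0// ?invr_ge0 ?law_ge0.
rewrite -(sum_law1 _ (pairRV (pairRV rvX rvZ1) rvY1)) -P1 -(sum_law1 P (pairRV rvX rvZ1)) sum_pair.
apply: eq_bigr => -[a c] _; under eq_bigr do rewrite law_alt_law1//.
exact: sum_cond_law.
Qed.

Lemma prob_dec_le1 n (c : Defs.code n R0 0 0) b :
  prob_dec1 c (alt_law P) b <= 1 /\ prob_dec2 c (alt_law P) b <= 1.
Proof.
rewrite prob_dec1E prob_dec2E -(sum_nlaw rvX alt_law_pmf (enc_pmf c)).
have h := nlaw_ge0 rvX alt_law_pmf (enc_pmf c).
by split; rewrite big_mkcond/=; apply: ler_sum => w _; case: ifP.
Qed.

(** Error probabilities are at most 1, so every code has exponent at least 0; this keeps the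
    shrunken pairs of [inner_sub_region] nonnegative. *)
Lemma achievable_max0 (eps t1 t2 : R) : achievable P eps t1 t2 R0 0 0 ->
  achievable P eps (Num.max t1 0) (Num.max t2 0) R0 0 0.
Proof.
have e0 beta : (forall n, beta n <= 1) -> (0%:E <= error_exponent (R := R) beta)%E.
  by move=> h; apply: (@error_exponent_ge _ _ _ 0%N) => n _ _; rewrite mulr0 oppr0 powRr0.
case=> c [a1 a2 b1 b2]; exists c; split=> //.
  by rewrite /Num.max; case: ifP => // _; apply: e0 => n; case: (prob_dec_le1 (c n) false).
by rewrite /Num.max; case: ifP => // _; apply: e0 => n; case: (prob_dec_le1 (c n) false).
Qed.

Lemma achievable0 (eps : R) : 0 < eps -> achievable P eps 0 0 R0 0 0.
Proof.
move=> e; pose c n := sval (cid (trivial_code P R0 n e)).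
have e0 beta : (forall n, beta n <= 1) -> (0%:E <= error_exponent (R := R) beta)%E.
  by move=> h; apply: (@error_exponent_ge _ _ _ 0%N) => n _ _; rewrite mulr0 oppr0 powRr0.
exists c; split=> [n _|n _||].
- by case: (svalP (cid (trivial_code P R0 n e))).
- by case: (svalP (cid (trivial_code P R0 n e))).
- by apply: e0 => n; case: (prob_dec_le1 (c n) false).
- by apply: e0 => n; case: (prob_dec_le1 (c n) false).
Qed.

End Achievable.

Local Open Scope classical_set_scope.
Local Open Scope ring_scope.

Section InnerSubRegion.
Context {R : realType} {X Y1 Y2 Z1 Z2 : finType}.
Local Notation L := (letter X Y1 Y2 Z1 Z2).
Variable P : L -> R.
Hypotheses (hP : is_pmf P) (hZ2 : constant_Z2 P).
Variable R0 : R.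
Hypothesis hR0 : 0 <= R0.

Lemma inner_sub_region : inner_region P R0 0 0 `<=` exponents_region P R0 0 0.
Proof.
move=> t ht; have [t10 t20 _] := ht.
have [A [B [k [hk hR h1 h2]]]] := inner_region_kernel hP hZ2 ht.
have rv := rate_VX_ge0 hP hk; have rb := bin_rate_ge0 hP hk.
have u1 := exponent1_le hP hk; have u2 := exponent2_le hP hk.
(* At zero rate there is no room for a strict inequality, but both exponents are zero and the
   trivial code attains them. *)
move: hR0; rewrite le_eqVlt => /predU1P[R00|Rpos].
  apply: subset_closure.
  have e1 : t.1 = 0 by apply/eqP; rewrite eq_le t10; lra.
  have e2 : t.2 = 0 by apply/eqP; rewrite eq_le t20; lra.
  by split=> // eps /andP[e0 _]; rewrite e1 e2; exact: achievable0.
move=> N /nbhs_ballP[d/= d0 dN].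
set s := t.1 + t.2 + 1; have s0 : 0 < s by rewrite /s; lra.
(* [c] is the erasure probability. It costs each exponent at most [d / 4]; a further [d / 4] makes
   the exponent bounds strict, and the point stays within [d] of [t]. *)
pose c : R := Num.min (2^-1) (d / (4 * s)).
have c0 : 0 < c by rewrite lt_min invr_gt0 ltr0n/= divr_gt0 ?mulr_gt0.
have c1 : c <= 2^-1 by rewrite ge_min lexx.
have cd : c * (4 * s) <= d by rewrite -ler_pdivlMr ?mulr_gt0// ge_min lexx orbT.
have cs : c * s = c * t.1 + c * t.2 + c by rewrite /s; ring.
have ct1 : 0 <= c * t.1 by rewrite mulr_ge0// ltW.
have ct2 : 0 <= c * t.2 by rewrite mulr_ge0// ltW.
pose f (x : R) := Num.max ((1 - c) * x - d / 4) 0.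
exists (f t.1, f t.2); split.
  split=> /=; rewrite ?le_max ?lexx ?orbT// => eps heps.
  apply: achievable_max0 => //.
  apply: (@achievable_erased _ _ _ _ _ _ P hP _ _ k (1 - c) hk) => //.
  - by lra.
  - have : (1 - c) * (rate_VX P k + bin_rate P k) <= (1 - c) * R0.
      by rewrite ler_wpM2l//; lra.
    have : 0 < c * R0 by rewrite mulr_gt0.
    by lra.
  - have : (1 - c) * t.1 <= (1 - c) * exponent1 P k by rewrite ler_wpM2l//; lra.
    by lra.
  - have : (1 - c) * t.2 <= (1 - c) * exponent2 P k by rewrite ler_wpM2l//; lra.
    by lra.
apply: dN; split; rewrite /ball/= /f /Num.max ltr_distlC; case: ifP => /= h; apply/andP; split.
all: move: h; rewrite ?ltNge; try move=> /negbT; try move=> /negbFE; lra.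
Qed.

End InnerSubRegion.

Theorem theorem3 (R : realType) (X Y1 Y2 Z1 Z2 : finType)
    (P : letter X Y1 Y2 Z1 Z2 -> R)
    (hP : is_pmf P) (hZ2 : constant_Z2 P) (hless : less_noisy_Z1_Y2 P)
    (R0 : R) (hR0 : 0 <= R0) :
  exponents_region P R0 0 0 = inner_region P R0 0 0.
Proof.
apply/seteqP; split; first exact: region_sub_inner.
exact: inner_sub_region.
Qed.
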